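(* Let $L$ be a 2-complex with a single vertex and oriented edges, and let $K=K_1\vee\ldots\vee K_n\subseteq L$ be a subcomplex that is a wedge of subcomplexes $K_1,\ldots,K_n$. Assume that each $K_i$ is full, that the attaching maps of the 2-cells of $K$ have exponent sum zero, and that $L$ satisfies the weight test relative to $K$. Then $L$ is VA relative to $K$. If in addition the attaching maps of all 2-cells of $L$ have exponent sum zero, then all the inclusion induced homomorphisms $\pi_1(K_i)\to\pi_1(L)$, $i=1,\ldots,n$, are injective.
   Context: **Diagrams and relative VA.** A map of cell complexes is combinatorial if it maps open cells homeomorphically to open cells. A 2-complex is a 2-dimensional cell complex with combinatorial attaching maps. A spherical diagram over $L$ is a combinatorial map $f\colon C\to L$, where $C$ is a 2-sphere with a cell structure. The link $\mathrm{lk}(L,u)$ of a vertex $u$ is the boundary of a regular neighborhood of $u$, a graph whose edges are the corners of 2-cells at $u$; if $L$ has a single vertex it is written $\mathrm{lk}(L)$. For a vertex $v\in C$, $f$ induces a combinatorial map $\mathrm{lk}(C,v)\to\mathrm{lk}(L,f(v))$, whose image is a closed edge path $z(v)=c_1\ldots c_q$. A cycle (closed edge path) $e_1\ldots e_q$ in a graph, read cyclically, is homology reduced if it contains no pair $e_i,e_j$ with $e_i=\bar e_j$ (bar denotes opposite orientation). The vertex $v$ is a folding vertex if $z(v)$ is not homology reduced; if $c_i=\bar c_j$, the pair of 2-cells $(d_i,d_j)$ of $C$ containing the preimages of $c_i,c_j$ is a folding pair. For a subcomplex $K\subseteq L$, $L$ is VA relative to $K$ if every spherical diagram $f\colon C\to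 L$ with $f(C)\not\subseteq K$ has a folding vertex with a folding pair of 2-cells that map to 2-cells of $L-K$. **Further notions.** An attaching map of a 2-cell has exponent sum zero if, traveling around its boundary, one encounters the same number of positively as of negatively traversed edges. A subcomplex $K_i$ of $L$ is full if every 2-cell of $L$ all of whose boundary cells lie in $K_i$ belongs to $K_i$. **The graph $\mathrm{lk}(L,K)$.** If $X$ is the set of oriented edges of $L$, the vertices of $\mathrm{lk}(L)$ are $x^+,x^-$, $x\in X$, where $x^+$ is a point of $x$ close to its beginning and $x^-$ a point close to its end. If $y_1,\ldots,y_l$ are the edges of $K_i$, let $\Delta(K_i)$ be the graph with vertices $y_j^{\pm}$ (the vertices of $\mathrm{lk}(K_i)$) having one edge between every pair of distinct vertices and one loop at each vertex. $\Delta^+(K_i)$ and $\Delta^-(K_i)$ are the full subgraphs of $\Delta(K_i)$ on the vertices $y_j^+$ and $y_j^-$, respectively. The graph $\mathrm{lk}(L,K)$ is obtained from $\mathrm{lk}(L)$ by replacing, for each $i$, $\mathrm{lk}(K_i)$ by $\Delta(K_i)$ (same vertices; corners of 2-cells of $L$ not in $K$ are retained). Let $\Delta(K)=\Delta(K_1)\cup\ldots\cup\Delta(K_n)$ (disjoint union). **Relative weight test.** Assume the attaching maps of 2-cells of $K$ have exponent sum zero. $L$ satisfies the weight test relative to $K$ if there is a real-valued weight function $\omega$ on the set of edges of $\mathrm{lk}(L,K)$ such that (1) $\sum_i\omega(c_i)\le q-2$ if $c_1,\ldots,c_q$ are the corners of a 2-cell of $L$ not contained in $K$; (2) if $z=e_1\ldots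 e_m$ is a homology reduced cycle in $\mathrm{lk}(L,K)$ containing at least one edge from $\mathrm{lk}(L,K)-\Delta(K)$, then $\sum_{i=1}^m\omega(e_i)\ge 2$; (3) for each $i$, $\omega(c)=0$ if $c$ is an edge of $\Delta^+(K_i)$ or $\Delta^-(K_i)$, and $\omega(c)=1$ if $c$ is an edge of $\Delta(K_i)$ connecting a vertex of $\Delta^+(K_i)$ with a vertex of $\Delta^-(K_i)$. *)

(* Defs.v *)
From HB Require Import structures.
From mathcomp Require Import all_boot all_order all_algebra.
From mathcomp Require Import boolp classical_sets reals.

Set Implicit Arguments.
Unset Strict Implicit.
Unset Printing Implicit Defensive.

Import Order.TTheory GRing.Theory Num.Theory.

Local Open Scope classical_set_scope.

(* An oriented edge with a choice of direction: (x, true) traverses x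
   positively, (x, false) traverses it backwards. *)
Definition letter (X : Type) : Type := (X * bool)%type.
Definition linv X (l : letter X) : letter X := (l.1, ~~ l.2).

(* The boundary word [bd c] is the attaching map of c, read from a chosen base
   point in a chosen direction.  A combinatorial attaching map is defined on a
   circle having at least one edge, so the word is nonempty; it need not be
   reduced.  There are no finiteness assumptions. *)
Record complex := Complex {
  edge : Type;
  cell : Type;
  bd : cell -> seq (letter edge);
  bd_neq0 : forall c, 0 < size (bd c) }.

Definition bd_letter (L : complex) (c : cell L) (i : 'I_(size (bd c))) :
  letter (edge L) := tnth (in_tuple (bd c)) i.

Definition exponent_sum_zero (L : complex) (c : cell L) : Prop :=
  count (fun l => l.2) (bd c) = count (fun l => ~~ l.2) (bd c).

(* Subcomplexes are nonempty: they contain the vertex of L. *)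
Record subcomplex (L : complex) := Subcomplex {
  sub_edge : set (edge L);
  sub_cell : set (cell L);
  sub_closed : forall c, sub_cell c ->
    forall i : 'I_(size (bd c)), sub_edge (bd_letter i).1 }.

Definition full (L : complex) (K : subcomplex L) : Prop :=
  forall c : cell L,
    (forall i : 'I_(size (bd c)), sub_edge K (bd_letter i).1) -> sub_cell K c.

Definition is_wedge (L : complex) (K : subcomplex L)
    (n : nat) (Ki : 'I_n -> subcomplex L) : Prop :=
  [/\ sub_edge K = \bigcup_i sub_edge (Ki i),
      sub_cell K = \bigcup_i sub_cell (Ki i),
      trivIset setT (fun i => sub_edge (Ki i)) &
      trivIset setT (fun i => sub_cell (Ki i))].

(* Every geometric edge gives two distinct arcs a and [grev a], one for each
   orientation; this includes loops. *)
Record graph := Graph {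
  gvert : Type;
  garc : Type;
  gsrc : garc -> gvert;
  gtgt : garc -> gvert;
  grev : garc -> garc;
  grevK : involutive grev;
  grev_neq : forall a, grev a <> a;
  gsrc_rev : forall a, gsrc (grev a) = gtgt a }.

Definition gcycle (G : graph) (z : seq (garc G)) : Prop :=
  0 < size z /\
  forall i : 'I_(size z),
    gtgt (tnth (in_tuple z) i) = gsrc (tnth (in_tuple z) (ordS i)).

Definition homology_reduced (G : graph) (z : seq (garc G)) : Prop :=
  forall i j : 'I_(size z),
    tnth (in_tuple z) i <> grev (tnth (in_tuple z) j).

(* (x, true) is x^+, near the beginning of x; (x, false) is x^-, near its end.
   With this encoding the link vertex at the start of a letter is the letter
   itself, and the one at its end is the inverse letter. *)
Definition link_vert (L : complex) : Type := letter (edge L).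
Definition letter_start (L : complex) (l : letter (edge L)) : link_vert L := l.
Definition letter_end (L : complex) (l : letter (edge L)) : link_vert L :=
  linv l.

(* The corner (c, i) lies between the letters i-1 and i of [bd c], cyclically;
   its arc (c, i, true) runs from the former to the latter. *)
Definition corner (L : complex) : Type := {c : cell L & 'I_(size (bd c))}.
Definition corner_src (L : complex) (k : corner L) : link_vert L :=
  letter_end (bd_letter (ord_pred (tagged k))).
Definition corner_tgt (L : complex) (k : corner L) : link_vert L :=
  letter_start (bd_letter (tagged k)).

Section Link.
Variable L : complex.

Definition link_arc : Type := (corner L * bool)%type.
Definition link_src (a : link_arc) : link_vert L :=
  if a.2 then corner_src a.1 else corner_tgt a.1.
Definition link_tgt (a : link_arc) : link_vert L :=
  if a.2 then corner_tgt a.1 else corner_src a.1.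
Definition link_rev (a : link_arc) : link_arc := (a.1, ~~ a.2).

Fact link_revK : involutive link_rev.
Proof. by case=> k []. Qed.
Fact link_rev_neq a : link_rev a <> a.
Proof. by case: a => k []. Qed.
Fact link_src_rev a : link_src (link_rev a) = link_tgt a.
Proof. by case: a => k []. Qed.

Definition link : graph := Graph link_revK link_rev_neq link_src_rev.
End Link.

Section RelativeLink.
Variables (L : complex) (K : subcomplex L) (n : nat) (Ki : 'I_n -> subcomplex L).

Definition delta_vert (i : 'I_n) : Type := (set_type (sub_edge (Ki i)) * bool)%type.
Definition delta_val i (u : delta_vert i) : link_vert L := (val u.1, u.2).

(* An edge of Delta(K_i) between distinct vertices is an unordered pair, so its
   two orientations are the two ordered pairs; the two orientations of a loop
   are told apart by a boolean. *)
Inductive rel_arc : Type :=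
| Retained (k : corner L) of ~ sub_cell K (tag k) & bool
| DeltaEdge (i : 'I_n) (u v : delta_vert i) of u <> v
| DeltaLoop (i : 'I_n) (u : delta_vert i) of bool.

Definition rel_src (a : rel_arc) : link_vert L :=
  match a with
  | Retained k _ b => link_src (k, b)
  | DeltaEdge _ u _ _ => delta_val u
  | DeltaLoop _ u _ => delta_val u
  end.
Definition rel_tgt (a : rel_arc) : link_vert L :=
  match a with
  | Retained k _ b => link_tgt (k, b)
  | DeltaEdge _ _ v _ => delta_val v
  | DeltaLoop _ u _ => delta_val u
  end.
Definition rel_rev (a : rel_arc) : rel_arc :=
  match a with
  | Retained k kK b => Retained kK (~~ b)
  | DeltaEdge _ u v uv => DeltaEdge (not_eq_sym uv)
  | DeltaLoop _ u b => DeltaLoop u (~~ b)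
  end.

Definition delta_arc (i : 'I_n) (a : rel_arc) : Prop :=
  match a with
  | Retained _ _ _ => False
  | DeltaEdge j _ _ _ => j = i
  | DeltaLoop j _ _ => j = i
  end.

Fact rel_revK : involutive rel_rev.
Proof.
case=> [k kK b|i u v uv|i u b] /=; rewrite ?negbK //.
by rewrite (Prop_irrelevance (not_eq_sym (not_eq_sym uv)) uv).
Qed.
Fact delta_val_inj i : injective (@delta_val i).
Proof. by move=> [u b] [v c] [/val_inj -> ->]. Qed.
Fact rel_rev_neq a : rel_rev a <> a.
Proof.
case: a => [k kK b|i u v uv|i u b] e.
- have : (if rel_rev (Retained kK b) is Retained _ _ c then c else b) = b.
    by rewrite e.
  by case: (b).
- have : rel_src (rel_rev (DeltaEdge uv)) = delta_val u by rewrite e.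
  by move=> /delta_val_inj vu; case: (uv (esym vu)).
- have : (if rel_rev (DeltaLoop u b) is DeltaLoop _ _ c then c else b) = b.
    by rewrite e.
  by case: (b).
Qed.
Fact rel_src_rev a : rel_src (rel_rev a) = rel_tgt a.
Proof. by case: a => [k kK []|i u v uv|i u b]. Qed.

Definition rel_link : graph := Graph rel_revK rel_rev_neq rel_src_rev.
End RelativeLink.

Section WeightTest.
Local Open Scope ring_scope.

(* A weight on edges is a weight on arcs invariant under reversal. *)
Definition weight_test (R : realType) (L : complex) (K : subcomplex L)
    (n : nat) (Ki : 'I_n -> subcomplex L) : Prop :=
  exists omega : garc (rel_link K Ki) -> R,
  [/\ (forall a, omega (grev a) = omega a),
      (forall (c : cell L) (cK : ~ sub_cell K c),
         \sum_(i < size (bd c))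
            omega (Retained Ki (k := Tagged (fun c => 'I_(size (bd c))) i) cK true)
         <= (size (bd c))%:R - 2),
      (forall z : seq (garc (rel_link K Ki)),
         gcycle z -> homology_reduced z ->
         (exists j : 'I_(size z),
            ~ exists i, delta_arc i (tnth (in_tuple z) j)) ->
         2 <= \sum_(a <- z) omega a) &
      (forall (i : 'I_n) (a : garc (rel_link K Ki)), delta_arc i a ->
         ((gsrc a).2 = (gtgt a).2 -> omega a = 0) /\
         ((gsrc a).2 <> (gtgt a).2 -> omega a = 1))].

End WeightTest.

(* Cell structures on the 2-sphere, as combinatorial maps.  Darts are the
   directed edges; [einv d] is the reversed dart, and [fnext d] is the next
   dart along the boundary of the 2-cell on the left of d.  The 2-cells, edges
   and vertices are the orbits of [fnext], [einv] and [vnext], where [vnext]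
   rotates about the initial vertex of a dart; the surface is connected and has
   Euler characteristic 2.  The structure without edges is excluded, as it has
   no combinatorial map to a complex as above. *)
Record sphere := Sphere {
  dart : finType;
  einv : dart -> dart;
  fnext : dart -> dart;
  einvK : involutive einv;
  einv_neq : forall d, einv d != d;
  fnext_inj : injective fnext;
  sphere_connected : forall d d',
    connect (fun x y => (y == einv x) || (y == fnext x)) d d';
  sphere_euler :
    fcard (fun d => fnext (einv d)) dart + fcard fnext dart
    = fcard einv dart + 2 }.

Definition vnext (C : sphere) (d : dart C) : dart C := fnext (einv d).

(* A side of a 2-cell of L: a position in its boundary word and a direction of
   travel, [true] being that of the word. *)
Definition side (L : complex) : Type := (corner L * bool)%type.
Definition side_letter (L : complex) (s : side L) : letter (edge L) :=
  let l := bd_letter (tagged s.1) in if s.2 then l else linv l.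
Definition side_next (L : complex) (s : side L) : side L :=
  (Tagged (fun c => 'I_(size (bd c)))
     (if s.2 then ordS (tagged s.1) else ord_pred (tagged s.1)), s.2).

(* A combinatorial map to L, given by the side onto which each dart is mapped
   as an edge of the 2-cell on its left.  [diag_face] says that a 2-cell of C is
   mapped homeomorphically, not as a branched cover, and [diag_edge] that the
   two 2-cells along an edge agree on it. *)
Record spherical_diagram (L : complex) := SphericalDiagram {
  diag_sphere :> sphere;
  diag_side : dart diag_sphere -> side L;
  diag_next : forall d, diag_side (fnext d) = side_next (diag_side d);
  diag_face : forall d, order (@fnext _) d = size (bd (tag (diag_side d).1));
  diag_edge : forall d,
    side_letter (diag_side (einv d)) = linv (side_letter (diag_side d)) }.

Section VA.
Variables (L : complex) (f : spherical_diagram L).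

Definition diag_letter (d : dart f) : letter (edge L) := side_letter (diag_side d).
Definition diag_cell (d : dart f) : cell L := tag (diag_side d).1.

Definition diag_in (K : subcomplex L) : Prop :=
  (forall d : dart f, sub_edge K (diag_letter d).1) /\
  (forall d : dart f, sub_cell K (diag_cell d)).

(* The image in lk(L) of the corner at the start of d, in the 2-cell on the left
   of d, oriented towards d.  When d runs backwards along the letter i, its
   start is the end of that letter, which is at the corner i+1. *)
Definition diag_corner (d : dart f) : garc (link L) :=
  let s := diag_side d in
  if s.2 then (s.1, true)
  else (Tagged (fun c => 'I_(size (bd c))) (ordS (tagged s.1)), false).

(* A vertex of C is given by a dart d starting at it. *)
Definition vertex_path (d : dart f) : seq (garc (link L)) :=
  [seq diag_corner d' | d' <- orbit (@vnext f) d].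

Definition folding_vertex (d : dart f) : Prop :=
  ~ homology_reduced (vertex_path d).

(* A folding pair at the vertex of d; the two 2-cells are those on the left of
   d1 and d2. *)
Definition folding_pair (d d1 d2 : dart f) : Prop :=
  [/\ d1 \in orbit (@vnext f) d, d2 \in orbit (@vnext f) d &
      diag_corner d1 = grev (diag_corner d2)].

End VA.

Definition VA_relative (L : complex) (K : subcomplex L) : Prop :=
  forall f : spherical_diagram L, ~ diag_in f K ->
  exists d d1 d2 : dart f,
    [/\ folding_vertex d, folding_pair d d1 d2,
        ~ sub_cell K (diag_cell d1) & ~ sub_cell K (diag_cell d2)].

(* The edge-path group: as L has a single vertex, every word is a closed edge
   path. *)
Section Pi1.
Variable L : complex.
Notation word := (seq (letter (edge L))).

Inductive homotopic : word -> word -> Prop :=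
| homotopic_refl u : homotopic u u
| homotopic_sym u v : homotopic u v -> homotopic v u
| homotopic_trans u v w : homotopic u v -> homotopic v w -> homotopic u w
| homotopic_spur u v l : homotopic (u ++ v) (u ++ [:: l; linv l] ++ v)
| homotopic_cell u v c : homotopic (u ++ v) (u ++ bd c ++ v).

Definition word_inv (w : word) : word := rev (map (@linv _) w).

Definition pi1 : Type := set_type (range homotopic).
HB.instance Definition _ := Choice.on pi1.

Fact pi1_class_subproof w : homotopic w \in range homotopic.
Proof. by rewrite inE; exists w. Qed.
Definition pi1_class (w : word) : pi1 :=
  exist (fun A => A \in range homotopic) _ (pi1_class_subproof w).

Fact pi1_repr_subproof (g : pi1) : exists w, homotopic w = val g.
Proof. by case: g => A /=; rewrite inE => -[w _ <-]; exists w. Qed.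
Definition pi1_repr (g : pi1) : word := sval (cid (pi1_repr_subproof g)).

Lemma pi1_classP u v : pi1_class u = pi1_class v <-> homotopic u v.
Proof.
split=> [/(congr1 val) /= ->|uv]; first exact: homotopic_refl.
apply: val_inj => /=; apply/funext => w; apply/propext; split.
- exact: homotopic_trans (homotopic_sym uv).
- exact: homotopic_trans uv.
Qed.

Lemma pi1_reprK : cancel pi1_repr pi1_class.
Proof.
by move=> g; apply: val_inj; rewrite /= /pi1_repr; case: (cid _).
Qed.

Lemma homotopic_repr w : homotopic (pi1_repr (pi1_class w)) w.
Proof. by apply/pi1_classP; rewrite pi1_reprK. Qed.

Lemma homotopic_catl w u v : homotopic u v -> homotopic (w ++ u) (w ++ v).
Proof.
elim=> {u v} [u|u v _|u v t _ + _|u v l|u v c]; first exact: homotopic_refl.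
- exact: homotopic_sym.
- exact: homotopic_trans.
- rewrite !(catA w); exact: homotopic_spur.
- rewrite !(catA w); exact: homotopic_cell.
Qed.

Lemma homotopic_catr w u v : homotopic u v -> homotopic (u ++ w) (v ++ w).
Proof.
elim=> {u v} [u|u v _|u v t _ + _|u v l|u v c]; first exact: homotopic_refl.
- exact: homotopic_sym.
- exact: homotopic_trans.
- rewrite -!catA; exact: homotopic_spur.
- rewrite -!catA; exact: homotopic_cell.
Qed.

Lemma homotopic_cat u u' v v' :
  homotopic u u' -> homotopic v v' -> homotopic (u ++ v) (u' ++ v').
Proof.
move=> uu' vv'; apply: homotopic_trans (homotopic_catr _ uu') _.
exact: homotopic_catl.
Qed.

Lemma linvK : involutive (@linv (edge L)).
Proof. by case=> x []. Qed.

Lemma word_invK : involutive word_inv.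
Proof. by move=> w; rewrite /word_inv map_rev revK mapK //; exact: linvK. Qed.

Lemma homotopic_invr w : homotopic (w ++ word_inv w) [::].
Proof.
elim/last_ind: w => [|w l IHw]; first exact: homotopic_refl.
rewrite /word_inv map_rcons rev_rcons -cats1 -catA.
apply: homotopic_trans IHw; apply: homotopic_sym.
exact: (homotopic_spur w (word_inv w) l).
Qed.

Lemma homotopic_invl w : homotopic (word_inv w ++ w) [::].
Proof. by have := homotopic_invr (word_inv w); rewrite word_invK. Qed.

Definition pi1_one : pi1 := pi1_class [::].
Definition pi1_mul (g h : pi1) : pi1 := pi1_class (pi1_repr g ++ pi1_repr h).
Definition pi1_inv (g : pi1) : pi1 := pi1_class (word_inv (pi1_repr g)).

Lemma pi1_mul_class u v : pi1_mul (pi1_class u) (pi1_class v) = pi1_class (u ++ v).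
Proof. by apply/pi1_classP; apply: homotopic_cat; exact: homotopic_repr. Qed.

Fact pi1_mulA : associative pi1_mul.
Proof.
move=> g h k; rewrite -[g]pi1_reprK -[h]pi1_reprK -[k]pi1_reprK.
by rewrite !pi1_mul_class catA.
Qed.
Fact pi1_mul1 : left_id pi1_one pi1_mul.
Proof. by move=> g; rewrite -[g]pi1_reprK pi1_mul_class. Qed.
Fact pi1_1mul : right_id pi1_one pi1_mul.
Proof. by move=> g; rewrite -[g]pi1_reprK pi1_mul_class cats0. Qed.
Fact pi1_mulV : left_inverse pi1_one pi1_inv pi1_mul.
Proof.
move=> g; rewrite -{2}[g]pi1_reprK pi1_mul_class.
exact/pi1_classP/homotopic_invl.
Qed.
Fact pi1_Vmul : right_inverse pi1_one pi1_inv pi1_mul.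
Proof.
move=> g; rewrite -{1}[g]pi1_reprK pi1_mul_class.
exact/pi1_classP/homotopic_invr.
Qed.

HB.instance Definition _ :=
  isGroup.Build pi1 pi1_mulA pi1_mul1 pi1_1mul pi1_mulV pi1_Vmul.

Lemma pi1_classM u v : (pi1_class u * pi1_class v)%g = pi1_class (u ++ v).
Proof. exact: pi1_mul_class. Qed.

End Pi1.

Section Inclusion.
Variables (L : complex) (K : subcomplex L).

Definition sub_letter_val (l : letter (set_type (sub_edge K))) :
  letter (edge L) := (val l.1, l.2).

Definition restrict_letter (l : letter (edge L)) :
    option (letter (set_type (sub_edge K))) :=
  omap (fun x => (x, l.2)) (insub l.1).

(* On boundary words of 2-cells of K, [pmap] drops no letter; see [sub_bdE]. *)
Definition sub_bd (c : set_type (sub_cell K)) :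
    seq (letter (set_type (sub_edge K))) :=
  pmap restrict_letter (bd (val c)).

Lemma restrict_letterK (w : seq (letter (edge L))) :
  (forall i : 'I_(size w), sub_edge K (tnth (in_tuple w) i).1) ->
  map sub_letter_val (pmap restrict_letter w) = w.
Proof.
elim: w => //= -[x b] w IHw wK.
have xK : x \in sub_edge K by rewrite inE; exact: (wK ord0).
rewrite /restrict_letter /= insubT /= IHw // => i.
by have := wK (lift ord0 i); rewrite !(tnth_nth (x, b)).
Qed.

Lemma sub_bdE c : map sub_letter_val (sub_bd c) = bd (val c).
Proof.
apply: restrict_letterK => i; apply: sub_closed.
by have := valP c; rewrite inE.
Qed.

Fact sub_bd_neq0 c : 0 < size (sub_bd c).
Proof. by rewrite -(size_map sub_letter_val) sub_bdE bd_neq0. Qed.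

Definition complex_of_sub : complex := Complex sub_bd_neq0.

Lemma homotopic_incl (u v : seq (letter (edge complex_of_sub))) :
  homotopic u v -> homotopic (map sub_letter_val u) (map sub_letter_val v).
Proof.
elim=> {u v} [u|u v _|u v w _ + _|u v l|u v c]; first exact: homotopic_refl.
- exact: homotopic_sym.
- exact: homotopic_trans.
- rewrite !map_cat; exact: homotopic_spur.
- rewrite !map_cat sub_bdE; exact: homotopic_cell.
Qed.

Definition pi1_incl (g : pi1 complex_of_sub) : pi1 L :=
  pi1_class (map sub_letter_val (pi1_repr g)).

Lemma pi1_incl_class w : pi1_incl (pi1_class w) = pi1_class (map sub_letter_val w).
Proof. exact/pi1_classP/homotopic_incl/homotopic_repr. Qed.

Fact pi1_inclM : {morph pi1_incl : g h / (g * h)%g}.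
Proof.
move=> g h; rewrite -[g]pi1_reprK -[h]pi1_reprK.
by rewrite pi1_classM !pi1_incl_class pi1_classM map_cat.
Qed.
Fact pi1_incl1 : pi1_incl 1%g = 1%g.
Proof. exact: pi1_incl_class. Qed.

HB.instance Definition _ :=
  isMultiplicative.Build (pi1 complex_of_sub) (pi1 L) pi1_incl pi1_inclM.
HB.instance Definition _ :=
  Multiplicative_isUMagmaMorphism.Build (pi1 complex_of_sub) (pi1 L)
    pi1_incl pi1_incl1.

End Inclusion.

(* Main.v *)
(* A cell structure on a closed surface is a pair of permutations e, f of its
   darts; the vertices are the orbits of v = f o e, and planarity is an inequality
   between the numbers of orbits.

   Asphericity: detach from its vertex, one at a time, every dart of an edge whose
   two sides lie over K. A detachment adds a vertex and merges or splits faces, and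
   it loses at most one face with exponent sum zero; if the darts far from the cells
   outside K are detached first, each edge is finally cut off by a split that gains
   one. What remains is a planar map all of whose corners over K are edges of
   Delta(K), and in which enough faces have exponent sum zero for the combinatorial
   Gauss-Bonnet formula to contradict the weight test. At a vertex the inequality
   [>= 2] survives for cycles that are not homology reduced in Delta(K), since a
   cancelling pair of edges cuts the cycle into two.

   Injectivity: a word of K_i that is trivial in L bounds a planar map, built along
   the homotopy by splitting faces, by connected sums and by zipping edges. Folding
   pairs are removed by zipping the two mirror-image faces together edge by edge,
   which preserves planarity, so in the end no face lies over a 2-cell outside K.
   The detachment argument, with [exponent sum zero] replaced by
   [trivial in pi1(K_i)], then shows that the boundary word is trivial as well. *)

Require Import Defs.
From HB Require Import structures.
From mathcomp Require Import boolp classical_sets reals.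
From mathcomp Require Import fingroup perm.
From mathcomp Require Import all_boot all_order all_algebra.
From mathcomp Require Import zify ring lra.

Set Implicit Arguments.
Unset Strict Implicit.
Unset Printing Implicit Defensive.

(** * Cycles of a permutation multiplied by a transposition *)

(** A region of the sphere over K need not be a disc: only its boundary circles taken together have
    exponent sum zero, and it may touch itself at a vertex. Regions are therefore never formed. What
    is tracked is a property of cyclic words under which, for A, B and their concatenation, any two
    imply the third. Multiplying the face permutation by a transposition then changes the number of
    faces with the property by at most one, so vertices plus such faces can be followed like an
    Euler characteristic.

    The exponent sum enters because the weights 0 and 1 on Delta(K) turn the sum of 1 - omega around
    a face left over K into the number of sign changes along it. This number is at least 2 as soon
    as both signs occur, which exponent sum zero guarantees for a nonempty word.

    Planarity is defined for arbitrary pairs of permutations, not only when e is an involution,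
    since zipping two edges passes through a permutation that joins them into a four-cycle. Each
    surgery is then one or two multiplications by transpositions, checked by counting orbits. *)

Section PermCycles.
Variable T : finType.
Implicit Types (s : {perm T}) (x y z : T) (l A B : seq T).

Lemma mem_porbit_fconnect s x y : (y \in porbit s x) = fconnect s x y.
Proof.
apply/porbitP/idP=> [[i ->]|xy]; first by rewrite permX fconnect_iter.
by exists (findex s x y); rewrite permX iter_findex.
Qed.

Lemma porbit_cycle s l x : fcycle s l -> x \in l -> porbit s x = [set y in l].
Proof.
by move=> sl xl; apply/setP=> y; rewrite mem_porbit_fconnect (fconnect_cycle sl) // inE.
Qed.

Lemma porbit_orbit s x : porbit s x = [set y in orbit s x].
Proof. by apply: porbit_cycle; [exact: cycle_orbit perm_inj _|exact: in_orbit]. Qed.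

Lemma card_porbit_order s x : #|porbit s x| = order s x.
Proof. by apply: eq_card => y; rewrite mem_porbit_fconnect. Qed.

Lemma orbit_eq_in s s' x : {in orbit s x, s =1 s'} -> orbit s' x = orbit s x.
Proof.
move=> ss'; have c' : fcycle s' (orbit s x).
  apply: (sub_in_cycle (P := mem (orbit s x)) (e := frel s)).
  - by move=> y z yo _ /= /eqP<-; rewrite -ss'.
  - exact/allP.
  - exact: cycle_orbit perm_inj _.
rewrite (orbitE c') ?orbit_uniq ?in_orbit //.
suff -> : index x (orbit s x) = 0 by rewrite rot0.
by rewrite /orbit -orderSpred /= eqxx.
Qed.

Lemma perm_closed s (U : {set T}) : {homo s : x / x \in U} ->
  forall x, (s x \in U) = (x \in U).
Proof.
move=> sU x; apply/idP/idP=> [sxU|]; last exact: sU.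
have -> : x = iter (order s (s x)).-1 s (s x).
  by rewrite -iterSr orderSpred; apply: (@perm_inj _ s); rewrite -iterS iterSr (iter_order perm_inj).
elim: (_.-1) => //= n; exact: sU.
Qed.

Lemma porbit_closed s (U : {set T}) x : {homo s : x / x \in U} -> x \in U ->
  porbit s x \subset U.
Proof.
move=> sU xU; apply/subsetP=> y /porbitP[i ->]; rewrite permX.
by elim: i => //= i; exact: sU.
Qed.

Lemma porbit_perm1 s x : porbit s (s x) = porbit s x.
Proof. by have := porbit_perm s 1 x; rewrite expg1. Qed.

Lemma fpath_tperm s x y z A : x \notin A -> y \notin A ->
  fpath (tperm x y * s)%g x (rcons A z) = fpath s y (rcons A z).
Proof.
have aux a B : x \notin a :: B -> y \notin a :: B ->
    fpath (tperm x y * s)%g a (rcons B z) = fpath s a (rcons B z).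
  elim: B a => [|b B IHB] a; rewrite !inE ?negb_or /=.
    by move=> xa ya; rewrite permM tpermD.
  move=> /and3P[xa xb xB] /and3P[ya yb yB].
  by rewrite permM tpermD // IHB // inE negb_or ?xb ?yb.
case: A => [|a A] /= xA yA; first by rewrite permM tpermL.
by rewrite permM tpermL aux.
Qed.

(** Precomposing with [tperm x y] exchanges the successors of x and y. These are the last entries of
    the two blocks, so a block runs into the other one under one permutation exactly when the other
    one closes up under the other permutation. *)
Lemma cycle_tperm s x y A B : uniq (rcons A x ++ rcons B y) ->
  fcycle (tperm x y * s)%g (rcons A x ++ rcons B y)
  = fcycle s (rcons A x) && fcycle s (rcons B y).
Proof.
rewrite cat_uniq !rcons_uniq has_rcons !negb_or => /and3P[/andP[xA _] /andP[yA AB] /andP[yB _]].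
rewrite mem_rcons inE negb_or in yA; case/andP: yA => _ yA.
have xB : x \notin B.
  by apply: contra AB => xB; apply/hasP; exists x; rewrite // mem_rcons mem_head.
rewrite !(cycle_path x) last_cat !last_rcons cat_path last_rcons andbC.
by rewrite fpath_tperm // tpermC fpath_tperm // andbC.
Qed.

Lemma cycle_tpermV s x y A B : uniq (rcons A x ++ rcons B y) ->
  fcycle s (rcons A x ++ rcons B y)
  = fcycle (tperm x y * s)%g (rcons A x) && fcycle (tperm x y * s)%g (rcons B y).
Proof.
by move=> u; rewrite -cycle_tperm // mulgA tperm2 mul1g.
Qed.

Lemma split_orbit s x y : x != y -> y \in porbit s x ->
  exists A B, uniq (rcons A x ++ rcons B y) /\ fcycle s (rcons A x ++ rcons B y).
Proof.
move=> xy; rewrite mem_porbit_fconnect fconnect_orbit.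
have := cycle_orbit (@perm_inj _ s) x; have := orbit_uniq s x.
rewrite /orbit -orderSpred /=; set p := traject _ _ _ => u c.
rewrite inE eq_sym (negPf xy) /= => /splitPr pE; case: pE u c => B A u c.
exists A, B; have -> : rcons A x ++ rcons B y = rot (size B).+2 (x :: B ++ y :: A).
  have -> : x :: B ++ y :: A = (x :: rcons B y) ++ A by rewrite /= cat_rcons.
  have -> : (size B).+2 = size (x :: rcons B y) by rewrite /= size_rcons.
  by rewrite rot_size_cat -cat_rcons.
by rewrite rot_uniq rot_cycle.
Qed.

(** Otherwise two successive multiplications by [tperm x y] would both lower the number of orbits,
    although together they restore s. *)
Lemma porbit_merge s x y : y \notin porbit s x -> y \in porbit (tperm x y * s)%g x.
Proof.
move=> yx; have /= := porbits_mul_tperm s x y; rewrite porbit_sym yx.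
have xy : x != y by apply: contra yx => /eqP->; exact: porbit_id.
case: (boolP (y \in porbit _ _)) => // ny; have /= := porbits_mul_tperm (tperm x y * s)%g x y.
by rewrite porbit_sym ny mulgA tperm2 mul1g xy /= => e1 e2; lia.
Qed.

End PermCycles.

(** * Orbits whose word has a two-out-of-three property *)

Section GoodOrbits.
Variables (T : finType) (P : pred (seq T)).
(** The model for P is that a word has trivial value in some group: rotation is conjugation, and any
    two of A, B, A ++ B with P force the third. *)
Hypothesis P_rot : forall A B, P (A ++ B) -> P (B ++ A).
Hypothesis P_cat : forall A B, P A -> P B -> P (A ++ B).
Hypothesis P_catl : forall A B, P A -> P (A ++ B) -> P B.
Implicit Types (s : {perm T}) (x y z : T) (l A B : seq T) (U V : {set T}).

Definition good_orbit s x := P (orbit s x).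
Definition good_orbits s := [set porbit s x | x in good_orbit s].
Definition all_good s := [forall x, good_orbit s x].
(* For [k = 2] a single bad orbit counts more than a good one. *)
Definition phi k s := #|good_orbits s| + k * ~~ all_good s.

Lemma P_rotE n l : P (rot n l) = P l.
Proof.
have aux m k : P k -> P (rot m k) by rewrite -{1}(cat_take_drop m k); exact: P_rot.
apply/idP/idP; last exact: aux.
by move=> /(aux (size (rot n l) - n)); rewrite -/(rotr n (rot n l)) rotK.
Qed.

Lemma good_cycle s l x : fcycle s l -> uniq l -> x \in l -> good_orbit s x = P l.
Proof.
by move=> sl ul xl; rewrite /good_orbit (orbitE sl ul xl) P_rotE.
Qed.

Lemma good_porbit s x y : y \in porbit s x -> good_orbit s y = good_orbit s x.
Proof.
rewrite porbit_orbit inE => yx.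
by rewrite (good_cycle (cycle_orbit perm_inj x) (orbit_uniq _ _) yx).
Qed.

Let restr s U := #|[set porbit s x | x in [set x in U | good_orbit s x]]|.
Let gdin s U := [forall x in U, good_orbit s x].

Lemma card_good_orbitsID s U : {homo s : x / x \in U} ->
  #|good_orbits s| = restr s (~: U) + restr s U.
Proof.
move=> sU; rewrite /restr -cardsUI -imsetU.
rewrite (_ : _ :&: _ = set0) ?cards0 ?addn0.
  apply: eq_card => O; apply/imsetP/imsetP=> -[x xg ->]; exists x => //.
    by rewrite !inE -topredE /=; move: xg; rewrite -topredE /= => ->; rewrite !andbT orNb.
  by move: xg; rewrite !inE => /orP[]/andP[].
apply/setP=> O; rewrite !inE; apply/negbTE/negP=> /andP[/imsetP[x]].
rewrite !inE => /andP[xU _] -> /imsetP[y]; rewrite !inE => /andP[yU _] /eqP.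
rewrite eq_sym eq_porbit_mem porbit_sym => /(subsetP (porbit_closed sU yU)).
by rewrite (negPf xU).
Qed.

Lemma all_goodID s U : all_good s = gdin s (~: U) && gdin s U.
Proof.
apply/forallP/andP=> [g|[/forallP g1 /forallP g2] x].
  by split; apply/forallP=> x; rewrite g implybT.
by have := g1 x; have := g2 x; rewrite inE; case: (x \in U).
Qed.

Lemma restr_cycle s l : fcycle s l -> uniq l -> l != [::] ->
  restr s [set x in l] = P l /\ gdin s [set x in l] = P l.
Proof.
move=> sl ul l0; have [x xl] : exists x, x \in l by case: l l0 {sl ul} => // a l _; exists a; exact: mem_head.
have gl y : y \in l -> good_orbit s y = P l by exact: good_cycle.
split; last first.
  apply/forallP/idP=> [/(_ x)|Pl y]; rewrite inE; first by rewrite xl gl.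
  by apply/implyP=> /gl ->.
rewrite /restr; case Pl: (P l).
  rewrite (_ : imset _ _ = [set [set y in l]]) ?cards1 //.
  apply/setP=> O; rewrite !inE; apply/imsetP/eqP=> [[y]|->].
    by rewrite !inE => /andP[yl _] ->; exact: porbit_cycle.
  by exists x; rewrite ?inE ?xl ?gl // (porbit_cycle sl).
rewrite (_ : imset _ _ = set0) ?cards0 //; apply/setP=> O; rewrite inE.
by apply/negP=> /imsetP[y]; rewrite !inE => /andP[yl]; rewrite gl ?Pl.
Qed.

Lemma restr_eq s s' U : {homo s : x / x \in U} -> {in U, s =1 s'} ->
  restr s U = restr s' U /\ gdin s U = gdin s' U.
Proof.
move=> sU ss'; have oE x : x \in U -> orbit s' x = orbit s x.
  move=> xU; apply: orbit_eq_in => y.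
  rewrite -fconnect_orbit -mem_porbit_fconnect.
  by move=> /(subsetP (porbit_closed sU xU)) /ss'.
have gE x : x \in U -> good_orbit s' x = good_orbit s x by move=> xU; rewrite /good_orbit oE.
split.
  rewrite /restr (_ : [set x in U | good_orbit s' x] = [set x in U | good_orbit s x]).
    congr #|pred_of_set _|; apply: eq_in_imset => x; rewrite inE => /andP[xU _].
    by rewrite !porbit_orbit oE.
  by apply/setP=> x; rewrite !inE; case xU: (x \in U) => //=; exact: gE.
by apply: eq_forallb => x; case xU: (x \in U) => //=; rewrite gE.
Qed.

(** N and b are the contributions of the orbits off A and B, where the two permutations agree. *)
Lemma split_counts s x y A B : uniq (rcons A x ++ rcons B y) ->
  fcycle s (rcons A x ++ rcons B y) ->
  let s' := (tperm x y * s)%g in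
  exists N b, [/\ #|good_orbits s| = N + P (rcons A x ++ rcons B y),
    #|good_orbits s'| = N + (P (rcons A x) + P (rcons B y)),
    all_good s = b && P (rcons A x ++ rcons B y) &
    all_good s' = b && (P (rcons A x) && P (rcons B y))].
Proof.
set a := rcons A x; set b := rcons B y => u c s'.
have := c; rewrite cycle_tpermV // => /andP[ca cb].
set U := [set z in a ++ b].
have sU : {homo s : z / z \in U} by move=> z; rewrite !inE; exact: (mem_fcycle c).
have s'U : {homo s' : z / z \in U}.
  move=> z; rewrite !inE !mem_cat => /orP[]; rewrite -/s' in ca cb.
    by move=> /(mem_fcycle ca) ->.
  by move=> /(mem_fcycle cb) ->; rewrite orbT.
have sC : {homo s : z / z \in ~: U} by move=> z; rewrite inE => zU; rewrite inE perm_closed.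
have ss' : {in ~: U, s =1 s'}.
  move=> z; rewrite !inE mem_cat !mem_rcons !inE !negb_or => /andP[/andP[zx _] /andP[zy _]].
  by rewrite permM tpermD // eq_sym.
have [rE gE] := restr_eq sC ss'.
have [ua ub] : uniq a /\ uniq b by move: u; rewrite cat_uniq => /and3P[].
have a0 : a != [::] by rewrite /a; case: (A).
have b0 : b != [::] by rewrite /b; case: (B).
have ab0 : a ++ b != [::] by rewrite /a; case: (A).
have [r1 g1] := restr_cycle c u ab0.
have [ra ga] := restr_cycle ca ua a0; have [rb gb] := restr_cycle cb ub b0.
exists (restr s (~: U)), (gdin s (~: U)); split.
- by rewrite (card_good_orbitsID sU) r1.
- rewrite (card_good_orbitsID s'U) -rE; congr (_ + _); rewrite -ra -rb -/s' /restr -cardsUI -imsetU.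
  rewrite [X in _ + #|pred_of_set X|](_ : _ :&: _ = set0) ?cards0 ?addn0.
    rewrite (_ : [set z in U | _] = [set z in [set w in a] | good_orbit s' z] :|:
      [set z in [set w in b] | good_orbit s' z]) //.
    by apply/setP=> z; rewrite !inE mem_cat andb_orl.
  apply/setP=> O; rewrite !inE; apply/negbTE/negP=> /andP[/imsetP[z]].
  rewrite !inE => /andP[za _] -> /imsetP[t]; rewrite !inE => /andP[tb _] /eqP.
  rewrite eq_porbit_mem (porbit_cycle cb tb) inE => zb.
  by move: u; rewrite cat_uniq => /and3P[_ /hasPn /(_ _ zb)]; rewrite /= za.
- by rewrite (all_goodID s U) g1.
- rewrite (all_goodID s' U) -gE; congr (_ && _); rewrite -ga -gb.
  apply/forallP/andP=> [g|[/forallP g2 /forallP g3] z].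
    by split; apply/forallP=> z; have := g z; rewrite !inE mem_cat; case: (z \in a); case: (z \in b).
  by have := g2 z; have := g3 z; rewrite !inE mem_cat; case: (z \in a); case: (z \in b).
Qed.

(** P holds for all three of the words involved, for exactly one, or for none. The critical case is
    that only the concatenation is good: a good orbit is lost while the second summand of [phi] may
    rise by k, so the total moves by -1 at least and by k - 1 at most. *)
Lemma phi_split k s x y A B : k <= 2 -> uniq (rcons A x ++ rcons B y) ->
  fcycle s (rcons A x ++ rcons B y) ->
  phi k s <= phi k (tperm x y * s)%g + 1 /\ phi k (tperm x y * s)%g <= phi k s + 1.
Proof.
move=> k2 u c; have [N [b [e1 e2 e3 e4]]] := split_counts u c.
rewrite /phi e1 e2 e3 e4; set a := rcons A x; set d := rcons B y.
have h1 := @P_cat a d; have h2 := @P_catl a d.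
have h3 : P d -> P (a ++ d) -> P a by move=> Pd /P_rot; exact: P_catl.
move: h1 h2 h3; case: (P a); case: (P d); case: (P (a ++ d)) => h1 h2 h3;
  try (by have := h1 isT isT); try (by have := h2 isT isT); try (by have := h3 isT isT);
  case: b {e3 e4} => /=; rewrite ?muln0 ?muln1 ?addn0 /=; split; clear -k2; lia.
Qed.

(** A merge is a split read backwards, which is where the second bound of [phi_split] is used. *)
Lemma phi_tperm k s x y : k <= 2 -> phi k s <= phi k (tperm x y * s)%g + 1.
Proof.
move=> k2; have [->|xy] := eqVneq x y; first by rewrite tperm1 mul1g leq_addr.
have [yx|yx] := boolP (y \in porbit s x).
  by have [A [B [u c]]] := split_orbit xy yx; case: (phi_split k2 u c).
have [A [B [u c]]] := split_orbit xy (porbit_merge yx).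
by have [_] := phi_split k2 u c; rewrite mulgA tperm2 mul1g.
Qed.

(** The block x, y is cut out of its orbit. Since the block is good, the remainder is good exactly
    when the whole orbit was, so the block is a pure gain. *)
Lemma phi_isolate k s x y : P [:: x; y] -> s x = y -> s y != x -> 
  phi k (tperm y ((s^-1)%g x) * s)%g = phi k s + 1.
Proof.
move=> Pxy sx syx; set w := (s^-1)%g x.
have sw : s w = x by rewrite permKV.
have wx : w != x.
  by apply/eqP=> wx; move: sw; rewrite wx sx => yx; move: syx; rewrite yx sx yx eqxx.
have wy : y != w by apply: contra syx => /eqP->; rewrite sw.
have wyo : w \in porbit s y.
  by rewrite -sx porbit_perm1 -sw porbit_perm1 porbit_id.
have [A [B [u c]]] := split_orbit wy wyo.
have [N [b [e1 e2 e3 e4]]] := split_counts u c.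
have AE : A = [:: x].
  have := c; rewrite cycle_tpermV // => /andP[cA _].
  have uA : uniq (rcons A y) by move: u; rewrite cat_uniq => /and3P[].
  have cxy : fcycle (tperm y w * s)%g [:: x; y].
    by rewrite /= !permM tpermL sw tpermD ?sx ?eqxx // eq_sym //;
      apply/eqP=> yx; move: syx; rewrite -yx in sx *; rewrite sx eqxx.
  have xy : x != y by apply/eqP=> yx; move: syx; rewrite -yx in sx *; rewrite sx eqxx.
  have e : rcons A y =i [:: x; y].
    move=> z; have yA : y \in rcons A y by rewrite mem_rcons mem_head.
    have yx : y \in [:: x; y] by rewrite !inE eqxx orbT.
    by move/setP/(_ z): (porbit_cycle cA yA); rewrite (porbit_cycle cxy yx) !inE.
  have sA : size (rcons A y) = 2.
    have /perm_size -> // : perm_eq (rcons A y) [:: x; y].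
    by apply: uniq_perm => //=; rewrite inE xy.
  move: sA uA e {u c e1 e2 e3 e4 cA}; rewrite size_rcons => -[]; case: A => // a [] // _ /= _ e.
  have : x \in [:: a; y] by rewrite e mem_head.
    by rewrite !inE (negPf xy) orbF => /eqP ->.
rewrite /phi e1 e2 e3 e4 AE [rcons [:: x] y]/= Pxy.
have -> : P ([:: x; y] ++ rcons B w) = P (rcons B w) by apply/idP/idP; [exact: P_catl|exact: P_cat].
by rewrite add1n addnS addSn addn1.
Qed.

End GoodOrbits.

(** * Connectivity under two permutations *)

Section Connectivity.
Variable T : finType.
Implicit Types (s t : {perm T}) (x y z : T).

Definition step s t : rel T := fun x y => (y == s x) || (y == t x).
Definition conn s t : rel T := connect (step s t).

Lemma conn_perml s t x : conn s t x (s x).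
Proof. by apply: connect1; rewrite /step eqxx. Qed.

Lemma conn_permr s t x : conn s t x (t x).
Proof. by apply: connect1; rewrite /step eqxx orbT. Qed.

Lemma conn_min s t (C : rel T) : reflexive C -> transitive C ->
  (forall x, C x (s x)) -> (forall x, C x (t x)) ->
  forall x y, conn s t x y -> C x y.
Proof.
move=> C0 C2 Cs Ct x y /connectP[p]; elim: p x => [|z p IHp] x /=; first by move=> _ ->.
case/andP=> xz /IHp zy /zy; apply: C2.
by case/orP: xz => /eqP->.
Qed.

Lemma conn_sym s t : connect_sym (step s t).
Proof.
suff h x y : conn s t x y -> conn s t y x by move=> x y; apply/idP/idP; exact: h.
move: x y; apply: conn_min => [x|y x z xy yz|x|x]; first exact: connect0.
- exact: connect_trans yz xy.
- have : fconnect s (s x) x by rewrite (fconnect_sym (@perm_inj _ s)) fconnect1.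
  by apply: connect_sub => u w /eqP<-; exact: conn_perml.
- have : fconnect t (t x) x by rewrite (fconnect_sym (@perm_inj _ t)) fconnect1.
  by apply: connect_sub => u w /eqP<-; exact: conn_permr.
Qed.

Lemma conn_porbitr s t x y : y \in porbit t x -> conn s t x y.
Proof.
rewrite mem_porbit_fconnect; apply: connect_sub => u w /eqP<-; exact: conn_permr.
Qed.

End Connectivity.

(** * Detaching darts *)

Section Detach.
Variables (T : finType) (e : {perm T}).
Hypotheses (eK : involutive e) (e_neq : forall x, e x != x).
Implicit Types (s v : {perm T}) (x y z d : T) (l : seq T).

Definition detach d s : {perm T} := (tperm d ((s^-1)%g d) * s)%g.

Lemma detachE d s x :
  detach d s x = if x == d then d else if s x == d then s d else s x.
Proof.
rewrite permM; case: eqVneq => [->|xd]; first by rewrite tpermL permKV.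
case: eqVneq => [sxd|sxd]; first by rewrite -{2}sxd permK tpermR.
by rewrite tpermD // eq_sym //; apply: contra sxd => /eqP->; rewrite permKV.
Qed.

Lemma porbit_detach d s x : x != d -> porbit (detach d s) x = porbit s x :\ d.
Proof.
move=> xd; have [dx|dx] := boolP (d \in porbit s x); last first.
  rewrite porbit_orbit (@orbit_eq_in _ s).
    rewrite -porbit_orbit; apply/setP=> y; rewrite !inE andbC.
    by case: eqVneq => [->|]; rewrite ?andbT // (negPf dx).
  move=> y; rewrite -fconnect_orbit -mem_porbit_fconnect detachE => yx.
  case: eqVneq yx => [-> dx'|_ yx]; first by rewrite dx' in dx.
  by case: eqVneq => // syd; move: dx; rewrite -syd -eq_porbit_mem porbit_perm1 eq_porbit_mem yx.
have := cycle_orbit (@perm_inj _ s) d; have := orbit_uniq s d.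
have xo : x \in orbit s d by rewrite -fconnect_orbit -mem_porbit_fconnect porbit_sym.
have sE : porbit s x = [set z in orbit s d].
  by rewrite -porbit_orbit; apply/eqP; rewrite eq_porbit_mem -porbit_sym.
move: xo sE; rewrite /orbit -orderSpred /=; case/lastP: (traject _ _ _) => [|B w].
  by rewrite inE (negPf xd).
move=> xo sE u c.
have wE : (s^-1)%g d = w.
  by move: c; rewrite rcons_path last_rcons => /andP[_ /eqP/= <-]; rewrite permK.
have : fcycle s (d :: rcons B w) by [].
rewrite -[d :: _]/(rcons [::] d ++ rcons B w) cycle_tpermV // => /andP[_ cB].
rewrite /detach wE (porbit_cycle cB).
  rewrite sE; apply/setP=> z; rewrite !inE; case: eqVneq => //= ->.
  by case/andP: u => /negPf.
by move: xo; rewrite inE (negPf xd).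
Qed.

Definition detach_seq v l := foldr detach v l.

Lemma detach_seq_fix v l x : x \in l -> detach_seq v l x = x.
Proof.
elim: l => //= d l IHl; rewrite inE detachE; case: eqVneq => //= xd /IHl ->.
by rewrite (negPf xd).
Qed.

Lemma porbit_detach_seq v l x : x \notin l ->
  porbit (detach_seq v l) x = porbit v x :\: [set y in l].
Proof.
elim: l => /= [_|d l IHl]; first by apply/setP=> y; rewrite !inE.
rewrite inE negb_or => /andP[xd xl]; rewrite porbit_detach // IHl //.
by apply/setP=> y; rewrite !inE negb_or andbA.
Qed.

Lemma porbit_fix s x : s x = x -> porbit s x = [set x].
Proof.
move=> sx; apply/setP=> y; rewrite inE; apply/idP/eqP=> [/porbitP[i ->]|->].
  by rewrite permX; elim: i => //= i ->.
exact: porbit_id.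
Qed.

Lemma fix_porbit s x : (forall y, y \in porbit s x -> y = x) -> s x = x.
Proof. by apply; rewrite -porbit_perm1 porbit_id. Qed.

Variables (KK : {set T}) (Phi : {perm T} -> nat) (v : {perm T}).
Hypothesis KKe : forall x, (e x \in KK) = (x \in KK).
Hypothesis Phi_tperm : forall s x y, Phi s <= Phi (tperm x y * s)%g + 1.
(** For a face permutation, [s x = e x] says that the face turns back at the end of the edge of x,
    where no other edge is attached. The product cuts this edge off, with x and [e x] as its only
    face. *)
Hypothesis Phi_isolate : forall s x, x \in KK -> s x = e x -> s (e x) != x ->
  Phi (tperm (e x) ((s^-1)%g x) * s)%g = Phi s + 1.

Let rt x := fingraph.root (step e v) x.
(** A component inside KK has no dart outside KK from which a depth could be measured. One dart of
    it, the canonical representative, is kept for this purpose. *)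
Definition KK_roots := [set x | (rt x == x) && [forall y, conn e v x y ==> (y \in KK)]].

Let base := [set x | [exists y in porbit v x, (y \notin KK) || (y \in KK_roots)]].
(** Breadth-first search on vertices; the condition for entering a ball is invariant under rotation
    about the vertex. *)
Fixpoint ball k := if k is k'.+1 then
  ball k' :|: [set x | [exists y in porbit v x, e y \in ball k']] else base.

Lemma ball_porbit k x y : y \in porbit v x -> (y \in ball k) = (x \in ball k).
Proof.
rewrite -eq_porbit_mem => /eqP yx; elim: k => [|k IHk] /=; first by rewrite !inE yx.
by rewrite !inE IHk yx.
Qed.

Lemma ball_ex x : exists k, x \in ball k.
Proof.
have [y xy yB] : exists2 y, conn e v x y & (y \notin KK) || (y \in KK_roots).
  have [/existsP[y /andP[xy yK]]|/existsPn xK] :=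
    boolP [exists y, conn e v x y && (y \notin KK)]; first by exists y; rewrite ?yK.
  exists (rt x); first exact: connect_root.
  apply/orP; right; rewrite inE /rt root_root ?eqxx; last exact: conn_sym.
  apply/forallP=> y; apply/implyP=> xy; have := xK y; rewrite negb_and negbK.
  by rewrite (_ : conn e v x y) //; apply: connect_trans (connect_root _ x) xy.
have [p] := connectP xy; elim: p x {xy} => [|z p IHp] x /=.
  by move=> _ <-; exists 0; rewrite inE; apply/existsP; exists y; rewrite porbit_id.
case/andP=> xz /IHp h /h{h}[k zk]; case/orP: xz => /eqP zE; subst z.
  by exists k.+1; rewrite /= !inE; apply/orP; right; apply/existsP; exists x; rewrite porbit_id.
by exists k; rewrite -(ball_porbit k (y := v x)) // -porbit_perm1 porbit_id.
Qed.

Definition depth x := ex_minn (ball_ex x).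

Lemma depth_porbit x y : y \in porbit v x -> depth y = depth x.
Proof.
move=> yx; rewrite /depth; case: ex_minnP => m ym mP; case: ex_minnP => n xn nP.
by apply/eqP; rewrite eqn_leq mP ?nP ?(ball_porbit _ yx) // -(ball_porbit _ yx).
Qed.

Lemma depth0 x : (depth x == 0) = (x \in base).
Proof.
rewrite /depth; case: ex_minnP => m xm mP; apply/eqP/idP=> [m0|x0]; first by rewrite m0 in xm.
by apply/eqP; rewrite -leqn0 mP.
Qed.

Lemma depth_desc x : 0 < depth x -> exists2 y, y \in porbit v x & depth (e y) < depth x.
Proof.
rewrite {1 3}/depth; case: ex_minnP => -[|m] //= xm mP _.
case/setUP: xm => [/mP|]; first by rewrite ltnn.
rewrite inE => /existsP[y /andP[yx ym]]; exists y => //.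
by rewrite /depth ltnS; case: ex_minnP => n _; exact.
Qed.

(** The parent edges form a spanning forest: [pick] selects one edge towards smaller depth at each
    vertex of positive depth. *)
Definition parent x := [pick y in porbit v x | depth (e y) < depth x] == Some x.

Lemma parent_ex x : 0 < depth x -> exists2 y, y \in porbit v x & parent y.
Proof.
move=> /depth_desc[y yx yd].
case E: [pick y in porbit v x | depth (e y) < depth x] => [z|]; last first.
  by move: E; case: pickP => // /(_ y) /=; rewrite yx yd.
have /andP[zx _] : (z \in porbit v x) && (depth (e z) < depth x).
  by move: E; case: pickP => // w h [<-].
exists z => //; rewrite /parent; have /eqP -> : porbit v z == porbit v x by rewrite eq_porbit_mem.
by rewrite (depth_porbit zx) E.
Qed.

Lemma parent_depth x : parent x -> depth (e x) < depth x.
Proof. by rewrite /parent; case: pickP => // y /andP[yx yd] /eqP[yE]; move: yd; rewrite yE. Qed.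

Lemma parent_uniq x y : y \in porbit v x -> parent x -> parent y -> x = y.
Proof.
move=> yx; rewrite /parent; have /eqP -> : porbit v y == porbit v x by rewrite eq_porbit_mem.
by rewrite (depth_porbit yx) => /eqP -> /eqP[].
Qed.

(* [foldr] starts from the end of [todo], hence with the deepest darts. Then a
   parent dart is alone at its vertex when its reverse is detached, so that each
   edge is isolated by one of the detachments. *)
Let todo : seq T := sort (fun x y => depth x <= depth y)
  [seq x <- enum KK | ~~ parent x && (x \notin KK_roots)].

Lemma mem_todo x : (x \in todo) = [&& x \in KK, ~~ parent x & x \notin KK_roots].
Proof. by rewrite mem_sort mem_filter mem_enum andbC. Qed.

Lemma off_base x y : 0 < depth x -> y \in porbit v x -> (y \in KK) && (y \notin KK_roots).
Proof.
rewrite lt0n depth0 inE negb_exists => /forallP/(_ y) + yx.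
by rewrite yx /= negb_or negbK.
Qed.

Lemma todo_mates x y : parent x -> y \in porbit v x -> y != x -> y \in todo.
Proof.
move=> px yx yNx; rewrite mem_todo; have x0 := leq_ltn_trans (leq0n _) (parent_depth px).
have /andP[-> ->] := off_base x0 yx; rewrite andbT /=.
by apply: contra yNx => py; rewrite (parent_uniq yx px py).
Qed.

Lemma detach_seq_todo x : x \in KK -> detach_seq v todo x = x.
Proof.
move=> xK; have [|xT] := boolP (x \in todo); first exact: detach_seq_fix.
apply: fix_porbit => y; rewrite porbit_detach_seq // !inE => /andP[yT yx].
apply/eqP/negPn/negP=> yNx; move: xT; rewrite mem_todo xK /= negb_and !negbK => /orP[px|xR].
  by rewrite (todo_mates px yx yNx) in yT.
have xy : conn e v x y by exact: conn_porbitr.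
move: yT; rewrite mem_todo; have := xR; rewrite inE => /andP[/eqP rx /forallP/(_ y)].
rewrite xy /= => -> /=; rewrite negb_and !negbK => /orP[py|].
  have := parent_depth py; rewrite (depth_porbit yx) (_ : depth x = 0) //.
  by apply/eqP; rewrite depth0 inE; apply/existsP; exists x; rewrite porbit_id xR orbT.
rewrite inE => /andP[/eqP ry _]; case/eqP: yNx; rewrite -rx -ry.
by apply/esym/(fingraph.rootP (@conn_sym _ e v)).
Qed.

Let M := [set x in KK | (x \notin KK_roots) && (e x \notin KK_roots)].
(** The darts of the edges that are isolated once l has been detached: each end is detached itself,
    or is a parent, which ends up alone when its mates are gone. *)
Let done l := [set x in M | ((x \in l) || parent x) && ((e x \in l) || parent (e x))].

(** The new vertex makes up for the possible loss in Phi. If [e d] is already alone, Phi rises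
    instead, and the total gain of 2 pays for d and [e d], the only darts that can enter [done]. *)
Lemma detach_step d l : d \in todo -> d \notin l ->
  (forall x, x \in todo -> depth d < depth x -> x \in l) -> {subset l <= todo} ->
  #|porbits (detach_seq v l)| + Phi (e * detach_seq v l)%g + #|done (d :: l)| <=
  #|porbits (detach_seq v (d :: l))| + Phi (e * detach_seq v (d :: l))%g + #|done l|.
Proof.
move=> dT dl deep lT; set s := detach_seq v l; rewrite /= -/s /detach; set w := (s^-1)%g d.
have := dT; rewrite mem_todo => /and3P[dK dp dR].
(* The vertex of d still carries a dart that is never detached, a base dart or the parent; hence d
   is not alone and its detachment does create a vertex. *)
have sd : s d != d.
  have [y yd yT] : exists2 y, y \in porbit v d & y \notin todo.
    have [d0|] := posnP (depth d).
      have: d \in base by rewrite -depth0 d0.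
      rewrite inE => /existsP[y /andP[yd yB]]; exists y => //.
      by rewrite mem_todo; case/orP: yB => [/negPf->|->] //; rewrite andbF andbF.
    by move=> /parent_ex[y yd py]; exists y; rewrite // mem_todo py andbF.
  apply/eqP=> /porbit_fix; rewrite porbit_detach_seq // => /setP/(_ y).
  rewrite !inE yd andbT (contra (lT y) yT) => /esym/eqP yE.
  by rewrite yE dT in yT.
have wd : w != d by apply: contra sd => /eqP wd; rewrite -{1}wd permKV.
have sw : s w = d by rewrite permKV.
have cs : #|porbits (tperm d w * s)%g| = #|porbits s| + 1.
  have dw : d \in porbit s w by have := mem_porbit s 1 w; rewrite expg1 sw.
  by have /= := porbits_mul_tperm s d w; rewrite dw addn0 eq_sym wd.
have eE : (e * (tperm d w * s) = tperm (e d) (e w) * (e * s))%g.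
  apply/perm.permP=> x; rewrite !permM; congr (s _).
  by rewrite (inj_tperm _ _ _ (@perm_inj _ e)) !eK.
have ew : ((e * s)^-1)%g d = e w.
  by apply: (@perm_inj _ (e * s)%g); rewrite permKV permM eK sw.
rewrite cs eE; have hA := Phi_tperm (e * s)%g (e d) (e w).
have [ed|ed] := boolP ((e d \in l) || parent (e d)).
  (* If [e d] is a parent, its mates are deeper than d, so [deep] puts them in l. *)
  have sed : s (e d) = e d.
    case/orP: ed => [|ped]; first exact: detach_seq_fix.
    have [|el] := boolP (e d \in l); first exact: detach_seq_fix.
    apply: fix_porbit => y; rewrite porbit_detach_seq // !inE => /andP[yl yed].
    apply/eqP/negPn/negP=> yN; move: yl; rewrite deep ?(todo_mates ped) //.
    by rewrite (depth_porbit yed); have := parent_depth ped; rewrite eK.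
  have hB : Phi (tperm (e d) (e w) * (e * s))%g = Phi (e * s)%g + 1.
    by rewrite -ew; apply: Phi_isolate; rewrite ?permM ?eK.
  have : #|done (d :: l)| <= #|done l| + 2.
    apply: (@leq_trans #|done l :|: [set d; e d]|).
      apply/subset_leq_card/subsetP=> x; rewrite !inE.
      have -> : (e x == d) = (x == e d) by rewrite -(inj_eq (@perm_inj _ e)) eK.
      case: (x == d); first by rewrite !orbT.
      by case: (x == e d); rewrite ?orbT ?orbF /= ?implybT // => ->.
    by apply: leq_trans (leq_card_setU _ _) _; rewrite leq_add2l cards2; case: (_ != _).
  by rewrite hB; move: #|porbits s| (Phi _) #|done (d :: l)| #|done l| => a b c f; lia.
have -> : done (d :: l) = done l.
  apply/setP=> x; rewrite !inE.
  have -> : (e x == d) = (x == e d) by rewrite -(inj_eq (@perm_inj _ e)) eK.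
  case: (eqVneq x d) => [->|xd].
    by rewrite (negPf ed) (eq_sym d) (negPf (e_neq d)) (negPf ed) !andbF.
  case: (eqVneq x (e d)) => [->|xed] //.
  by rewrite /= (negPf ed) /= !andbF.
by move: hA; move: #|porbits s| (Phi _) (Phi _) #|done l| => a b c f; lia.
Qed.

(** The sequence of detachments is hidden in the statement; the clause on I carries any invariant of
    a single detachment over to [v']. A root exempts the two darts of its edge from the gain, whence
    the term [2 * #|KK_roots|]. *)
Lemma detach_count : exists2 v' : {perm T}, (forall x, x \in KK -> v' x = x) &
  #|porbits v| + Phi (e * v)%g + #|KK| <= #|porbits v'| + Phi (e * v')%g + 2 * #|KK_roots|
  /\ (forall I : {perm T} -> Prop, I v ->
        (forall s d, d \in KK -> I s -> I (detach d s)) -> I v').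
Proof.
exists (detach_seq v todo); first exact: detach_seq_todo.
have h l : (exists m, todo = m ++ l) ->
    #|porbits v| + Phi (e * v)%g + #|done l| <=
    #|porbits (detach_seq v l)| + Phi (e * detach_seq v l)%g + #|done [::]|.
  elim: l => [|d l IHl] [m mE]; first exact: leqnn.
  have := IHl (ex_intro _ (rcons m d) _); rewrite mE cat_rcons => /(_ erefl) {}IHl.
  have uT : uniq todo by rewrite sort_uniq filter_uniq ?enum_uniq.
  have dl : d \notin l by move: uT; rewrite mE cat_uniq /= => /and4P[].
  have dT : d \in todo by rewrite mE mem_cat mem_head orbT.
  have lT : {subset l <= todo} by move=> x xl; rewrite mE mem_cat inE xl !orbT.
  suff deep x : x \in todo -> depth d < depth x -> x \in l by have := detach_step dT dl deep lT; lia.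
  rewrite {1}mE mem_cat inE => /orP[xm|/orP[/eqP->|//]]; last by rewrite ltnn.
  have tr : transitive (fun x y => depth x <= depth y) by move=> a b c; exact: leq_trans.
  have : sorted (fun x y => depth x <= depth y) todo.
    by apply: sort_sorted => a b; exact: leq_total.
  rewrite (sorted_pairwise tr) mE pairwise_cat => /and3P[/allrelP/(_ x d xm) + _ _].
  by rewrite mem_head ltnNge => ->.
(* The depth drops along a parent, so the two darts of an edge cannot both be parents. *)
have done0 : done [::] = set0.
  apply/setP=> x; rewrite !inE /=; apply/negP=> /andP[_ /andP[/parent_depth]].
  by move=> + /parent_depth; rewrite eK => /ltnW; rewrite leqNgt => /negP.
have doneT : done todo = M.
  apply/setP=> x; rewrite in_set; case xM: (x \in M) => //=; move: xM; rewrite in_set => /and3P[xK xR eR].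
  by rewrite !mem_todo KKe xK xR eR /= andbT orNb andbT orNb.
split.
  have := h todo (ex_intro _ [::] erefl); rewrite done0 cards0 doneT.
  have : #|KK| <= #|M| + #|KK_roots| + #|KK_roots|.
    rewrite -{2}(card_imset (mem KK_roots) (@perm_inj _ e)).
    apply: leq_trans (subset_leq_card (_ : KK \subset M :|: KK_roots :|: e @: KK_roots)) _.
      apply/subsetP=> x xK; rewrite in_setU in_setU in_set xK /=.
      case: (x \in KK_roots) => //=; case xR: (e x \in KK_roots) => //=.
      by apply/imsetP; exists (e x).
    by apply: leq_trans (leq_card_setU _ _) _; rewrite leq_add2r leq_card_setU.
  move: #|KK| #|M| #|KK_roots| #|porbits v| #|porbits _| (Phi _) (Phi _) => a b c f g i j; lia.
move=> I Iv Id; have : {subset todo <= KK} by move=> x; rewrite mem_todo => /andP[].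
elim: todo => //= d l IHl lK; apply: Id; first by apply: lK; rewrite mem_head.
by apply: IHl => x xl; apply: lK; rewrite inE xl orbT.
Qed.
End Detach.

(** * Counting orbits *)

Section PorbitCounts.
Variable T : finType.
Implicit Types (s t h : {perm T}) (x y z : T).

Lemma big_porbits (R : Type) (idx : R) (op : Monoid.com_law idx) s (F : T -> R) :
  \big[op/idx]_x F x = \big[op/idx]_(O in porbits s) \big[op/idx]_(x in O) F x.
Proof.
rewrite (partition_big (porbit s) (mem (porbits s))) => [|x _]; last exact: imset_f.
apply: eq_bigr => _ /imsetP[y _ ->]; apply: eq_bigl => x /=.
by rewrite eq_porbit_mem.
Qed.

Lemma card_porbits_involution s : involutive s -> (forall x, s x != x) ->
  2 * #|porbits s| = #|T|.
Proof.
move=> sK s_neq; have -> : #|T| = \sum_(x : T) 1 by rewrite sum1_card.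
rewrite (big_porbits addn s) -sum1_card big_distrr /=; apply: eq_bigr => _ /imsetP[x _ ->].
rewrite sum1_card (@porbit_cycle _ _ [:: x; s x]).
- have <- : #|[:: x; s x]| = 2 by rewrite (card_uniqP _) //= inE eq_sym s_neq.
  by rewrite muln1; apply: eq_card => y; rewrite inE.
- by rewrite /= sK !eqxx.
- exact: mem_head.
Qed.

Lemma card_porbits_tperm s x y : x != y ->
  #|porbits (tperm x y * s)%g| = #|porbits s| + 1 \/
  y \in porbit (tperm x y * s)%g x /\ #|porbits (tperm x y * s)%g| + 1 = #|porbits s|.
Proof.
move=> xy; have /= := porbits_mul_tperm s x y; rewrite porbit_sym xy.
have [|yx] := boolP (y \in porbit s x); first by rewrite addn0; left.
by right; split; [exact: porbit_merge|lia].
Qed.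

Lemma porbit_conj s h x : porbit (s ^ h)%g (h x) = h @: porbit s x.
Proof.
have hE i z : ((s ^ h) ^+ i)%g (h z) = h ((s ^+ i)%g z).
  by rewrite -conjXg conjgE !permM permK.
apply/setP=> y; apply/porbitP/imsetP=> [[i ->]|[z /porbitP[i ->] ->]].
  by exists ((s ^+ i)%g x); rewrite ?mem_porbit.
by exists i; rewrite hE.
Qed.

Lemma card_porbitsC s t : #|porbits (s * t)%g| = #|porbits (t * s)%g|.
Proof.
have -> : (t * s = (s * t) ^ s)%g by rewrite conjgE mulgA mulKg.
have -> : porbits ((s * t) ^ s)%g = (fun O : {set T} => s @: O) @: porbits (s * t)%g.
  apply/setP=> O; apply/imsetP/imsetP=> [[x _ ->]|[_ /imsetP[x _ ->] ->]].
    by exists (porbit (s * t)%g ((s^-1)%g x)); rewrite ?imset_f // -porbit_conj permKV.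
  by exists (s x); rewrite ?porbit_conj.
by rewrite card_imset //; exact: imset_inj perm_inj.
Qed.

End PorbitCounts.

(** * Planar maps *)

Section Planar.
Variable T : finType.
Implicit Types (s t e f : {perm T}) (x y z a b : T).

(* The set [Rt] meets every component, so that its size bounds the number of
   components; the inequality then says that the total genus is zero. *)
Definition planar e f := exists2 Rt : {set T},
  forall x, exists2 r, r \in Rt & conn e f x r &
  #|T| + 2 * #|Rt| <= #|porbits e| + #|porbits f| + #|porbits (e * f)%g|.

Lemma conn_swap s t : conn s t =2 conn t s.
Proof. by apply: eq_connect => x y; rewrite /step orbC. Qed.

Lemma planar_swap e f : planar e f -> planar f e.
Proof.
case=> Rt hit c; exists Rt; last by rewrite card_porbitsC (addnC #|porbits f|).
by move=> x; have [r rR xr] := hit x; exists r; rewrite // conn_swap.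
Qed.

(** Only the arrows of t at x and y change, and they are exchanged: their endpoints remain within
    reach of x or y. *)
Lemma conn_tperm s t x y a b : let c := conn s (tperm x y * t)%g in
  conn s t a b -> c a b \/ (c a x || c a y) /\ (c b x || c b y).
Proof.
set t' := (tperm x y * t)%g => c.
have cC : symmetric c by exact: conn_sym.
have c2 : transitive c by exact: connect_trans.
have c0 z : c z z by exact: connect0.
pose near z := c z x || c z y.
have near_c z w : c z w -> near w -> near z.
  by move=> zw /orP[] /(c2 _ _ _ zw) h; rewrite /near h ?orbT.
suff h : conn s t a b -> c a b || near a && near b.
  by move=> /h/orP[|/andP[]]; [left|right].
move: a b; apply: (@conn_min _ _ _ (fun a b => c a b || near a && near b)).
- by move=> z; rewrite c0.
- move=> z u w /orP[uz|/andP[nu nz]] /orP[zw|/andP[nz' nw]].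
  + by rewrite (c2 _ _ _ uz zw).
  + by rewrite nw (near_c u z) ?orbT.
  + by rewrite nu (near_c w z) ?orbT // cC.
  + by rewrite nu nw orbT.
- by move=> z; rewrite /c conn_perml.
- have xE : t' y = t x by rewrite permM tpermR.
  have yE : t' x = t y by rewrite permM tpermL.
  have ct z : c z (t' z) by exact: conn_permr.
  move=> z; case: (eqVneq z x) => [->|zx].
    by rewrite /near c0 -xE [c (t' y) y]cC ct !orbT.
  case: (eqVneq z y) => [->|zy].
    by rewrite /near c0 -yE [c (t' x) x]cC ct !orbT.
  have -> : t z = t' z by rewrite permM tpermD // eq_sym.
  by rewrite ct.
Qed.

(** The numbers of faces and of vertices each change by one. If both rise, a component may fall
    apart, and the gain of 2 pays for one more point in Rt. If one rises and the other falls, x and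
    y stay connected and Rt still works. The hypothesis excludes that both fall, which could add a
    handle. *)
Lemma planar_tpermr e f x y : planar e f ->
  y \in porbit f x \/ (e^-1)%g y \in porbit (e * f)%g ((e^-1)%g x) ->
  planar e (tperm x y * f)%g.
Proof.
have [->|xy] := eqVneq x y; first by rewrite tperm1 mul1g.
set f' := (tperm x y * f)%g; pose c := conn e f'.
case=> Rt hit cnt yx.
have eE : (e * f' = tperm ((e^-1)%g x) ((e^-1)%g y) * (e * f))%g.
  apply/perm.permP=> z; rewrite !permM; congr (f _).
  by rewrite (inj_tperm _ _ _ (@perm_inj _ e)) !permKV.
have xy' : (e^-1)%g x != (e^-1)%g y by rewrite (inj_eq perm_inj).
have cC : symmetric c by exact: conn_sym.
have c2 : transitive c by exact: connect_trans.
have stay : c x y -> #|porbits f| + #|porbits (e * f)%g| <=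
    #|porbits f'| + #|porbits (e * f')%g| -> planar e f'.
  move=> cxy le; exists Rt => [z|]; last by move: cnt le; lia.
  have [r rR zr] := hit z; exists r => //; case: (conn_tperm x y zr) => // -[zx rx].
  have zx' : c z x by case/orP: zx => // zy; apply: (c2 _ _ _ zy); rewrite cC.
  apply: (c2 _ _ _ zx'); rewrite cC; case/orP: rx => // ry; apply: (c2 _ _ _ ry); by rewrite cC.
have inc : #|porbits f| + #|porbits (e * f)%g| + 2 <=
    #|porbits f'| + #|porbits (e * f')%g| -> planar e f'.
  move=> le; have [r rR xr] := hit x; have rx : c r x || c r y.
    by case: (conn_tperm x y xr) => [|[]//]; rewrite -/f' -/c cC => ->.
  (* The old representative r stays connected to x or to y; w represents the part that may have been
     separated from it. *)
  pose w := if c r x then y else x; exists (w |: Rt) => [z|]; last first.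
    by have := cardsU1 w Rt; move: cnt le; case: (w \notin Rt) => /=; lia.
  have [r' r'R zr'] := hit z; case: (conn_tperm x y zr') => [h|[+ _]].
    by exists r'; rewrite // inE r'R orbT.
  rewrite -/f' -/c => zxy; rewrite /w; case: (boolP (c r x)) => rx'.
    case/orP: zxy => [zx|zy]; last by exists y; rewrite // !inE eqxx.
    by exists r; rewrite ?inE ?rR ?orbT //; apply: (c2 _ _ _ zx); rewrite cC.
  rewrite (negPf rx') /= in rx.
  case/orP: zxy => [zx|zy]; first by exists x; rewrite // !inE eqxx.
  by exists r; rewrite ?inE ?rR ?orbT //; apply: (c2 _ _ _ zy); rewrite cC.
have yv : (e^-1)%g y \in porbit (e * f')%g ((e^-1)%g x) -> c x y.
  move=> h; have ce z : c ((e^-1)%g z) z by rewrite /c -{2}(permKV e z); exact: conn_perml.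
  have c3 : c ((e^-1)%g x) ((e^-1)%g y).
    move: h; rewrite mem_porbit_fconnect => /connect_sub; apply => u w /eqP<- /=.
    by rewrite permM; apply: (c2) (conn_perml _ _ _) (conn_permr _ _ _).
  by apply: (c2) (c2 _ _ _ c3 (ce y)); rewrite cC.
have [f1|[f1 f2]] := card_porbits_tperm f xy.
  have [v1|[v1 v2]] := card_porbits_tperm (e * f)%g xy'; rewrite -eE in v1.
    by apply: inc; move: f1 v1; rewrite -/f'; lia.
  by apply: stay; [exact: yv|move: f1 v2; rewrite -eE -/f'; lia].
have [v1|[v1 v2]] := card_porbits_tperm (e * f)%g xy'.
  apply: stay; first exact: conn_porbitr.
  by move: f2 v1; rewrite -eE -/f'; lia.
exfalso; case: yx => yx.
  by have /= := porbits_mul_tperm f x y; rewrite porbit_sym yx xy -/f' addn0 -f2; move: #|_| => m; lia.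
have /= := porbits_mul_tperm (e * f)%g ((e^-1)%g x) ((e^-1)%g y).
by rewrite porbit_sym yx xy' addn0 -v2; move: #|_| => m; lia.
Qed.

Lemma planar_tperml e f x y : planar e f ->
  y \in porbit e x \/ y \in porbit (e * f)%g x -> planar (tperm x y * e)%g f.
Proof.
move=> /planar_swap pl yx; apply: planar_swap; apply: planar_tpermr => //.
case: yx => [->|yx]; [by left|right].
have -> : (f * e = (e * f) ^ f^-1)%g by rewrite conjgE invgK !mulgA mulgK.
by rewrite porbit_conj imset_f.
Qed.

(** As a and [e b] start at the same vertex, a can become the reverse of b. The first transposition
    splits that vertex and joins the two edges into the four-cycle [e a], a, b, [e b]; the second
    cuts this cycle into the two new edges. *)
Lemma planar_zip e f a b : involutive e -> (forall x, e x != x) -> planar e f ->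
  a != b -> a \in porbit (e * f)%g (e b) ->
  exists e' : {perm T}, [/\ involutive e', forall x, e' x != x, planar e' f, e' a = b &
    e' (e a) = e b /\ forall z, z \notin [:: a; b; e a; e b] -> e' z = e z].
Proof.
move=> eK e_neq pl ab abo; have eI := inj_eq (@perm_inj _ e).
have [eab|eab] := eqVneq (e a) b.
  by exists e; split=> //; split=> //; rewrite eK -eab eK.
have aeb : a != e b by rewrite -eI eK.
pose e1 := (tperm a (e b) * e)%g; pose e2 := (tperm (e a) b * e1)%g.
have pl1 : planar e1 f by apply: planar_tperml => //; right; rewrite porbit_sym.
have e1a : e1 (e a) = a by rewrite permM tpermD ?eK // ?eI eq_sym.
have e1a' : e1 a = b by rewrite permM tpermL eK.
have pl2 : planar e2 f.
  apply: planar_tperml => //; left; apply/porbitP; exists 2.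
  by rewrite permX /= e1a e1a'.
have e2E z : e2 z = if z == a then b else if z == b then a else
    if z == e a then e b else if z == e b then e a else e z.
  rewrite permM; case: (eqVneq z a) => [->|za]; first by rewrite tpermD ?e1a' // eq_sym.
  case: (eqVneq z b) => [->|zb]; first by rewrite tpermR.
  case: (eqVneq z (e a)) => [->|zea]; first by rewrite tpermL permM tpermD.
  rewrite tpermD 1?eq_sym // permM.
  case: (eqVneq z (e b)) => [->|zeb]; first by rewrite tpermR.
  by rewrite tpermD // eq_sym.
exists e2; split=> //.
- move=> z; rewrite (e2E z); case: (eqVneq z a) => [->|za].
    by rewrite e2E eq_sym (negPf ab) eqxx.
  case: (eqVneq z b) => [->|zb]; first by rewrite e2E eqxx.
  case: (eqVneq z (e a)) => [->|zea].
    by rewrite e2E eq_sym (negPf aeb) (negPf (e_neq b)) eI eq_sym (negPf ab) eqxx.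
  case: (eqVneq z (e b)) => [->|zeb].
    by rewrite e2E (negPf (e_neq a)) (negPf eab) eqxx.
  have h w : (e z == w) = (z == e w) by rewrite -eI eK.
  by rewrite e2E !h !eK (negPf zea) (negPf zeb) (negPf za) (negPf zb).
- move=> z; rewrite e2E; case: (eqVneq z a) => [->|za]; first by rewrite eq_sym.
  case: (eqVneq z b) => [->|zb] //; case: (eqVneq z (e a)) => [->|zea]; first by rewrite eI eq_sym.
  by case: (eqVneq z (e b)) => [->|zeb] //; rewrite eI.
- by rewrite e2E eqxx.
split; first by rewrite e2E (negPf (e_neq a)) (negPf eab) eqxx.
by move=> z; rewrite e2E !inE !negb_or => /and4P[/negPf-> /negPf-> /negPf-> /negPf->].
Qed.

(* Zips the face of [a] onto the mirror-image face of [b]. The hypothesis that [a]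
   and [e b] start at the same vertex is restored by each zip for the next one. *)
Lemma planar_mirror (X : Type) (li : X -> X) (lam : T -> X) e f a b :
  involutive li -> involutive e -> (forall x, e x != x) -> planar e f ->
  (forall x, lam (e x) = li (lam x)) -> b \notin porbit f a -> order f a = order f b ->
  (forall k, lam (iter k (f^-1)%g b) = li (lam (iter k f a))) ->
  a \in porbit (e * f)%g (e b) ->
  exists e' : {perm T}, [/\ involutive e', forall x, e' x != x, planar e' f,
    forall x, lam (e' x) = li (lam x) &
    forall k, k < order f a -> e' (iter k f a) = iter k (f^-1)%g b].
Proof.
move=> liK; set g := (f^-1)%g => eK e_neq pl lamE ba oE lamab abo.
have go : order g b = order f a by rewrite oE -!card_porbit_order porbitV.
have iter_neq (s : {perm T}) z i j : i < j -> j < order s z -> iter i s z != iter j s z.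
  move=> ij jo; apply/eqP=> /(congr1 (findex s z)).
  by rewrite !findex_iter ?(ltn_trans ij) // => e0; rewrite e0 ltnn in ij.
have ab_neq i j : iter i f a != iter j g b.
  apply: contra ba => /eqP ij; rewrite -eq_porbit_mem.
  have -> : porbit f b = porbit f (iter j g b) by rewrite -[LHS]porbitV -[RHS]porbitV -permX porbit_perm.
  by rewrite -ij -permX porbit_perm.
suff h k : k <= order f a -> exists e' : {perm T}, [/\ involutive e', forall x, e' x != x,
    planar e' f, forall x, lam (e' x) = li (lam x) &
    (k = 0 -> a \in porbit (e' * f)%g (e' b)) /\
    forall j, j < k -> e' (iter j f a) = iter j g b].
  by have [e' [? ? ? ? [_ ?]]] := h _ (leqnn _); exists e'.
elim: k => [|k IHk] ko; first by exists e.
have [e1 [e1K e1n pl1 lam1 [e10 e1k]]] := IHk (ltnW ko).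
set ak := iter k f a; set bk := iter k g b.
(* Rotation takes [e1 bk] to the previous dart of the b side, which is already zipped to the
   previous dart of the a side, and the next rotation step reaches [ak]. *)
have akb : ak \in porbit (e1 * f)%g (e1 bk).
  have [k0|k0] := posnP k; first by rewrite /ak /bk k0; exact: e10.
  apply/porbitP; exists 2; rewrite permX /= !permM e1K.
  have fbk : f bk = iter k.-1 g b by rewrite /bk -(prednK k0) iterS /g permKV.
  by rewrite fbk -e1k ?prednK // e1K -iterS prednK.
have [e2 [e2K e2n pl2 e2a [e2ea e2z]]] := planar_zip e1K e1n pl1 (ab_neq k k) akb.
exists e2; split=> //; last first.
  split=> // j; rewrite ltnS leq_eqVlt => /orP[/eqP->//|jk].
  rewrite e2z; first exact: e1k.
  rewrite !inE !negb_or ab_neq iter_neq //=; apply/andP; split.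
    rewrite -(inj_eq (@perm_inj _ e1)) e1K e1k // eq_sym; exact: ab_neq.
  by rewrite -(inj_eq (@perm_inj _ e1)) e1K e1k // iter_neq // go.
move=> x; have [xin|/e2z ->//] := boolP (x \in [:: ak; bk; e1 ak; e1 bk]).
have lam12 : lam bk = li (lam ak) by exact: lamab.
move: xin; rewrite !inE => /or4P[]/eqP->.
- by rewrite e2a lam12.
- by rewrite {1}/bk -e2a e2K lam12 liK.
- by rewrite e2ea !lam1 lamab -/ak.
- have -> : e2 (e1 bk) = e1 ak by rewrite -e2ea e2K.
  by rewrite !lam1 lam12 liK.
Qed.

Lemma conn_mul e f : conn e (e * f)%g =2 conn e f.
Proof.
move=> x y; apply/idP/idP; move: x y; apply: conn_min.
- by move=> x; exact: connect0.
- by move=> x y z; exact: connect_trans.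
- by move=> x; exact: conn_perml.
- by move=> x; rewrite permM; apply: connect_trans (conn_perml _ _ _) (conn_permr _ _ _).
- by move=> x; exact: connect0.
- by move=> x y z; exact: connect_trans.
- by move=> x; exact: conn_perml.
- move=> x; have -> : f x = (e * f)%g ((e^-1)%g x) by rewrite permM permKV.
  apply: connect_trans (conn_permr _ _ _).
  have := conn_perml e (e * f)%g ((e^-1)%g x); rewrite permKV.
  by rewrite /conn conn_sym.
Qed.

(** Euler's formula grants 2 for every point of Rt. A component inside KK spends its 2 on its root;
    a component with a dart outside KK keeps it. Everything is doubled because there are two darts
    per edge, which makes the surviving constant 4. *)
Lemma planar_detach e f (KK : {set T}) (Phi : {perm T} -> nat) :
  involutive e -> (forall x, e x != x) -> planar e f ->
  (forall x, (e x \in KK) = (x \in KK)) ->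
  (forall s x y, Phi s <= Phi (tperm x y * s)%g + 1) ->
  (forall s x, x \in KK -> s x = e x -> s (e x) != x ->
    Phi (tperm (e x) ((s^-1)%g x) * s)%g = Phi s + 1) ->
  exists2 v' : {perm T}, (forall x, x \in KK -> v' x = x) &
  #|T| + 2 * Phi f + 2 * #|KK| + 4 * [exists x, x \notin KK] <=
    2 * #|porbits v'| + 2 * Phi (e * v')%g + 2 * #|porbits f|
  /\ (forall I : {perm T} -> Prop, I (e * f)%g ->
        (forall s d, d \in KK -> I s -> I (detach d s)) -> I v').
Proof.
move=> eK e_neq [Rt hit cnt] KKe PhiA PhiB.
have [v' v'K [le ind]] := detach_count eK e_neq (e * f)%g KKe PhiA PhiB.
exists v' => //; split=> //.
have ee : (e * (e * f) = f)%g by apply/perm.permP=> x; rewrite !permM eK.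
have := card_porbits_involution eK e_neq.
rewrite ee in le; set R0 := KK_roots e KK (e * f)%g in le.
have : #|R0| + [exists x, x \notin KK] <= #|Rt|.
  pose rt := fingraph.root (step e (e * f)%g).
  have rtE x y : conn e f x y -> rt x = rt y.
    by rewrite -conn_mul => /(fingraph.rootP (@conn_sym _ e (e * f)%g)).
  have R0s : R0 \subset rt @: Rt.
    apply/subsetP=> x; rewrite inE => /andP[/eqP rx _]; have [r rR xr] := hit x.
    by apply/imsetP; exists r; rewrite // -(rtE _ _ xr).
  case: existsP => [[x xK]|_]; last first.
    by rewrite addn0; apply: leq_trans (subset_leq_card R0s) (leq_imset_card _ _).
  apply: leq_trans (leq_imset_card rt Rt); rewrite addn1.
  apply: proper_card; apply/properP; split=> //; have [r rR xr] := hit x.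
  exists (rt r); first exact: imset_f.
  apply: contra xK; rewrite inE -(rtE _ _ xr) => /andP[_ /forallP/(_ x)/implyP]; apply.
  by rewrite /conn conn_sym; exact: connect_root.
move: cnt le; move: #|T| #|R0| #|Rt| #|KK| #|porbits e| #|porbits f| #|porbits v'|
  #|porbits (e * f)%g| (Phi f) (Phi _).
by case: [exists x, _] => /=; lia.
Qed.

End Planar.

Import Order.TTheory GRing.Theory Num.Theory.

(** * Gauss-Bonnet and the weight test *)

Section Walks.
Local Open Scope ring_scope.
Variable G : graph.
Implicit Types (z : seq (garc G)) (u w : gvert G).

Fixpoint walk u z w : Prop :=
  if z is a :: z' then gsrc a = u /\ walk (gtgt a) z' w else u = w.

Lemma walk_cat u z1 z2 w : walk u (z1 ++ z2) w <-> exists2 t, walk u z1 t & walk t z2 w.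
Proof.
elim: z1 u => [|a z1 IHz] u /=; first by split=> [|[t ->]//]; exists u.
split=> [[au /IHz[t]]|[t [au h1] h2]]; first by exists t.
by split=> //; apply/IHz; exists t.
Qed.

Lemma walk_gcycle u z : (0 < size z)%N -> walk u z u -> gcycle z.
Proof.
move=> z0 zu; split=> // i; have a0 : garc G by case: z z0 {zu i}.
have step v w y k : walk v y w -> (k.+1 < size y)%N -> gtgt (nth a0 y k) = gsrc (nth a0 y k.+1).
  elim: y v k => [|a y IHy] v [|k] //=.
    by case: y {IHy} => [|b y] //= [_ [->]].
  by case=> _ /IHy; exact.
rewrite !(tnth_nth a0) /=; have [iz|] := ltnP i.+1 (size z).
  by rewrite modn_small //; exact: step zu _.
rewrite leq_eqVlt ltnS leqNgt ltn_ord orbF => /eqP iz; rewrite -iz modnn.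
have {iz} -> : nat_of_ord i = (size z).-1 by apply: succn_inj; rewrite -iz prednK.
rewrite nth_last; case/lastP: z z0 zu {i step} => // y a _.
rewrite -cats1 => /walk_cat[t yt [at_ au]]; rewrite last_cat /= au.
by case: y yt => [|b y] /= => [->|[-> _]].
Qed.

Variables (R : realType) (om : garc G -> R) (ret : garc G -> bool).
Hypothesis ret_rev : forall a, ret (grev a) = ret a.
Hypothesis om_ge0 : forall a, ~~ ret a -> 0 <= om a.
Hypothesis reduced_ge2 : forall z, gcycle z -> homology_reduced z -> has ret z ->
  2 <= \sum_(a <- z) om a.

Let om_seq_ge0 z : ~~ has ret z -> 0 <= \sum_(a <- z) om a.
Proof.
elim: z => [|a z IHz] /=; first by rewrite big_nil.
by rewrite negb_or big_cons => /andP[/om_ge0 a0 /IHz z0]; rewrite addr_ge0.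
Qed.

(* A pair of mutually inverse arcs cuts a closed walk into two closed walks. *)
Lemma walk_weight u z : walk u z u -> has ret z ->
  pairwise (fun a b => ~~ (ret a && `[< a = grev b >])) z -> 2 <= \sum_(a <- z) om a.
Proof.
have [m] := ubnP (size z); elim: m => // m IHm in u z *; rewrite ltnS => zm zu zr zp.
have [red|nred] := pselect (homology_reduced z).
  by apply: reduced_ge2 => //; apply: walk_gcycle zu; case: (z) zr.
have [z1 [a [z2 [b [z3 [zE ab]]]]]] : exists z1 a z2 b z3, z = z1 ++ a :: z2 ++ b :: z3 /\ a = grev b.
  have cut (i j : 'I_(size z)) : (i < j)%N -> tnth (in_tuple z) i = grev (tnth (in_tuple z) j) ->
      exists z1 a z2 b z3, z = z1 ++ a :: z2 ++ b :: z3 /\ a = grev b.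
    move=> ij; have a := tnth (in_tuple z) i; rewrite !(tnth_nth a) /= => aE.
    exists (take i z), (nth a z i), (take (j - i.+1) (drop i.+1 z)), (nth a z j), (drop j.+1 z).
    split; last exact: aE.
    rewrite -{1}(cat_take_drop i z) (drop_nth a) //; congr (_ ++ _ :: _).
    rewrite -{1}(cat_take_drop (j - i.+1) (drop i.+1 z)) drop_drop subnK //.
    by rewrite (drop_nth a (ltn_ord j)).
  have [i [j ij]] : exists i j : 'I_(size z), tnth (in_tuple z) i = grev (tnth (in_tuple z) j).
    by apply: contrapT => h; apply: nred => i j ij; apply: h; exists i, j.
  have [lt|lt|eq] := ltngtP i j; first exact: cut lt ij.
    by apply: (cut j i lt); rewrite ij grevK.
  by move: ij; rewrite (val_inj eq) => /esym/grev_neq.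
move: zp zr; rewrite zE; set r := (fun a b => _).
rewrite !(pairwise_cat, pairwise_cons, allrel_catr, allrel_consr, all_cat) /= -!andbA.
do 3![case/andP=> _]; case/andP=> p13; case/andP=> p1; case/andP=> _; case/andP=> abr.
do 3![case/andP=> _]; case/andP=> p2; case/andP=> _ p3.
have ra : ~~ ret a by move: abr; rewrite /r negb_and => /orP[//|/asboolPn]; case.
have rb : ~~ ret b by rewrite -ret_rev -ab.
have aw : gtgt a = gsrc b by rewrite -gsrc_rev ab grevK.
have bw : gsrc a = gtgt b by rewrite ab gsrc_rev.
move: zu; rewrite zE => /walk_cat[t u1 [at_]] /walk_cat[t2 u2 [bt u3]].
have w2 : walk (gtgt a) z2 (gtgt a) by rewrite {2}aw bt.
have w13 : walk u (z1 ++ z3) u by apply/walk_cat; exists t => //; rewrite -at_ bw.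
have s2 : (size z2 < m)%N.
  by apply: leq_trans zm; rewrite zE size_cat /= size_cat /= addnS ltnS; lia.
have s13 : (size (z1 ++ z3) < m)%N.
  by apply: leq_trans zm; rewrite zE !size_cat /= size_cat /= addnS ltnS; lia.
have p13' : pairwise r (z1 ++ z3) by rewrite pairwise_cat p13 p1.
have -> : \sum_(c <- z1 ++ a :: z2 ++ b :: z3) om c =
    \sum_(c <- z2) om c + \sum_(c <- z1 ++ z3) om c + (om a + om b).
  rewrite !big_cat big_cons /= big_cat big_cons /=; lra.
have a0 := om_ge0 ra; have b0 := om_ge0 rb.
rewrite has_cat /= has_cat /= (negPf ra) (negPf rb) /=.
(* A retained arc survives in one of the two pieces, where induction gives 2; a piece without any
   has nonnegative weight. *)
have [r2 _|r2] := boolP (has ret z2).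
  have h2 := IHm _ _ s2 w2 r2 p2; have [r13|/om_seq_ge0] := boolP (has ret (z1 ++ z3)); last by lra.
  by have := IHm _ _ s13 w13 r13 p13'; lra.
have h2 := om_seq_ge0 r2; rewrite -has_cat => r13.
by have := IHm _ _ s13 w13 r13 p13'; lra.
Qed.

End Walks.

Section PorbitSums.
Local Open Scope ring_scope.
Variable T : finType.
Implicit Types (s : {perm T}) (x y z : T).

Lemma sum_porbits_le (R : numDomainType) s (c : {set T} -> R) (g : T -> R) :
  (forall x, c (porbit s x) <= \sum_(y in porbit s x) g y) ->
  \sum_(O in porbits s) c O <= \sum_y g y.
Proof.
move=> h; rewrite (big_porbits +%R s); apply: ler_sum => _ /imsetP[x _ ->]; exact: h.
Qed.

Lemma sum_porbit_orbit (V : nmodType) s x (g : T -> V) :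
  \sum_(y in porbit s x) g y = \sum_(y <- orbit s x) g y.
Proof. by rewrite big_uniq ?orbit_uniq //; apply: eq_bigl => y; rewrite porbit_orbit inE. Qed.

Lemma sum_orbit_iter (V : nmodType) s x (g : T -> V) :
  \sum_(y <- orbit s x) g y = \sum_(k < fingraph.order s x) g (iter k s x).
Proof.
rewrite /orbit; elim: (fingraph.order s x) => [|m IHm]; first by rewrite big_nil big_ord0.
by rewrite trajectSr -cats1 big_cat big_seq1 big_ord_recr IHm.
Qed.

Lemma sum_porbit_perm (V : nmodType) s x (g : T -> V) :
  \sum_(y in porbit s x) g y = \sum_(y in porbit s x) g (s y).
Proof.
rewrite (reindex_inj (@perm_inj _ s)); apply: eq_bigl => y.
by rewrite -eq_porbit_mem porbit_perm1 eq_porbit_mem.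
Qed.

(** Around a cycle on which b takes both values, it has to fall somewhere and to rise again
    somewhere else. *)
Lemma sign_changes_ge2 (R : numDomainType) s (b : T -> bool) x y z :
  y \in porbit s x -> z \in porbit s x -> b y -> ~~ b z ->
  2 <= \sum_(w in porbit s x) (b w != b (s w))%:R :> R.
Proof.
have change (c : T -> bool) u t : u \in porbit s x -> t \in porbit s x -> c u -> ~~ c t ->
    exists2 w, w \in porbit s x & c w && ~~ c (s w).
  move=> ux tx cu ct; apply/exists_inP; apply: contraNT ct => /exists_inPn h.
  pose U := [set w in porbit s x | c w].
  have UU : {homo s : w / w \in U}.
    move=> w; rewrite !inE => /andP[wx cw]; have := h _ wx.
    by rewrite cw negbK => ->; rewrite andbT -eq_porbit_mem porbit_perm1 eq_porbit_mem.
  have uU : u \in U by rewrite inE ux.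
  have : t \in porbit s u by move: ux; rewrite -eq_porbit_mem => /eqP->.
  by move/(subsetP (porbit_closed UU uU)); rewrite inE => /andP[].
move=> yx zx by_ bz; have [w1 w1x /andP[b1 b1']] := change b y z yx zx by_ bz.
have [|w2 w2x /andP[b2 b2']] := change (fun w => ~~ b w) z y zx yx bz; first by rewrite by_.
have w12 : w2 != w1 by apply: contra b2 => /eqP->.
rewrite (bigD1 w1) //= (bigD1 w2) ?w2x //= b1 (negPf b1') (negPf b2) (negbNE b2') addrA /=.
by rewrite -[2]/(1 + 1) lerDl sumr_ge0.
Qed.

End PorbitSums.

(** * Sides of 2-cells, exponent sums and maps over L *)

Section Sides.
Local Open Scope ring_scope.
Variable L : complex.
Implicit Type s : side L.

(** The formula of [diag_corner], for a side rather than for a dart of a diagram. *)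
Definition side_corner s : link_arc L :=
  if s.2 then (s.1, true)
  else (Tagged (fun c => 'I_(size (bd c))) (ordS (tagged s.1)), false).

Lemma side_corner_tag s : tag (side_corner s).1 = tag s.1.
Proof. by rewrite /side_corner; case: s.2. Qed.

Lemma side_corner_tgt s : link_tgt (side_corner s) = side_letter s.
Proof.
by case: s => -[c i] []; rewrite /side_corner /link_tgt /side_letter //= /corner_src /= ordSK.
Qed.

Lemma side_corner_next_src s : link_src (side_corner (side_next s)) = linv (side_letter s).
Proof.
case: s => -[c i] []; rewrite /side_corner /link_src /side_letter /=.
  by rewrite /corner_src /= ordSK.
by rewrite /corner_tgt /= ord_predK linvK.
Qed.

Lemma iter_ordS_inj q (i : 'I_q) : injective (fun k : 'I_q => iter k (@ordS q) i).
Proof.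
have vE k : val (iter k (@ordS q) i) = ((i + k) %% q)%N.
  elim: k => [|k IHk] /=; first by rewrite addn0 modn_small.
  by rewrite IHk -addn1 modnDml -addnA addn1.
move=> k k' /(congr1 val); rewrite !vE => /eqP; rewrite eqn_modDl !modn_small //.
by move/eqP/val_inj.
Qed.

Lemma iter_ord_pred_inj q (i : 'I_q) : injective (fun k : 'I_q => iter k (@ord_pred q) i).
Proof.
move=> k k' kk'; apply: (@iter_ordS_inj q (iter k (@ord_pred q) i)).
have aux m : iter m (@ordS q) (iter m (@ord_pred q) i) = i.
  by elim: m => // m IHm; rewrite iterSr [iter m.+1 _ i]iterS ord_predK.
by rewrite {2}kk' !aux.
Qed.

Lemma sum_sides (V : nmodType) (F : side L -> V) s :
  \sum_(k < size (bd (tag s.1))) F (iter k (@side_next L) s) =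
  \sum_(i < size (bd (tag s.1))) F (Tagged (fun c => 'I_(size (bd c))) i, s.2).
Proof.
case: s => -[c i] b /=.
have -> : \sum_(k < size (bd c)) F (iter k (@side_next L) (existT _ c i, b)) =
    \sum_(k < size (bd c)) F (Tagged (fun c => 'I_(size (bd c)))
       (iter k (if b then @ordS _ else @ord_pred _) i), b).
  apply: eq_bigr => k _; congr F; elim: (nat_of_ord k) => //= m ->.
  by rewrite /side_next /=; case: (b).
case: b; first by rewrite [RHS](reindex_inj (@iter_ordS_inj _ i)).
by rewrite [RHS](reindex_inj (@iter_ord_pred_inj _ i)).
Qed.

Definition letter_sign (o : option (letter (edge L))) : int :=
  if o is Some l then (if l.2 then 1 else -1) else 0.

Lemma letter_sign_linv o : letter_sign (omap (@linv _) o) = - letter_sign o.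
Proof. by case: o => [[x []]|] //=; rewrite ?oppr0 ?opprK. Qed.

Lemma sum_letter_sign (w : seq (letter (edge L))) :
  \sum_(l <- w) letter_sign (Some l) =
  (count (fun l => l.2) w)%:Z - (count (fun l => ~~ l.2) w)%:Z.
Proof.
by elim: w => [|[x []] w IHw]; rewrite ?big_nil // big_cons IHw /= !PoszD; ring.
Qed.

Lemma sum_side_sign s : exponent_sum_zero (tag s.1) ->
  \sum_(k < size (bd (tag s.1))) letter_sign (Some (side_letter (iter k (@side_next L) s))) = 0.
Proof.
move=> c0; rewrite (sum_sides (fun s => letter_sign (Some (side_letter s)))).
have bd0 : \sum_(i < size (bd (tag s.1))) letter_sign (Some (bd_letter i)) = 0.
  transitivity (\sum_(l <- bd (tag s.1)) letter_sign (Some l)); first by rewrite [RHS]big_tnth.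
  by rewrite sum_letter_sign c0 subrr.
case: s {c0} bd0 => -[c i] b /= bd0; case: b; first exact: bd0.
rewrite -[RHS]oppr0 -[in RHS]bd0 -sumrN; apply: eq_bigr => j _.
exact: (letter_sign_linv (Some _)).
Qed.

End Sides.

(* The darts labelled [None] by [mlam] are discarded; those labelled [None] by
   [mside] lie on faces that are discarded or are not mapped to a 2-cell. *)
Record map_over (L : complex) := MapOver {
  mdart : finType;
  medge : {perm mdart};
  mface : {perm mdart};
  mlam : mdart -> option (letter (edge L));
  mside : mdart -> option (side L);
  medgeK : involutive medge;
  medge_neq : forall d, medge d != d;
  mplanar : planar medge mface;
  mlam_edge : forall d, mlam (medge d) = omap (@linv _) (mlam d);
  mside_lam : forall d s, mside d = Some s -> mlam d = Some (side_letter s);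
  mside_face : forall d s, mside d = Some s -> mside (mface d) = Some (side_next s);
  mside_order : forall d s, mside d = Some s ->
    fingraph.order mface d = size (bd (tag s.1)) }.

Section MapOver.
Local Open Scope ring_scope.
Variables (L : complex) (M : map_over L).
Implicit Types d : mdart M.

Lemma mside_iter d s k : mside d = Some s ->
  mside (iter k (mface M) d) = Some (iter k (@side_next L) s).
Proof. by move=> ds; elim: k => //= k; exact: mside_face. Qed.

Lemma mside_faceN d : mside d = None -> mside (mface M d) = None.
Proof.
move=> dN; case fd: (mside (mface M d)) => [s|] //.
have := mside_iter (fingraph.order (mface M) d).-1 fd.
by rewrite -iterSr prednK ?order_gt0 // (iter_order (@perm_inj _ _)) dN.
Qed.

Lemma mside_face_inv d s : mside (mface M d) = Some s ->
  exists2 s0, mside d = Some s0 & s = side_next s0.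
Proof.
case ds: (mside d) => [s0|]; last by rewrite mside_faceN.
by rewrite (mside_face ds) => -[<-]; exists s0.
Qed.

Lemma sum_mside (V : nmodType) (F : option (side L) -> V) d s : mside d = Some s ->
  \sum_(y <- orbit (mface M) d) F (mside y) =
  \sum_(k < size (bd (tag s.1))) F (Some (iter k (@side_next L) s)).
Proof.
move=> ds; rewrite (sum_orbit_iter _ _ (fun y => F (mside y))) (mside_order ds).
by apply: eq_bigr => k _; rewrite (mside_iter _ ds).
Qed.

Lemma sum_mlam_sign d s : mside d = Some s -> exponent_sum_zero (tag s.1) ->
  \sum_(y <- orbit (mface M) d) letter_sign (mlam y) = 0.
Proof.
move=> ds c0; rewrite -[RHS](sum_side_sign c0).
rewrite (sum_orbit_iter _ _ (fun y => letter_sign (mlam y))) (mside_order ds).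
by apply: eq_bigr => k _; rewrite (mside_lam (mside_iter _ ds)).
Qed.

End MapOver.

(** * Existence of a folding pair *)

Section Fold.
Local Open Scope ring_scope.
Variables (R : realType) (L : complex) (K : subcomplex L) (n : nat) (Ki : 'I_n -> subcomplex L).
Hypotheses (wedge : is_wedge K Ki) (weight : weight_test R K Ki).
Hypothesis K_exp : forall c, sub_cell K c -> exponent_sum_zero c.
Variable M : map_over L.
Implicit Types (d x y z : mdart M) (s : {perm mdart M}).
Notation e := (medge M).
Notation f := (mface M).
Notation lam := (@mlam L M).
Notation sd := (@mside L M).

Definition outside d := if sd d is Some s then `[< ~ sub_cell K (tag s.1) >] else false.
Definition in_sub (i : 'I_n) (o : option (letter (edge L))) :=
  exists2 l, o = Some l & sub_edge (Ki i) l.1.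
(** The condition for two letters to be joined by an arc of Delta(K); the case of two [None] is that
    of discarded darts. *)
Definition linked (o o' : option (letter (edge L))) :=
  (o = None /\ o' = None) \/ exists2 i, in_sub i o & in_sub i o'.

(** A face without a 2-cell is the boundary of a disc or is discarded. Together with [free_sum] this
    makes it behave like a face over K: its corners run inside one of the Delta(K_i), and its
    exponent sum is zero. *)
Hypothesis free_linked : forall d, sd d = None -> linked (lam d) (lam (f d)).
Hypothesis free_sum : forall d, sd d = None ->
  \sum_(y <- orbit f d) letter_sign (lam y) = 0.

Lemma outside_face d : outside (f d) = outside d.
Proof.
rewrite /outside; case ds: (sd d) => [s|]; last by rewrite mside_faceN.
by rewrite (mside_face ds).
Qed.

Lemma outside_orbit d d' : d' \in orbit f d -> outside d' = outside d.
Proof.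
rewrite -fconnect_orbit -mem_porbit_fconnect => /porbitP[i ->]; rewrite permX.
by elim: i => //= i; rewrite outside_face.
Qed.

Lemma in_sub_linv i o : in_sub i (omap (@linv _) o) <-> in_sub i o.
Proof.
case: o => [l|]; split=> -[l' //= [e0] h]; first by exists l => //; move: h; rewrite -e0.
by exists (linv l); rewrite // /linv /= e0.
Qed.

Lemma in_sub_uniq i j o : in_sub i o -> in_sub j o -> i = j.
Proof.
case: wedge => _ _ tE _ [l -> li] [l' [<-] lj].
by apply: (tE i j) => //; exists l.1.
Qed.

Lemma outsideN_linked d : ~~ outside d -> linked (lam d) (lam (f d)).
Proof.
rewrite /outside; case ds: (sd d) => [s|]; last by move=> _; exact: free_linked.
move=> /asboolPn/contrapT; case: (wedge) => _ -> _ _ [i _ si]; right; exists i.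
  exists (side_letter s); first exact: mside_lam.
  by move: (sub_closed si (tagged s.1)); rewrite /side_letter; case: s.2.
exists (side_letter (side_next s)); first exact/mside_lam/mside_face.
by case: s {ds} si => -[c j] b /= si; rewrite /side_letter /=; case: b; exact: (sub_closed si).
Qed.

(* The edges with no side over a 2-cell outside [K]. *)
Definition KK := [set d | ~~ outside d & ~~ outside (e d)].
Notation v := (e * f)%g.

Lemma KK_edge d : (e d \in KK) = (d \in KK).
Proof. by rewrite !inE medgeK andbC. Qed.

(* Under [s], a step around a vertex is a corner outside [K] or runs over corners
   of a single [Ki i]. *)
Definition merged s := (forall x, s x \in porbit v x) /\
  forall x, if outside (s x) then s x = v x else linked (lam x) (lam (s x)).

Lemma merged_v : merged v.
Proof.
split=> x; first by rewrite -eq_porbit_mem porbit_perm1.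
case: ifPn => //; rewrite permM outside_face => /outsideN_linked.
rewrite mlam_edge => -[[le lf]|[i li lf]]; [left|right].
  by split=> //; case: (lam x) le.
by exists i => //; apply/in_sub_linv.
Qed.

(** Neither face along the edge of d lies outside K, so no outside corner begins or ends at d. The
    corners before and after d run over the same K_i, because the letter of d lies in only one of
    them, and they merge into one arc of Delta(K_i). *)
Lemma merged_detach s d : d \in KK -> merged s -> merged (detach d s).
Proof.
rewrite inE => /andP[dN edN] [sv sl].
have d_linked x : s x = d -> linked (lam x) (lam d).
  by move=> sx; have := sl x; rewrite sx (negPf dN).
split=> x; rewrite detachE; case: eqVneq => [->|xd]; try exact: porbit_id; last first.
- case: eqVneq => [sxd|_]; last exact: sl.
  case: ifPn => [o|oN].
    by have := sl d; rewrite o => sd'; rewrite sd' permM outside_face (negPf edN) in o.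
  have := sl d; rewrite (negPf oN); have := d_linked _ sxd.
  case=> [[-> dn]|[i xi di]].
    by case=> [[_ ->]|[j [l]]]; [left|rewrite dn].
  case=> [[dn]|[j dj sdj]]; first by case: di => l; rewrite dn.
  by right; exists i => //; rewrite (in_sub_uniq di dj).
- rewrite (negPf dN); have := outsideN_linked dN.
  by case=> [[-> _]|[i di _]]; [left|right; exists i].
- case: eqVneq => [sxd|_]; last exact: sv.
  have := sv x; have := sv d; rewrite sxd.
  by rewrite -!eq_porbit_mem => /eqP-> /eqP->.
Qed.

Lemma lam_outside d : outside d -> exists l, lam d = Some l.
Proof. by rewrite /outside; case ds: (sd d) => [s|] // _; exists (side_letter s); exact: mside_lam. Qed.

Lemma lam_boundary d : d \notin KK -> exists l, lam d = Some l.
Proof.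
rewrite inE negb_and !negbK => /orP[/lam_outside//|/lam_outside[l]].
by rewrite mlam_edge; case: (lam d) => // l' _; exists l'.
Qed.

(** The default occurs only on darts of KK; all others carry a letter. *)
Definition sgn d := if lam d is Some l then l.2 else true.

Lemma sgn_edge d : d \notin KK -> sgn (e d) = ~~ sgn d.
Proof. by move=> /lam_boundary[l dl]; rewrite /sgn mlam_edge dl. Qed.

Section Merged.
Variables (v' : {perm mdart M}) (om : garc (rel_link K Ki) -> R).
Hypothesis v'K : forall d, d \in KK -> v' d = d.
Hypothesis v'm : merged v'.
Hypothesis om_rev : forall a, om (grev a) = om a.
Hypothesis om_cell : forall (c : cell L) (cK : ~ sub_cell K c),
  \sum_(i < size (bd c)) om (Retained Ki (k := Tagged (fun c => 'I_(size (bd c))) i) cK true)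
  <= (size (bd c))%:R - 2.
Hypothesis om_cycle : forall z : seq (garc (rel_link K Ki)),
  gcycle z -> homology_reduced z ->
  (exists j : 'I_(size z), ~ exists i, delta_arc i (tnth (in_tuple z) j)) ->
  2 <= \sum_(a <- z) om a.
Hypothesis om_delta : forall (i : 'I_n) (a : garc (rel_link K Ki)), delta_arc i a ->
  ((gsrc a).2 = (gtgt a).2 -> om a = 0) /\ ((gsrc a).2 <> (gtgt a).2 -> om a = 1).

Lemma v'_outside d : outside (v d) -> v' d = v d.
Proof.
move=> o; have := v'm.2 ((v'^-1)%g (v d)); rewrite permKV o => /perm_inj dE.
by rewrite {1}dE permKV.
Qed.

Lemma v'_KK d : (v' d \in KK) = (d \in KK).
Proof. by apply: perm_closed => {}d dK; rewrite v'K. Qed.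

Definition retained (a : garc (rel_link K Ki)) : bool := if a is Retained _ _ _ then true else false.

Definition corner_weight (k : corner L) : R :=
  if pselect (sub_cell K (tag k)) is right kK then om (Retained Ki kK true) else 0.

Lemma corner_weightE k (kK : ~ sub_cell K (tag k)) b : om (Retained Ki kK b) = corner_weight k.
Proof.
rewrite /corner_weight; case: pselect => // kK'; rewrite (Prop_irrelevance kK' kK).
by case: b => //; rewrite -om_rev.
Qed.

(** The weight of the corner between [v'^-1 d] and d. Over K it is the value prescribed by condition
    (3). An isolated dart gets 0, which gives equality in the face inequality for the bigon around
    its edge. *)
Definition dart_weight d : R :=
  if outside d then (if sd d is Some s then corner_weight (side_corner s).1 else 0)
  else if d \in KK then 0 else (sgn ((v'^-1)%g d) != sgn d)%:R.

Definition arc_of d (a : garc (rel_link K Ki)) :=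
  [/\ Some (gsrc a) = lam ((v'^-1)%g d), Some (gtgt a) = lam d, om a = dart_weight d,
    retained a = outside d &
    forall k kK b, a = @Retained L K n Ki k kK b -> exists s : side L,
      [/\ sd d = Some s, ~ sub_cell K (tag s.1) & side_corner s = (k, b)]].

Lemma arc_of_ex d : d \notin KK -> exists a, arc_of d a.
Proof.
move=> dK; set x := (v'^-1)%g d; have xd : v' x = d by rewrite permKV.
have := v'm.2 x; rewrite xd; case: ifPn => dN.
  rewrite permM => dE; have := dN; rewrite {1}/outside.
  case ds: (sd d) => [s|] // /asboolP sK.
  have [s0 es s0E] : exists2 s0, sd (e x) = Some s0 & s = side_next s0.
    by apply: mside_face_inv; rewrite -dE.
  have kK : ~ sub_cell K (tag (side_corner s).1) by rewrite side_corner_tag.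
  exists (Retained Ki kK (side_corner s).2); split.
  - rewrite -/x; have := mside_lam es; rewrite mlam_edge; case: (lam x) => //= l [lE].
    congr Some; rewrite /= -surjective_pairing s0E side_corner_next_src -lE.
    exact: linvK.
  - by rewrite (mside_lam ds) /= -surjective_pairing side_corner_tgt.
  - by rewrite corner_weightE /dart_weight dN ds.
  - by rewrite /= dN.
  - move=> k kK' b aE; exists s; split=> //.
    move/(congr1 (fun a : rel_arc K Ki => if a is Retained k0 _ b' then (k0, b') else (k, b))): aE.
    by rewrite /= -surjective_pairing.
have [l dl] := lam_boundary dK; rewrite dl => -[[_ //]|[i [l0 xl0 l0i] [l1 [<-] li]]].
pose u : delta_vert Ki i := (exist _ l0.1 (mem_set l0i), l0.2).
pose w : delta_vert Ki i := (exist _ l.1 (mem_set li), l.2).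
have uE : delta_val u = l0 by rewrite /delta_val /= -surjective_pairing.
have wE : delta_val w = l by rewrite /delta_val /= -surjective_pairing.
have sE : dart_weight d = (l0.2 != l.2)%:R.
  by rewrite /dart_weight (negPf dN) (negPf dK) -/x /sgn xl0 dl.
have omE (a : garc (rel_link K Ki)) : delta_arc i a -> gsrc a = l0 -> gtgt a = l -> om a = dart_weight d.
  move=> ai a1 a2; have [h0 h1] := om_delta ai; rewrite sE -a1 -a2.
  by case: eqVneq => [/h0|/eqP/h1].
have [uw|uw] := pselect (u = w).
  have ul : gsrc (DeltaLoop K u true : garc (rel_link K Ki)) = l0 by [].
  have wl : gtgt (DeltaLoop K u true : garc (rel_link K Ki)) = l by rewrite -wE -uw.
  exists (DeltaLoop K u true); split; rewrite ?ul ?wl ?(negPf dN) //.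
  exact: omE.
have ul : gsrc (DeltaEdge K uw : garc (rel_link K Ki)) = l0 by [].
have wl : gtgt (DeltaEdge K uw : garc (rel_link K Ki)) = l by [].
exists (DeltaEdge K uw); split; rewrite ?ul ?wl ?(negPf dN) //.
exact: omE.
Qed.

Hypothesis unfolded : forall d1 d2 (s1 s2 : side L), sd d1 = Some s1 -> sd d2 = Some s2 ->
  ~ sub_cell K (tag s1.1) -> ~ sub_cell K (tag s2.1) -> d2 \in porbit v d1 ->
  side_corner s1 <> link_rev (side_corner s2).

(** An isolated dart is a vertex by itself, and the second summand grants it 2. Any other vertex
    yields a closed walk in lk(L,K). It has a retained arc, since an edge not in KK has an outside
    face on some side, and by [unfolded] no two retained arcs cancel. *)
Lemma vertex_weight_ge2 x : 2 <= \sum_(y in porbit v' x) (dart_weight y + 2 * (y \in KK)%:R).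
Proof.
have [xK|xK] := boolP (x \in KK).
  rewrite (porbit_fix (v'K xK)) big_set1 xK /dart_weight xK.
  by move: xK; rewrite inE => /andP[/negPf -> _]; rewrite add0r mulr1.
have orbK y : y \in porbit v' x -> y \notin KK.
  have cl : {homo v' : z / z \in ~: KK} by move=> z; rewrite !in_setC v'_KK.
  by rewrite -in_setC; apply/subsetP/porbit_closed; rewrite ?in_setC.
rewrite (eq_bigr dart_weight) => [|y /orbK /negPf ->]; last by rewrite mulr0 addr0.
rewrite sum_porbit_orbit.
have [a0 _] := arc_of_ex xK.
have /choice[F FE] : forall y, exists a, y \notin KK -> arc_of y a.
  move=> y; have [yK|yK] := boolP (y \in KK); first by exists a0.
  by have [a ya] := arc_of_ex yK; exists a.
have orbF y : y \in orbit v' x -> arc_of y (F y).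
  by move=> yx; apply/FE/orbK; rewrite porbit_orbit inE.
have -> : \sum_(y <- orbit v' x) dart_weight y = \sum_(a <- [seq F y | y <- orbit v' x]) om a.
  by rewrite big_map !big_seq; apply: eq_bigr => y /orbF[].
have walkF y m : traject v' y m.+1 \subset orbit v' x -> exists u w : gvert (rel_link K Ki),
   [/\ Some u = lam ((v'^-1)%g y), Some w = lam (iter m v' y) & walk u (map F (traject v' y m.+1)) w].
  elim: m y => [|m IHm] y /subsetP sub.
    have [h1 h2 _ _ _] := orbF _ (sub _ (mem_head _ _)).
    by exists (gsrc (F y)), (gtgt (F y)).
  have [|u [w [h1 h2 h3]]] := IHm (v' y).
    by apply/subsetP=> z zt; apply: sub; rewrite trajectS inE zt orbT.
  have [k1 k2 _ _ _] := orbF _ (sub _ (mem_head _ _)).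
  exists (gsrc (F y)), w; split; rewrite // ?iterSr //=; split=> //.
  by move: h1; rewrite permK -k2 => -[<-].
have o1 : (fingraph.order v' x) = (fingraph.order v' x).-1.+1 by rewrite prednK ?order_gt0.
have [|u [w [h1 h2 h3]]] := walkF x (fingraph.order v' x).-1.
  by rewrite -o1; apply/subsetP.
have uw : u = w.
  apply: Some_inj; rewrite h1 h2; congr lam; apply: (@perm_inj _ v').
  by rewrite permKV -iterS -o1 (iter_order (@perm_inj _ _)).
subst w; rewrite -o1 -/(orbit v' x) in h3.
apply: (@walk_weight (rel_link K Ki) R om retained) h3 _ _.
- by case.
- case=> [//|i p q pq|i p b] _.
    have [h0 h1'] := om_delta (erefl : delta_arc i (DeltaEdge K pq)).
    pose a : garc (rel_link K Ki) := DeltaEdge K pq.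
    by have [/h0->|/eqP/h1'->] := eqVneq (gsrc a).2 (gtgt a).2.
  by have [->] := om_delta (erefl : delta_arc i (DeltaLoop K p b)).
- move=> z zc zr zh; apply: om_cycle => //; move: zh => /(has_nthP a0)[i iz ri].
  exists (Ordinal iz); rewrite (tnth_nth a0) /=; case: (nth a0 z i) ri => // k kK b _ [] //.
- rewrite has_map; apply/hasP; have [xo|xo] := boolP (outside x).
    by exists x; rewrite ?in_orbit //=; have [_ _ _ -> _] := orbF _ (in_orbit _ _).
  have vxo : outside (v x).
    by move: xK; rewrite inE negb_and !negbK (negPf xo) permM outside_face.
  have v'x : v' x \in orbit v' x by rewrite -fconnect_orbit fconnect1.
  by exists (v' x) => //=; have [_ _ _ -> _] := orbF _ v'x; rewrite v'_outside.
- have : {in orbit v' x &, forall y z, ~~ (retained (F y) && `[< F y = grev (F z) >])}.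
    move=> y z yx zx; apply/negP=> /andP[ry /asboolP yz].
    have [_ _ _ _ hy] := orbF _ yx; have [_ _ _ _ hz] := orbF _ zx.
    case Fz: (F z) yz => [k kK b|i p q pq|i p b] Fy; try by rewrite Fy in ry.
    have [s1 [sd1 s1K c1]] := hy _ _ _ Fy; have [s2 [sd2 s2K c2]] := hz _ _ _ Fz.
    have zy : z \in porbit v y.
      have sub t : t \in orbit v' x -> t \in porbit v x.
        move=> tx; have : t \in porbit v' x by rewrite porbit_orbit inE.
        apply/subsetP/porbit_closed; last exact: porbit_id.
        by move=> r; rewrite -!eq_porbit_mem => /eqP<-; rewrite eq_porbit_mem; exact: v'm.1.
      by have := sub _ yx; have := sub _ zx; rewrite -!eq_porbit_mem => /eqP-> /eqP->.
    by apply: (unfolded sd1 sd2 s1K s2K zy); rewrite c1 c2.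
  elim: (orbit v' x) => //= y l IHl h; apply/andP; split.
    by rewrite all_map; apply/allP=> z zl; apply: h; rewrite inE ?eqxx ?zl ?orbT.
  by apply: IHl => z t zl tl; apply: h; rewrite inE ?zl ?tl orbT.
Qed.

(** The value 0 on outside faces makes them good whatever their exponent sum; their weights are
    controlled by condition (1) instead. *)
Definition region_sign d : int := if outside d then 0 else letter_sign (lam d).
Definition zero_sum (l : seq (mdart M)) := \sum_(y <- l) region_sign y == 0.
Notation f' := (e * v')%g.

Lemma cell_weight_le (s : side L) : ~ sub_cell K (tag s.1) ->
  \sum_(k < size (bd (tag s.1))) corner_weight (side_corner (iter k (@side_next L) s)).1
  <= (size (bd (tag s.1)))%:R - 2.
Proof.
move=> sK; rewrite (sum_sides (fun s : side L => corner_weight (side_corner s).1)).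
have le : \sum_(i < size (bd (tag s.1))) corner_weight (Tagged (fun c => 'I_(size (bd c))) i)
    <= (size (bd (tag s.1)))%:R - 2.
  apply: le_trans (om_cell sK); rewrite le_eqVlt; apply/orP; left; apply/eqP.
  by apply: eq_bigr => i _; rewrite corner_weightE.
case: s {sK} le => -[c i] b /=; case: b => // le.
by rewrite [X in X <= _](reindex_inj (can_inj (@ordSK _))) in le.
Qed.

(** An outside face is still a face of f, so condition (1) applies. An isolated edge has a bigon of
    weight zero. On any other face, reversing an edge flips its sign, so the sum counts sign
    changes; if there are none, the exponent sum is plus or minus the length, and the face is not
    good. *)
Lemma face_weight_ge x :
  2 * (good_orbit zero_sum f' x)%:R <= \sum_(y in porbit f' x) (1 - dart_weight y).
Proof.
have b2 : 2 * (good_orbit zero_sum f' x)%:R <= 2 :> R.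
  by case: good_orbit; rewrite ?mulr1 // mulr0.
have [xo|xo] := boolP (outside x).
  apply: le_trans b2 _; rewrite sum_porbit_orbit.
  have oo y : y \in orbit f x -> outside y by move=> /outside_orbit->.
  rewrite (_ : orbit f' x = orbit f x); last first.
    by apply: orbit_eq_in => y /oo yo; rewrite permM v'_outside permM medgeK ?outside_face.
  have := xo; rewrite {1}/outside; case xs: (sd x) => [s|] // /asboolP sK.
  rewrite sumrB -[X in X - _](sum_porbit_orbit _ _ (fun=> 1)) sumr_const card_porbit_order.
  have -> : \sum_(y <- orbit f x) dart_weight y = \sum_(y <- orbit f x)
      (if sd y is Some s then corner_weight (side_corner s).1 else 0).
    by rewrite !big_seq; apply: eq_bigr => y /oo yo; rewrite /dart_weight yo.
  rewrite (sum_mside (fun o => if o is Some s then corner_weight (side_corner s).1 else 0) xs).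
  by rewrite (mside_order xs); have := cell_weight_le sK; lra.
have [xK|xK] := boolP (x \in KK).
  have f'K y : y \in KK -> f' y = e y by move=> yK; rewrite permM v'K ?KK_edge.
  apply: le_trans b2 _; have xc : fcycle f' [:: x; e x].
    by rewrite /= !f'K ?KK_edge // medgeK !eqxx.
  rewrite (porbit_cycle xc) ?mem_head // (eq_bigr (fun=> 1)); last first.
    move=> y; rewrite !inE => yx; have /setIdP[yo _] : y \in KK by case/orP: yx => /eqP->; rewrite ?KK_edge.
    have yK : y \in KK by case/orP: yx => /eqP->; rewrite ?KK_edge.
    by rewrite /dart_weight (negPf yo) yK subr0.
  have cE : #|[set y in [:: x; e x]]| = 2%N.
    by rewrite cardsE (card_uniqP _) //= inE eq_sym medge_neq.
  by rewrite sumr_const cE.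
pose U := [set z | (z \notin KK) && ~~ outside z].
have UE z : (z \in U) = (z \notin KK) && ~~ outside z by rewrite [LHS]in_set.
have xU : x \in U by rewrite UE xK.
have UU : {homo f' : z / z \in U}.
  move=> z; rewrite !UE => /andP[zK zo]; rewrite permM v'_KK KK_edge zK /=.
  apply: contra zo => o; have := v'm.2 (e z); rewrite o => vE.
  by rewrite vE permM medgeK outside_face in o.
have orbU z : z \in porbit f' x -> (z \notin KK) * (outside z = false).
  by move=> /(subsetP (porbit_closed UU xU)); rewrite UE => /andP[-> /negPf->].
have -> : \sum_(y in porbit f' x) (1 - dart_weight y) =
    \sum_(y in porbit f' x) (sgn y != sgn (f' y))%:R.
  rewrite sum_porbit_perm; apply: eq_bigr => y yx.
  have f'yx : f' y \in porbit f' x by rewrite -eq_porbit_mem porbit_perm1 eq_porbit_mem.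
  rewrite /dart_weight (orbU _ f'yx).2 (negPf (orbU _ f'yx).1) [X in (v'^-1)%g X]permM permK.
  rewrite sgn_edge ?(orbU _ yx).1 //; case: (sgn y); case: (sgn _) => /=; lra.
have [|same] := pselect (exists y z, [/\ y \in porbit f' x, z \in porbit f' x, sgn y & ~~ sgn z]).
  by move=> [y [z [yx zx ys zs]]]; exact: le_trans b2 (sign_changes_ge2 R yx zx ys zs).
suff -> : good_orbit zero_sum f' x = false by rewrite mulr0 sumr_ge0.
apply/negbTE; rewrite /good_orbit /zero_sum -sum_porbit_orbit.
have signE (b : bool) : (forall y, y \in porbit f' x -> sgn y = b) ->
    \sum_(y in porbit f' x) region_sign y = (if b then 1 else -1) *+ #|porbit f' x|.
  move=> h; rewrite -sumr_const; apply: eq_bigr => y yx.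
  have [yK yo] := orbU _ yx; rewrite /region_sign yo; have := h y yx; have [l yl] := lam_boundary yK.
  by rewrite /sgn yl /= => ->.
have c0 := card_porbit_neq0 f' x.
have [xs|xs] := boolP (sgn x).
  rewrite (signE true) => [|y yx]; last first.
    by apply/negPn/negP=> ys; apply: same; exists x, y; split; rewrite ?porbit_id.
  by rewrite mulrn_eq0 (negPf c0).
rewrite (signE false) => [|y yx]; last first.
  by apply/negbTE/negP=> ys; apply: same; exists y, x; split; rewrite ?porbit_id.
by rewrite mulrn_eq0 (negPf c0).
Qed.

End Merged.

Lemma zero_sum_rot A B : zero_sum (A ++ B) -> zero_sum (B ++ A).
Proof. by rewrite /zero_sum !big_cat /= addrC. Qed.

Lemma zero_sum_cat A B : zero_sum A -> zero_sum B -> zero_sum (A ++ B).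
Proof. by rewrite /zero_sum !big_cat /= => /eqP-> /eqP->. Qed.

Lemma zero_sum_catl A B : zero_sum A -> zero_sum (A ++ B) -> zero_sum B.
Proof. by rewrite /zero_sum !big_cat /= => /eqP->; rewrite add0r. Qed.

Lemma zero_sum_face x : good_orbit zero_sum f x.
Proof.
rewrite /good_orbit /zero_sum; have [xo|xo] := boolP (outside x).
  by rewrite big_seq big1 // => y /outside_orbit yE; rewrite /region_sign yE xo.
have -> : \sum_(y <- orbit f x) region_sign y = \sum_(y <- orbit f x) letter_sign (lam y).
  rewrite !big_seq; apply: eq_bigr => y /outside_orbit yE.
  by rewrite /region_sign yE (negPf xo).
move: xo; rewrite /outside; case xs: (sd x) => [s|]; last by move=> _; rewrite free_sum.
by move=> /asboolPn/contrapT/K_exp s0; rewrite (sum_mlam_sign xs).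
Qed.

(** With V the vertices of [v'] and G the good faces of [e * v'], the absence of folds gives 2V + 2G
    <= #darts + 2 #KK by summing over vertices and faces. As all faces of f are good,
    [planar_detach] gives #darts + 2 #KK + 4 <= 2V + 2G. *)
Theorem exists_fold : (exists d, outside d) -> exists d1 d2 (s1 s2 : side L),
  [/\ sd d1 = Some s1, sd d2 = Some s2, ~ sub_cell K (tag s1.1), ~ sub_cell K (tag s2.1) &
     d2 \in porbit v d1 /\ side_corner s1 = link_rev (side_corner s2)].
Proof.
move=> [d0 d0o]; apply: contrapT => nofold.
have [om [om_rev om_cell om_cycle om_delta]] := weight.
have phi_step s x y := phi_tperm zero_sum_rot zero_sum_cat zero_sum_catl s x y (leq0n 2).
have iso s x : x \in KK -> s x = e x -> s (e x) != x ->
    phi zero_sum 0 (tperm (e x) ((s^-1)%g x) * s)%g = (phi zero_sum 0 s + 1)%N.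
  move=> /setIdP[xo exo] sx sex.
  apply: (phi_isolate zero_sum_rot zero_sum_cat zero_sum_catl) => //.
  rewrite /zero_sum !big_cons big_nil /region_sign (negPf xo) (negPf exo) mlam_edge.
  by rewrite letter_sign_linv addr0 subrr.
have [v' v'K [le ind]] := planar_detach (@medgeK L M) (@medge_neq L M) (@mplanar L M)
  KK_edge phi_step iso.
have v'm : merged v' by apply: ind; [exact: merged_v|move=> s d dK; exact: merged_detach].
have fE : phi zero_sum 0 f = #|porbits f|.
  rewrite /phi mul0n addn0; apply: eq_card => O; apply/imsetP/imsetP=> -[x _ ->]; exists x => //.
  exact: zero_sum_face.
have unf d1 d2 (s1 s2 : side L) : sd d1 = Some s1 -> sd d2 = Some s2 ->
  ~ sub_cell K (tag s1.1) -> ~ sub_cell K (tag s2.1) -> d2 \in porbit v d1 ->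
  side_corner s1 <> link_rev (side_corner s2).
  by move=> h1 h2 h3 h4 h5 h6; apply: nofold; exists d1, d2, s1, s2.
have vle := sum_porbits_le (c := fun=> 2)
  (vertex_weight_ge2 v'K v'm om_rev om_cycle om_delta unf).
have fle : \sum_(O in porbits (e * v')%g) (2 * (O \in good_orbits zero_sum (e * v')%g)%:R) <=
    \sum_y (1 - dart_weight v' om y) :> R.
  apply: sum_porbits_le => x; apply: le_trans (face_weight_ge v'K v'm om_rev om_cell x).
  rewrite ler_pM2l // ler_nat; case: imsetP => // -[y yg /eqP].
  rewrite eq_porbit_mem => xy; rewrite -topredE /= in yg.
  by rewrite (good_porbit zero_sum_rot xy) yg.
have d0K : [exists x, x \notin KK].
  by apply/existsP; exists d0; rewrite inE d0o.
move: le; rewrite fE d0K muln1 => le.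
have gE : \sum_(O in porbits (e * v')%g) (2 * (O \in good_orbits zero_sum (e * v')%g)%:R) =
    2 * #|good_orbits zero_sum (e * v')%g|%:R :> R.
  rewrite -mulr_sumr -sum1_card natr_sum; congr (_ * _).
  transitivity (\sum_(O in porbits (e * v')%g) if O \in good_orbits zero_sum (e * v')%g then 1 else 0 : R).
    by apply: eq_bigr => O _; case: (O \in _).
  rewrite -big_mkcondr; apply: eq_bigl => O; apply: andb_idl => /imsetP[x _ ->].
  exact: imset_f.
have KE : \sum_(y : mdart M) (dart_weight v' om y + 2 * (y \in KK)%:R) =
    \sum_y dart_weight v' om y + 2 * #|KK|%:R.
  rewrite big_split /= -mulr_sumr; congr (_ + _ * _).
  rewrite -sum1_card natr_sum [RHS]big_mkcond; apply: eq_bigr => y _.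
  by case: (y \in KK).
rewrite sumr_const KE -[X in X <= _]mulr_natr in vle.
rewrite gE sumrB sumr_const (_ : #|[pred _ : mdart M | true]| = #|mdart M|) // in fle.
move: le vle fle; rewrite /phi mul0n addn0.
move: #|porbits v'| #|porbits f| #|KK| #|mdart M| #|good_orbits _ _| (\sum_y _) => a b c d g h le vle fle.
have {}le : (d + 2 * c + 4)%:R <= (2 * a + 2 * g)%:R :> R by rewrite ler_nat; lia.
by move: le; rewrite 3!natrD !natrM; lra.
Qed.
End Fold.

(** * Spherical diagrams as planar maps *)

Lemma fcard_porbits (T : finType) (s : {perm T}) : fcard s T = #|porbits s|.
Proof.
have sC := fconnect_sym (@perm_inj _ s).
have rootE x y : (porbit s x == porbit s y) = (froot s x == froot s y).
  by rewrite eq_porbit_mem porbit_sym mem_porbit_fconnect (root_connect sC).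
have -> : porbits s = porbit s @: [set x | froots s x].
  apply/setP=> O; apply/imsetP/imsetP=> -[x _ ->]; last by exists x.
  exists (froot s x); first by rewrite inE roots_root.
  by apply/eqP; rewrite rootE root_root.
rewrite card_in_imset => [|x y].
  by apply: eq_card => x; rewrite !inE andbT.
by rewrite !inE => /eqP rx /eqP ry /eqP; rewrite rootE rx ry => /eqP.
Qed.

Section SphericalMap.
Variables (L : complex) (C : spherical_diagram L).

Let e : {perm dart C} := perm (inv_inj (@einvK C)).
Let f : {perm dart C} := perm (@fnext_inj C).

Lemma sphere_planar : planar e f.
Proof.
have eK : involutive e by move=> d; rewrite !permE einvK.
have e_neq d : e d != d by rewrite permE einv_neq.
have := sphere_euler C.
rewrite (eq_fcard (f' := (e * f)%g)) => [|d]; last by rewrite permM !permE.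
rewrite (eq_fcard (f := @fnext C) (f' := f)) => [|d]; last by rewrite permE.
rewrite (eq_fcard (f := @einv C) (f' := e)) => [|d]; last by rewrite permE.
rewrite !fcard_porbits => euler; have eE := card_porbits_involution eK e_neq.
have [d0 _|T0] := pickP (dart C); last first.
  have P0 (s : {perm dart C}) : #|porbits s| = 0.
    by apply/eqP; rewrite -leqn0 (leq_trans (leq_imset_card _ _)) // (eq_card0 T0).
  by move: euler; rewrite !P0.
exists [set d0]; last first.
  rewrite cards1; move: euler eE.
  by move: #|porbits e| #|porbits f| #|porbits _| #|dart C| => a b c g; lia.
move=> x; exists d0; first by rewrite inE.
by have := sphere_connected x d0; rewrite /conn (@eq_connect _ _ (step e f)) // => y z; rewrite /step !permE.
Qed.

Program Definition spherical_map : map_over L :=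
  @MapOver L (dart C) e f (fun d => Some (diag_letter d)) (fun d => Some (diag_side d))
    _ _ sphere_planar _ _ _ _.
Next Obligation. by move=> d; rewrite !permE einvK. Qed.
Next Obligation. by rewrite permE einv_neq. Qed.
Next Obligation. by rewrite permE /diag_letter diag_edge. Qed.
Next Obligation. by rewrite permE diag_next. Qed.
Next Obligation.
rewrite -(diag_face d); apply: eq_card => x.
by apply: eq_fconnect => y; rewrite permE.
Qed.

End SphericalMap.

Lemma VA_relative_of_weight_test (R : realType) (L : complex) (K : subcomplex L)
    (n : nat) (Ki : 'I_n -> subcomplex L) :
  is_wedge K Ki -> (forall c, sub_cell K c -> exponent_sum_zero c) ->
  weight_test R K Ki -> VA_relative K.
Proof.
move=> wedge K_exp wt C C_out; set M := spherical_map C.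
have [d0 d0o] : exists d : mdart M, outside K d.
  apply: contrapT => none; have inK (d : dart C) : sub_cell K (diag_cell d).
    by apply: contrapT => dK; apply: none; exists d; apply/asboolP.
  apply: C_out; split=> // d; have := sub_closed (inK d) (tagged (diag_side d).1).
  by rewrite /diag_letter /side_letter; case: (diag_side d).2.
have [] := exists_fold wedge wt K_exp (M := M) _ _ (ex_intro _ d0 d0o); try by [].
move=> d1 [d2 [s1 [s2 [[s1E] [s2E] s1K s2K [d12 corner12]]]]].
have vE : porbit (medge M * mface M)%g d1 =i orbit (@vnext C) d1.
  move=> d; rewrite mem_porbit_fconnect -fconnect_orbit.
  by apply: eq_fconnect => y; rewrite permM !permE.
have d2o : d2 \in orbit (@vnext C) d1 by rewrite -vE.
have fold : diag_corner d1 = grev (diag_corner d2).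
  by have := corner12; rewrite -s1E -s2E.
exists d1, d1, d2; rewrite /diag_cell s1E s2E; split=> //.
move=> red; set o := orbit (@vnext C) d1 in d2o.
have sz : size (vertex_path d1) = size o by rewrite size_map.
have i1 : index d1 o < size (vertex_path d1) by rewrite sz index_mem in_orbit.
have i2 : index d2 o < size (vertex_path d1) by rewrite sz index_mem.
apply: (red (Ordinal i1) (Ordinal i2)); rewrite !(tnth_nth (diag_corner d1)) /=.
by rewrite !(nth_map d1) ?nth_index ?index_mem ?in_orbit.
Qed.

(** * Planar maps with boundary *)

Section SumPerm.
Variables T1 T2 : finType.
Implicit Types (s : {perm T1}) (t : {perm T2}).

Definition sum_fun s t (z : T1 + T2) : T1 + T2 :=
  match z with inl x => inl (s x) | inr y => inr (t y) end.
Lemma sum_fun_inj s t : injective (sum_fun s t).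
Proof. by move=> [x|y] [x'|y'] //= [/perm_inj->]. Qed.
Definition sum_perm s t : {perm T1 + T2} := perm (@sum_fun_inj s t).

Lemma sum_perml s t x : sum_perm s t (inl x) = inl (s x).
Proof. by rewrite permE. Qed.
Lemma sum_permr s t y : sum_perm s t (inr y) = inr (t y).
Proof. by rewrite permE. Qed.

Lemma sum_permM s s' t t' : (sum_perm s t * sum_perm s' t' = sum_perm (s * s') (t * t'))%g.
Proof.
by apply/perm.permP=> -[x|y]; rewrite permM ?sum_perml ?sum_permr permM.
Qed.

Lemma iter_sum_perml s t k x : iter k (sum_perm s t) (inl x) = inl (iter k s x).
Proof. by elim: k => //= k ->; rewrite sum_perml. Qed.
Lemma iter_sum_permr s t k y : iter k (sum_perm s t) (inr y) = inr (iter k t y).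
Proof. by elim: k => //= k ->; rewrite sum_permr. Qed.

Lemma porbit_sum_perml s t x : porbit (sum_perm s t) (inl x) = [set inl y | y in porbit s x].
Proof.
apply/setP=> z; apply/porbitP/imsetP=> [[i ->]|[y /porbitP[i ->] ->]].
  by rewrite permX iter_sum_perml -permX; exists ((s ^+ i)%g x); rewrite ?mem_porbit.
by exists i; rewrite !permX iter_sum_perml.
Qed.

Lemma porbit_sum_permr s t x : porbit (sum_perm s t) (inr x) = [set inr y | y in porbit t x].
Proof.
apply/setP=> z; apply/porbitP/imsetP=> [[i ->]|[y /porbitP[i ->] ->]].
  by rewrite permX iter_sum_permr -permX; exists ((t ^+ i)%g x); rewrite ?mem_porbit.
by exists i; rewrite !permX iter_sum_permr.
Qed.

Lemma card_porbits_sum s t : #|porbits (sum_perm s t)| = #|porbits s| + #|porbits t|.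
Proof.
pose il (O : {set T1}) : {set T1 + T2} := inl @: O.
pose ir (O : {set T2}) : {set T1 + T2} := inr @: O.
have -> : porbits (sum_perm s t) = il @: porbits s :|: ir @: porbits t.
  apply/setP=> O; rewrite inE; apply/imsetP/orP=> [[[x|y] _ ->]|[]/imsetP[_ /imsetP[x _ ->] ->]].
  - by left; rewrite porbit_sum_perml -/(il _) !imset_f.
  - by right; rewrite porbit_sum_permr -/(ir _) !imset_f.
  - by exists (inl x); rewrite // porbit_sum_perml.
  - by exists (inr x); rewrite // porbit_sum_permr.
rewrite cardsU (_ : _ :&: _ = set0) ?cards0 ?subn0; last first.
  apply/setP=> O; rewrite !inE; apply/negbTE/negP=> /andP[/imsetP[_ /imsetP[x _ ->] ->]].
  move=> /imsetP[Q _ /setP/(_ (inl x))]; rewrite imset_f ?porbit_id // => /esym/imsetP[] //.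
have ilI : injective il by apply: imset_inj => x y [].
have irI : injective ir by apply: imset_inj => x y [].
by rewrite (card_imset _ ilI) (card_imset _ irI).
Qed.

Lemma conn_suml s t s' t' x y : conn s s' x y ->
  conn (sum_perm s t) (sum_perm s' t') (inl x) (inl y).
Proof.
pose c := conn (sum_perm s t) (sum_perm s' t').
apply: (@conn_min _ _ _ (fun x y => c (inl x) (inl y))) => [z|z u w|z|z].
- exact: connect0.
- exact: connect_trans.
- by rewrite -(sum_perml s t); exact: conn_perml.
- by rewrite -(sum_perml s' t'); exact: conn_permr.
Qed.

Lemma conn_sumr s t s' t' x y : conn t t' x y ->
  conn (sum_perm s t) (sum_perm s' t') (inr x) (inr y).
Proof.
pose c := conn (sum_perm s t) (sum_perm s' t').
apply: (@conn_min _ _ _ (fun x y => c (inr x) (inr y))) => [z|z u w|z|z].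
- exact: connect0.
- exact: connect_trans.
- by rewrite -(sum_permr s t); exact: conn_perml.
- by rewrite -(sum_permr s' t'); exact: conn_permr.
Qed.

(** Connected sum along the faces of x and y. The counts of faces and of vertices fall by at most
    one each, and the two components of x and y become one, which frees the point [ry]. *)
Lemma planar_join (e1 f1 : {perm T1}) (e2 f2 : {perm T2}) x y :
  planar e1 f1 -> planar e2 f2 ->
  planar (sum_perm e1 e2) (tperm (inl x) (inr y) * sum_perm f1 f2)%g.
Proof.
move=> [R1 hit1 c1] [R2 hit2 c2]; set e := sum_perm e1 e2; set f := sum_perm f1 f2.
set f' := (_ * f)%g; pose c := conn e f'.
have cC : symmetric c by exact: conn_sym.
have cT : transitive c by exact: connect_trans.
have yx : inr y \notin porbit f (inl x).
  by rewrite porbit_sum_perml; apply/imsetP=> -[].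
have cxy : c (inl x) (inr y) by exact/conn_porbitr/porbit_merge.
have sub z w : conn e f z w -> c z w.
  move=> /(conn_tperm (inl x) (inr y)) -[//|[zxy wxy]].
  have h u : c u (inl x) || c u (inr y) -> c u (inl x).
    by case/orP=> // uy; apply: (cT _ _ _ uy); rewrite cC.
  by apply: (cT _ _ _ (h z zxy)); rewrite cC; exact: h w wxy.
have [rx rxR xr] := hit1 x; have [ry ryR yr] := hit2 y.
exists (inl @: R1 :|: inr @: (R2 :\ ry)) => [z|].
  case: z => z.
    have [r rR zr] := hit1 z; exists (inl r); first by rewrite inE imset_f.
    exact/sub/conn_suml.
  have [r rR zr] := hit2 z; have [rE|rN] := eqVneq r ry; last first.
    exists (inr r); first by rewrite inE (imset_f _ (_ : r \in R2 :\ ry)) ?orbT // !inE rN.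
    exact/sub/conn_sumr.
  exists (inl rx); first by rewrite inE imset_f.
  have c_z : c (inr z) (inr ry) by apply/sub/conn_sumr; rewrite -rE.
  have c_y : c (inr y) (inr ry) by exact/sub/conn_sumr.
  have c_x : c (inl x) (inl rx) by exact/sub/conn_suml.
  rewrite cC in c_y; rewrite cC in cxy.
  exact: cT (cT _ _ _ c_z (cT _ _ _ c_y cxy)) c_x.
have cR : #|(inl @: R1 :|: inr @: (R2 :\ ry) : {set T1 + T2})| + 1 <= #|R1| + #|R2|.
  apply: leq_trans (_ : #|R1| + #|R2 :\ ry| + 1 <= _); last first.
    by rewrite (cardsD1 ry R2) ryR; lia.
  rewrite leq_add2r; apply: leq_trans (leq_card_setU _ _) _.
  by rewrite leq_add ?leq_imset_card.
have xNy : inl x != inr y :> T1 + T2 by [].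
have fc : #|porbits f1| + #|porbits f2| <= #|porbits f'| + 1.
  by rewrite -card_porbits_sum -/f; case: (card_porbits_tperm f xNy) => [|[_]]; rewrite -/f'; lia.
have vc : #|porbits (e1 * f1)%g| + #|porbits (e2 * f2)%g| <= #|porbits (e * f')%g| + 1.
  have -> : (e * f' = tperm ((e^-1)%g (inl x)) ((e^-1)%g (inr y)) * (e * f))%g.
    apply/perm.permP=> z; rewrite !permM; congr (f _).
    by rewrite (inj_tperm _ _ _ (@perm_inj _ e)) !permKV.
  have xNy' : (e^-1)%g (inl x) != (e^-1)%g (inr y) by rewrite (inj_eq perm_inj).
  rewrite -card_porbits_sum -sum_permM -/e -/f.
  by case: (card_porbits_tperm (e * f)%g xNy') => [|[_]]; lia.
rewrite card_sum card_porbits_sum.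
move: c1 c2 cR fc vc; move: #|_ :|: _|.
move: #|porbits e1| #|porbits f1| #|porbits (e1 * f1)%g| #|porbits e2| #|porbits f2| #|porbits (e2 * f2)%g|.
move: #|porbits f'| #|porbits (e * f')%g| #|T1| #|T2| #|R1| #|R2|; lia.
Qed.

End SumPerm.

Section SplitFace.
Variables (T : finType) (e f : {perm T}).

Lemma split_face (A B : seq T) : planar e f -> uniq (A ++ B) -> fcycle f (A ++ B) ->
  exists f' : {perm T}, [/\ planar e f', fcycle f' A, fcycle f' B &
    forall z, z \notin A ++ B -> f' z = f z].
Proof.
case/lastP: A => [|A x]; first by exists f.
case/lastP: B => [|B y]; first by rewrite cats0; exists f.
move=> pl u c; exists (tperm x y * f)%g.
have := c; rewrite cycle_tpermV // => /andP[cA cB]; split=> //.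
  apply: planar_tpermr => //; left.
  by rewrite (porbit_cycle c) ?inE ?mem_cat !mem_rcons !inE eqxx ?orbT.
move=> z; rewrite mem_cat !mem_rcons !inE !negb_or => /andP[/andP[zx _] /andP[zy _]].
by rewrite permM tpermD // eq_sym.
Qed.

Lemma order_eq_off (f' : {perm T}) (A : seq T) z : fcycle f A ->
  (forall z, z \notin A -> f' z = f z) -> z \notin A ->
  fingraph.order f' z = fingraph.order f z.
Proof.
move=> fA ff' zA; rewrite -!size_orbit; congr size; apply: orbit_eq_in => y yz.
rewrite ff' //; apply: contra zA => yA; rewrite -(fconnect_cycle fA yA).
by rewrite (fconnect_sym (@perm_inj _ f)) fconnect_orbit.
Qed.

Lemma order_fcycle (A : seq T) z : uniq A -> fcycle f A -> z \in A ->
  fingraph.order f z = size A.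
Proof. by move=> uA fA zA; rewrite (order_cycle fA). Qed.

Lemma fcycle_nth (A : seq T) z i : fcycle f A -> i < size A ->
  f (nth z A i) = nth z A (i.+1 %% size A).
Proof.
move=> fA iA; have A0 : 0 < size A by apply: leq_ltn_trans iA.
have c : cycle (fun a b => f a == b) A by [].
have [iA1|] := ltnP i.+1 (size A).
  rewrite modn_small //; case: A {A0} iA fA c iA1 => // a A _ _.
  move=> /= /(pathP z) h iA1; have := h i; rewrite size_rcons => /(_ (ltnW iA1)) /eqP.
  rewrite nth_rcons (_ : (i < size A) = true) //.
  case: i iA1 {h} => [|i] iA1 /=; rewrite ?nth_rcons //.
  by rewrite (_ : (i < size A) = true) //; exact: ltnW.
rewrite leq_eqVlt ltnS leqNgt iA orbF => /eqP iE; rewrite -iE modnn.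
have -> : i = (size A).-1 by rewrite iE.
rewrite nth_last; move: c; rewrite (cycle_path z).
by case: A A0 {fA iA iE} => // a A _ /= /andP[/eqP -> _].
Qed.

End SplitFace.

Section Disc.
Variable L : complex.
Notation word := (seq (letter (edge L))).

(* A planar map with one distinguished face, reading [w], and whose other faces
   are mapped to 2-cells or discarded; when [w] is empty there is no
   distinguished face. *)
Record disc (w : word) := Disc {
  dmap :> map_over L;
  dbnd : seq (mdart dmap);
  dbnd_uniq : uniq dbnd;
  dbnd_cycle : fcycle (mface dmap) dbnd;
  dbnd_lam : map (@mlam _ dmap) dbnd = map Some w;
  dbnd_side : forall d, d \in dbnd -> mside d = None;
  dbnd_free : forall d, mside d = None -> d \notin dbnd -> mlam d = None }.

Lemma dbnd_cat u v (D : disc (u ++ v)) : exists A B,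
  [/\ dbnd D = A ++ B, map (@mlam _ D) A = map Some u & map (@mlam _ D) B = map Some v].
Proof.
exists (take (size u) (dbnd D)), (drop (size u) (dbnd D)).
have h := dbnd_lam D; rewrite cat_take_drop map_take map_drop h map_cat.
by rewrite take_size_cat ?drop_size_cat ?size_map.
Qed.

(** Connected sum along the distinguished faces. With x at the end of the cyclic word v u and y at
    the end of r, the merged face reads v u r, which is u r v cyclically. If one of the faces is
    missing, its word is empty and the other disc already serves. *)
Lemma disc_join u r v : disc (u ++ v) -> disc r -> inhabited (disc (u ++ r ++ v)).
Proof.
move=> D1 D2; have [A [B [cE uA vB]]] := dbnd_cat D1.
have [Cx|Cn] := boolP (A ++ B == [::]).
  have /andP[/eqP A0 /eqP B0] : (A == [::]) && (B == [::]) by move: Cx; case: (A); case: (B).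
  have [u0 v0] : u = [::] /\ v = [::].
    by split; apply: size0nil; rewrite -(size_map Some) -?uA -?vB ?A0 ?B0.
  by rewrite u0 v0 cats0; exact: inhabits.
have [/eqP r0|r0] := boolP (dbnd D2 == [::]).
  have -> : r = [::].
    by apply: size0nil; rewrite -(size_map Some) -(dbnd_lam D2) r0.
  exact: inhabits.
have [BA' [x BAE]] : exists BA' x, B ++ A = rcons BA' x.
  case/lastP E: (B ++ A) => [|BA' x]; last by exists BA', x.
  by move: Cn; have := size_cat B A; rewrite E addnC -size_cat -size_eq0 => <-.
have [C' [y CE]] : exists C' y, dbnd D2 = rcons C' y.
  by case/lastP: (dbnd D2) r0 => // C' y _; exists C', y.
pose T := (mdart D1 + mdart D2)%type.
pose e : {perm T} := sum_perm (medge D1) (medge D2).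
pose f0 : {perm T} := sum_perm (mface D1) (mface D2).
pose f : {perm T} := (tperm (inl x) (inr y) * f0)%g.
pose lam (z : T) := match z with inl d => mlam d | inr d => mlam d end.
pose sd (z : T) := match z with inl d => mside d | inr d => mside d end.
pose bnd : seq T := map inl A ++ map inr (dbnd D2) ++ map inl B.
pose bnd0 : seq T := rcons (map inl BA') (inl x) ++ rcons (map inr C') (inr y).
have bnd0E : bnd0 = map inl B ++ map inl A ++ map inr (dbnd D2).
  by rewrite /bnd0 -!map_rcons -BAE -CE map_cat catA.
have ilI : injective (@inl (mdart D1) (mdart D2)) by move=> ? ? [].
have irI : injective (@inr (mdart D1) (mdart D2)) by move=> ? ? [].
have inlE d (S : seq (mdart D2)) : (inl d : T) \in map inr S = false.
  by apply/negbTE/mapP=> -[].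
have inrE d (S : seq (mdart D1)) : (inr d : T) \in map inl S = false.
  by apply/negbTE/mapP=> -[].
have bndP z : (z \in bnd) = match z with inl d => d \in dbnd D1 | inr d => d \in dbnd D2 end.
  by case: z => d; rewrite !mem_cat ?inlE ?inrE ?orbF ?(mem_map ilI) ?(mem_map irI) ?cE ?mem_cat //.
have bnd0P z : (z \in bnd0) = (z \in bnd).
  by rewrite bnd0E !mem_cat orbC -orbA.
have u0 : uniq bnd0.
  rewrite bnd0E catA -map_cat cat_uniq !map_inj_uniq // dbnd_uniq uniq_catC -cE dbnd_uniq andbT /=.
  by apply/hasPn=> _ /mapP[d _ ->]; rewrite /= inrE.
have ubnd : uniq bnd by rewrite /bnd catA uniq_catC -bnd0E.
have fc0 : fcycle f bnd0.
  rewrite /bnd0 cycle_tperm // -!map_rcons -BAE -CE; apply/andP; split.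
    have := dbnd_cycle D1; rewrite cE cycle_catC cycle_map => h.
    by apply: sub_cycle h => a b /= /eqP<-; rewrite sum_perml.
  have := dbnd_cycle D2; rewrite cycle_map => h.
  by apply: sub_cycle h => a b /= /eqP<-; rewrite sum_permr.
have fc : fcycle f bnd by rewrite /bnd catA cycle_catC -bnd0E.
have fE z : z \notin bnd -> f z = f0 z.
  rewrite -bnd0P /bnd0 mem_cat !mem_rcons !inE !negb_or => /andP[/andP[zx _] /andP[zy _]].
  by rewrite permM tpermD // eq_sym.
have sdN z s : sd z = Some s -> z \notin bnd.
  by rewrite bndP; case: z => d /= ds; apply/negP=> /dbnd_side; rewrite ds.
have ord0 z s : sd z = Some s -> fingraph.order f0 z = size (bd (tag s.1)).
  case: z => d /= /mside_order <-.
    by rewrite -!card_porbit_order porbit_sum_perml card_imset.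
  by rewrite -!card_porbit_order porbit_sum_permr card_imset.
have ordE z s : sd z = Some s -> fingraph.order f z = size (bd (tag s.1)).
  move=> zs; rewrite -(ord0 z s zs); apply/esym.
  apply: (order_eq_off fc (f' := f0)); last exact: sdN zs.
  by move=> w /fE.
have eK : involutive e by move=> [d|d]; rewrite /e ?(sum_perml, sum_permr) medgeK.
have e_neq z : e z != z.
  by case: z => d; rewrite /e ?(sum_perml, sum_permr) ?(inj_eq ilI) ?(inj_eq irI) medge_neq.
have pl : planar e f by apply: planar_join; exact: mplanar.
have le z : lam (e z) = omap (@linv _) (lam z).
  by case: z => d; rewrite /e ?(sum_perml, sum_permr) /= mlam_edge.
have sl z s : sd z = Some s -> lam z = Some (side_letter s).
  by case: z => d /=; exact: mside_lam.
have sf z s : sd z = Some s -> sd (f z) = Some (side_next s).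
  move=> zs; rewrite fE ?(sdN z s zs) //; case: z zs => d /= /mside_face <-.
    by rewrite /f0 sum_perml.
  by rewrite /f0 sum_permr.
pose M := MapOver eK e_neq pl le sl sf ordE.
apply: inhabits; apply: (@Disc _ M bnd ubnd fc).
- by rewrite /bnd !map_cat -!map_comp -uA -vB -(dbnd_lam D2).
- by move=> z; rewrite bndP; case: z => d /dbnd_side.
- by move=> z zs; rewrite bndP; case: z zs => d /dbnd_free; exact.
Qed.

End Disc.

Section DiscMoves.
Variable L : complex.
Notation word := (seq (letter (edge L))).

Lemma disc_split u r v (D : disc (u ++ r ++ v)) :
  exists A C B (f' : {perm mdart D}),
  [/\ dbnd D = A ++ C ++ B,
      map (@mlam _ D) (A ++ B) = map Some (u ++ v), map (@mlam _ D) C = map Some r,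
      planar (medge D) f' & [/\ fcycle f' C, fcycle f' (A ++ B) &
      forall z, z \notin dbnd D -> f' z = @mface L D z]].
Proof.
have [A [S [cE uA]]] := dbnd_cat D.
rewrite map_cat => SE; exists A, (take (size r) S), (drop (size r) S).
have cE' : dbnd D = A ++ take (size r) S ++ drop (size r) S by rewrite cat_take_drop.
set C := take _ _; set B := drop _ _.
have rC : map (@mlam _ D) C = map Some r by rewrite map_take SE take_size_cat // size_map.
have vB : map (@mlam _ D) B = map Some v by rewrite map_drop SE drop_size_cat // size_map.
have u1 : uniq (C ++ B ++ A) by rewrite (catA C B A) uniq_catC -cE'; exact: dbnd_uniq.
have c1 : fcycle (mface D) (C ++ B ++ A) by rewrite (catA C B A) cycle_catC -cE'; exact: dbnd_cycle.
have [f' [pl cC cBA off]] := split_face (mplanar D) u1 c1.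
exists f'; split=> //; first by rewrite !map_cat uA vB.
split=> //; first by rewrite cycle_catC.
by move=> z; rewrite cE' => zn; apply: off; move: zn; rewrite !mem_cat orbC orbA.
Qed.

(** The face C that is split off reads [bd c], so it can be declared to lie over c, the index in C
    being the position in the boundary word. *)
Lemma disc_split_cell u c v : disc (u ++ bd c ++ v) -> inhabited (@disc L (u ++ v)).
Proof.
move=> D; have [A [C [B [f' [cE uvE rE pl [cC cAB off]]]]]] := disc_split D.
have sC : size C = size (bd c) by rewrite -(size_map (@mlam _ D)) rE size_map.
pose cell_side (z : mdart D) : option (side L) :=
  if insub (index z C) is Some i then Some (Tagged (fun c => 'I_(size (bd c))) (i : 'I_(size (bd c))), true)
  else mside z.
have [uA uCB] : uniq (A ++ B) /\ uniq C /\ (forall z, z \in C -> z \notin A ++ B).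
  have := dbnd_uniq D; rewrite cE uniq_catCA => u3; split.
    by move: u3; rewrite cat_uniq => /and3P[].
  move: u3; rewrite cat_uniq => /and3P[uC /hasPn h _]; split=> // z zC.
  by apply/negP=> /h; rewrite /= zC.
case: uCB => uC CAB.
have inbnd z : (z \in dbnd D) = (z \in C) || (z \in A ++ B).
  by rewrite cE !mem_cat orbCA.
have side_off z : z \notin C -> cell_side z = mside z.
  by move=> zC; rewrite /cell_side insubN // -leqNgt -sC leqNgt index_mem.
have side_nth z0 i (iq : i < size (bd c)) : cell_side (nth z0 C i) =
    Some (Tagged (fun c => 'I_(size (bd c))) (Ordinal iq), true).
  by rewrite /cell_side index_uniq ?sC // insubT.
have zC_nth z : z \in C -> exists i (iq : i < size (bd c)), z = nth z C i.
  move=> zC; exists (index z C); rewrite -sC.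
  by exists (etrans (index_mem z C) zC); rewrite nth_index.
have sl z s : cell_side z = Some s -> mlam z = Some (side_letter s).
  have [zC|zC] := boolP (z \in C); last by rewrite side_off //; exact: mside_lam.
  have [i [iq zE]] := zC_nth z zC; rewrite zE side_nth => -[<-].
  rewrite -(nth_map _ (mlam z)) ?sC // rE /side_letter /bd_letter /=.
  have l0 : letter (edge L) by exact: (tnth (in_tuple (bd c)) (Ordinal iq)).
  by rewrite (nth_map l0) // (tnth_nth l0).
have sN z s : cell_side z = Some s -> z \notin C -> z \notin dbnd D.
  by move=> + zC; rewrite side_off // => zs; apply/negP=> /dbnd_side; rewrite zs.
have fbnd w : (@mface L D w \in dbnd D) = (w \in dbnd D).
  have := @perm_closed _ (@mface L D) [set z in dbnd D]; move/(_ _ w); rewrite !inE; apply.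
  by move=> z; rewrite !inE; exact: (mem_fcycle (dbnd_cycle D)).
have sf z s : cell_side z = Some s -> cell_side (f' z) = Some (side_next s).
  have [zC|zC] := boolP (z \in C).
    have [i [iq zE]] := zC_nth z zC; rewrite {1}zE side_nth => -[<-].
    rewrite zE (fcycle_nth z cC) ?sC // side_nth ?ltn_mod ?bd_neq0 // => h.
    congr (Some (Tagged _ _, _)); exact: val_inj.
  move=> zs; have zD := sN z s zs zC; move: zs; rewrite side_off // => zs.
  rewrite off // side_off ?(mside_face zs) //.
  by apply: contra zD => fzC; rewrite -fbnd inbnd fzC.
have ordE z s : cell_side z = Some s -> fingraph.order f' z = size (bd (tag s.1)).
  have [zC|zC] := boolP (z \in C).
    have [i [iq zE]] := zC_nth z zC; rewrite {1}zE side_nth => -[<-] /=.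
    by rewrite (order_fcycle uC cC zC).
  move=> zs; have zD := sN z s zs zC; move: zs; rewrite side_off // => zs.
  by rewrite -(mside_order zs) (order_eq_off (dbnd_cycle D) off zD).
pose M := MapOver (@medgeK _ D) (@medge_neq _ D) pl (@mlam_edge _ D) sl sf ordE.
apply: inhabits; apply: (@Disc _ _ M (A ++ B) uA cAB uvE).
- move=> z zAB; have zC : z \notin C by apply/negP=> /CAB; rewrite zAB.
  by rewrite /= side_off // dbnd_side // inbnd zAB orbT.
- move=> z /= zs zAB; have zC : z \notin C.
    apply/negP=> zC; have [i [iq zE]] := zC_nth z zC.
    by move: zs; rewrite zE side_nth.
  by apply: dbnd_free; [rewrite -side_off|rewrite inbnd negb_or zC].
Qed.

(** The face split off is a bigon x, y. Zipping makes x and y the two sides of one edge, a component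
    of its own that is discarded by erasing its labels, and glues the far sides of the two edges
    together. *)
Lemma disc_split_spur u l v : disc (u ++ [:: l; linv l] ++ v) -> inhabited (@disc L (u ++ v)).
Proof.
move=> D; have [A [C [B [f' [cE uvE rE pl [cC cAB off]]]]]] := disc_split D.
case: C rE cE cC => [|x [|y [|]]] //= [xl yl] cE /and3P[/eqP f'x /eqP f'y _].
have [uA xy_AB] : uniq (A ++ B) /\ (x \notin A ++ B) /\ (y \notin A ++ B) /\ x != y.
  have := dbnd_uniq D; rewrite cE (uniq_catCA A [:: x; y] B) /= !inE !negb_or -!andbA.
  by case/and4P=> xy xAB yAB uAB.
case: xy_AB => xAB [yAB xy].
have inbnd z : (z \in dbnd D) = (z \in [:: x; y]) || (z \in A ++ B).
  by rewrite cE (mem_cat z A) (mem_cat z [:: x; y] B) mem_cat orbCA.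
have xo : x \in porbit (medge D * f')%g (medge D y).
  by have := mem_porbit (medge D * f')%g 1 (medge D y); rewrite expg1 permM medgeK f'y.
have [e' [e'K e'_neq pl' e'x [e'ex e'off]]] := planar_zip (@medgeK _ D) (@medge_neq _ D) pl xy xo.
have e'y : e' y = x by rewrite -e'x e'K.
have e'ey : e' (medge D y) = medge D x by rewrite -e'ex e'K.
pose lam z := if z \in [:: x; y] then None else mlam z.
have e'in z : (e' z \in [:: x; y]) = (z \in [:: x; y]).
  have h w : w \in [:: x; y] -> e' w \in [:: x; y].
    by rewrite !inE => /orP[]/eqP->; rewrite ?e'x ?e'y eqxx ?orbT.
  by apply/idP/idP=> [/h|/h //]; rewrite e'K.
have le z : lam (e' z) = omap (@linv _) (lam z).
  rewrite /lam e'in; case: ifPn => //; rewrite !inE negb_or => /andP[zx zy].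
  have [->|zex] := eqVneq z (medge D x).
    by rewrite e'ex !mlam_edge xl yl /= !linvK.
  have [->|zey] := eqVneq z (medge D y).
    by rewrite e'ey !mlam_edge xl yl /= !linvK.
  by rewrite e'off ?mlam_edge // !inE !negb_or zx zy zex zey.
have sN (z : mdart D) s : mside z = Some s -> z \notin dbnd D.
  by move=> zs; apply/negP=> /dbnd_side; rewrite zs.
have sl (z : mdart D) s : mside z = Some s -> lam z = Some (side_letter s).
  move=> zs; rewrite /lam (_ : (z \in [:: x; y]) = false); first exact: mside_lam.
  by apply/negbTE; apply: contra (sN z s zs); rewrite inbnd => ->.
have sf (z : mdart D) s : mside z = Some s -> mside (f' z) = Some (side_next s).
  by move=> zs; rewrite off ?(sN z s zs) //; exact: mside_face.
have ordE (z : mdart D) s : mside z = Some s -> fingraph.order f' z = size (bd (tag s.1)).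
  by move=> zs; rewrite (order_eq_off (dbnd_cycle D) off (sN z s zs)); exact: mside_order.
pose M := MapOver e'K e'_neq pl' le sl sf ordE.
apply: inhabits; apply: (@Disc _ _ M (A ++ B) uA cAB).
- rewrite -uvE; apply/eq_in_map => z zAB; rewrite /= /lam !inE.
  case: eqVneq zAB => [->|_]; first by rewrite (negPf xAB).
  by case: eqVneq => [->|//]; rewrite (negPf yAB).
- by move=> z zAB; rewrite /= dbnd_side // inbnd zAB orbT.
- move=> z /= zs zAB; rewrite /lam; case: ifPn => // zxy.
  by apply: dbnd_free; rewrite // inbnd negb_or zxy.
Qed.

End DiscMoves.

(** * Discs for elementary homotopies *)

Section BasicDiscs.
Variable L : complex.

Lemma disc_nil : inhabited (@disc L [::]).
Proof.
have pl : planar (1 : {perm void})%g 1%g.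
  by exists set0; [case|rewrite cards0 card_void].
pose lam (z : void) : option (letter (edge L)) := match z with end.
pose sd (z : void) : option (side L) := match z with end.
have eK : involutive (1 : {perm void})%g by case.
have h1 (d : void) : (1 : {perm void})%g d != d by case: d.
have h2 (d : void) : lam ((1 : {perm void})%g d) = omap (@linv _) (lam d) by case: d.
have h3 (d : void) s : sd d = Some s -> lam d = Some (side_letter s) by case: d.
have h4 (d : void) s : sd d = Some s -> sd ((1 : {perm void})%g d) = Some (side_next s) by case: d.
have h5 (d : void) s : sd d = Some s -> fingraph.order (1 : {perm void})%g d = size (bd (tag s.1)) by case: d.
apply: inhabits; apply: (@Disc L [::] (MapOver eK h1 pl h2 h3 h4 h5) [::]) => // d; by case: d.
Qed.

Lemma disc_spur (l : letter (edge L)) : inhabited (@disc L [:: l; linv l]).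
Proof.
pose e : {perm bool} := perm negb_inj.
have eE b : e b = ~~ b by rewrite permE.
have eK : involutive e by move=> b; rewrite !eE negbK.
have e_neq b : e b != b by rewrite eE; case: b.
have pl : planar e e.
  exists [set true] => [b|]; last first.
    have eC := card_porbits_involution eK e_neq; rewrite card_bool in eC.
    have ee : (e * e = 1)%g by apply/perm.permP=> b; rewrite permM eK perm1.
    have c1 : #|porbits (1 : {perm bool})%g| = 2.
      rewrite /porbits card_imset ?card_bool // => b c bc.
      have : b \in porbit 1%g c by rewrite -bc porbit_id.
      by rewrite porbit_fix ?perm1 // inE => /eqP.
    by rewrite ee c1 card_bool cards1; move: eC; move: #|porbits e|; lia.
  exists true; first by rewrite inE.
  case: b; first exact: connect0.
  by have := conn_perml e e false; rewrite eE.
pose lam (b : bool) := Some (if b then l else linv l).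
pose sd (b : bool) : option (side L) := None.
have h2 b : lam (e b) = omap (@linv _) (lam b) by rewrite eE; case: b; rewrite /lam //= linvK.
have h3 b s : sd b = Some s -> lam b = Some (side_letter s) by [].
have h4 b s : sd b = Some s -> sd (e b) = Some (side_next s) by [].
have h5 b s : sd b = Some s -> fingraph.order e b = size (bd (tag s.1)) by [].
apply: inhabits; apply: (@Disc L _ (MapOver eK e_neq pl h2 h3 h4 h5) [:: true; false]) => //=.
- by rewrite !eE.
- by case.
Qed.

(** A polygon on the sphere: the darts [(i, true)] bound the distinguished face, and the darts
    [(i, false)] bound a face over c, traversed backwards because it lies on the other side. *)
Lemma disc_cell (c : cell L) : inhabited (@disc L (bd c)).
Proof.
set q := size (bd c); have q0 : 0 < q := bd_neq0 c.
pose T := ('I_q * bool)%type.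
pose ef (z : T) : T := (z.1, ~~ z.2).
pose ff (z : T) : T := (if z.2 then ordS z.1 else ord_pred z.1, z.2).
have efK : involutive ef by move=> [i b]; rewrite /ef /= negbK.
have ffI : injective ff.
  move=> [i b] [j b']; rewrite /ff /= => -[+ bb]; rewrite -bb.
  by case: b {bb} => [/(can_inj (@ordSK q))|/(can_inj (@ord_predK q))] ->.
pose e := perm (inv_inj efK); pose f := perm ffI.
have eE z : e z = (z.1, ~~ z.2) by rewrite permE.
have fE z : f z = (if z.2 then ordS z.1 else ord_pred z.1, z.2) by rewrite permE.
have eK : involutive e by move=> z; rewrite !permE efK.
have e_neq z : e z != z by rewrite eE; case: z => i []; apply/eqP=> -[].
have fiter z k : iter k f z = (iter k (if z.2 then @ordS q else @ord_pred q) z.1, z.2).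
  by elim: k => [|k IHk] /=; [case: z|rewrite IHk fE /=; case: z.2].
have reach z i : (i, z.2) \in porbit f z.
  pose h := fun k : 'I_q => iter k (if z.2 then @ordS q else @ord_pred q) z.1.
  have hI : injective h.
    by rewrite /h; case: z.2; [exact: iter_ordS_inj|exact: iter_ord_pred_inj].
  have [k kE] : exists k, h k = i by exists (invF hI i); rewrite f_invF.
  by rewrite -kE /h -fiter -permX mem_porbit.
have porb z : porbit f z = [set w | w.2 == z.2].
  apply/setP=> w; rewrite inE; apply/idP/eqP=> [/porbitP[k ->]|wz].
    by rewrite permX fiter.
  by have := reach z w.1; rewrite -wz -surjective_pairing.
have ordE z : fingraph.order f z = q.
  rewrite -card_porbit_order porb.
  rewrite (_ : [set w | w.2 == z.2] = [set (i, z.2) | i in 'I_q]).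
    by rewrite card_imset ?card_ord // => i j [].
  apply/setP=> -[i b]; rewrite inE /=; apply/eqP/imsetP=> [->|[j _ [_ ->]] //]; by exists i.
pose i0 := Ordinal q0.
have pl : planar e f.
  exists [set (i0, true)] => [z|].
    exists (i0, true); first by rewrite inE.
    have h i : conn e f (i, true) (i0, true) by apply: conn_porbitr; exact: (reach (i, true)).
    case: z => i [] //; apply: connect_trans (h i).
    by have := conn_perml e f (i, false); rewrite eE.
  have vE z : (e * f)%g z = (if z.2 then ord_pred z.1 else ordS z.1, ~~ z.2).
    by rewrite permM eE fE /=; case: z.2.
  have vK : involutive (e * f)%g.
    by case=> i b; rewrite !vE /= negbK; case: b => /=; rewrite ?ordSK ?ord_predK.
  have v_neq z : (e * f)%g z != z by rewrite vE; case: z => i []; apply/eqP=> -[].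
  have := card_porbits_involution eK e_neq; have := card_porbits_involution vK v_neq.
  have : 1 < #|porbits f|.
    apply/card_gt1P; exists (porbit f (i0, true)), (porbit f (i0, false)).
    split; rewrite ?imset_f //; apply/eqP=> /setP/(_ (i0, true)).
    by rewrite !porb !inE.
  rewrite cards1; move: #|porbits f| #|porbits e| #|porbits _| #|_|; lia.
pose lam (z : T) := Some (if z.2 then bd_letter (L := L) z.1 else linv (bd_letter z.1)).
pose sd (z : T) : option (side L) :=
  if z.2 then None else Some (Tagged (fun c => 'I_(size (bd c))) z.1, false).
have h2 z : lam (e z) = omap (@linv _) (lam z).
  by rewrite /lam eE /=; case: z.2 => //=; rewrite linvK.
have h3 z s : sd z = Some s -> lam z = Some (side_letter s).
  by rewrite /sd /lam; case: z => i [] //= [<-].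
have h4 z s : sd z = Some s -> sd (f z) = Some (side_next s).
  by rewrite /sd fE; case: z => i [] //= [<-].
have h5 z s : sd z = Some s -> fingraph.order f z = size (bd (tag s.1)).
  by rewrite ordE /sd; case: z.2 => // -[<-].
pose M := MapOver eK e_neq pl h2 h3 h4 h5.
have memo z : (z \in orbit f (i0, true)) = z.2.
  by rewrite -fconnect_orbit -mem_porbit_fconnect porb inE eqb_id.
apply: inhabits; apply: (@Disc L _ M (orbit f (i0, true))).
- exact: orbit_uniq.
- exact: cycle_orbit (@perm_inj _ _) _.
- have l0 := bd_letter i0.
  apply: (@eq_from_nth _ None); rewrite !size_map size_orbit ordE // => k kq.
  rewrite (nth_map (i0, true)) ?size_orbit ?ordE // (nth_map l0) // nth_traject ?ordE // fiter /=.
  rewrite /lam /bd_letter /= (tnth_nth l0) /=; congr (Some (nth _ _ _)).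
  have -> : forall m, val (iter m (@ordS q) i0) = m %% q :> nat; last exact: modn_small.
  elim=> [|m IHm] /=; first by rewrite mod0n.
  by rewrite IHm -addn1 modnDml addn1.
- by move=> z; rewrite memo /= /sd => ->.
- by move=> z /=; rewrite /sd memo; case: z.2.
Qed.

(** An equivalence, so that the induction passes through [homotopic_sym]. *)
Lemma homotopic_disc u v : homotopic u v -> inhabited (@disc L u) <-> inhabited (@disc L v).
Proof.
elim=> {u v} [u|u v _ IH|u v w _ IH1 _ IH2|u v l|u v c] //.
- by rewrite IH.
- by rewrite IH1.
- split=> -[D]; last exact: disc_split_spur D.
  by have [D'] := disc_spur l; exact: disc_join D D'.
- split=> -[D]; last exact: disc_split_cell D.
  by have [D'] := disc_cell c; exact: disc_join D D'.
Qed.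

End BasicDiscs.

(** * Removing folding pairs *)

Section Mirror.
Variable L : complex.
Implicit Types s : side L.

(* The side facing [s] when a 2-cell is glued to its mirror image. *)
Definition side_mirror s : side L := (s.1, ~~ s.2).

Definition side_prev s : side L :=
  (Tagged (fun c => 'I_(size (bd c)))
     (if s.2 then ord_pred (tagged s.1) else ordS (tagged s.1)), s.2).

Lemma side_nextK : cancel (@side_next L) side_prev.
Proof. by case=> -[c i] []; rewrite /side_prev /side_next /= ?ordSK ?ord_predK. Qed.

Lemma side_next_mirror s : side_next (side_mirror (side_next s)) = side_mirror s.
Proof. by case: s => -[c i] []; rewrite /side_next /side_mirror /= ?ordSK ?ord_predK. Qed.

Lemma side_letter_mirror s : side_letter (side_mirror s) = linv (side_letter s).
Proof. by case: s => -[c i] []; rewrite /side_letter /side_mirror //= linvK. Qed.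

(** In a folding pair it is the side before s2 that mirrors s1, so zipping pairs the dart of s1 with
    the predecessor of that of s2. *)
Lemma side_corner_fold s1 s2 : side_corner s1 = link_rev (side_corner s2) ->
  s2 = side_next (side_mirror s1).
Proof.
case: s1 s2 => [k1 b1] [k2 b2]; rewrite /side_corner /link_rev /side_next /side_mirror /=.
case: b1; case: b2 => //= -[E].
  by rewrite E /= ordSK; case: (k2).
by rewrite -E.
Qed.

Lemma iter_side_next_dir k s : (iter k (@side_next L) s).2 = s.2.
Proof. by elim: k => //= k ->. Qed.

End Mirror.

Section FoldDisc.
Local Open Scope ring_scope.
Variables (R : realType) (L : complex) (K : subcomplex L) (n : nat) (Ki : 'I_n -> subcomplex L).
Hypotheses (wedge : is_wedge K Ki) (weight : weight_test R K Ki).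
Hypothesis exp0 : forall c : cell L, exponent_sum_zero c.
Variables (w : seq (letter (edge L))) (i0 : 'I_n).
Hypothesis w_sub : forall j : 'I_(size w), sub_edge (Ki i0) (tnth (in_tuple w) j).1.
Hypothesis w_exp : \sum_(l <- w) letter_sign (Some l) = 0.

Lemma dbnd_face (D : disc w) (d : mdart D) : (mface D d \in dbnd D) = (d \in dbnd D).
Proof.
have h : {homo mface D : x / x \in [set z in dbnd D]}.
  by move=> z; rewrite !inE; exact: (mem_fcycle (dbnd_cycle D)).
by have := perm_closed h d; rewrite !inE.
Qed.

Lemma disc_linked (D : disc w) (d : mdart D) : mside d = None ->
  linked Ki (mlam d) (mlam (mface D d)).
Proof.
move=> ds; have [dD|dD] := boolP (d \in dbnd D); last first.
  by left; split; apply: dbnd_free; rewrite ?dbnd_face // mside_faceN.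
have in_w z : z \in dbnd D -> in_sub Ki i0 (@mlam _ D z).
  move=> zD; have iD : (index z (dbnd D) < size w)%N.
    by rewrite -(size_map Some) -(dbnd_lam D) size_map index_mem.
  exists (tnth (in_tuple w) (Ordinal iD)); last exact: w_sub.
  have l0 := tnth (in_tuple w) (Ordinal iD).
  rewrite (tnth_nth l0) /= -(nth_map _ (Some l0)) // -(dbnd_lam D).
  by rewrite (nth_map z) ?index_mem ?nth_index.
by right; exists i0; apply: in_w; rewrite ?dbnd_face.
Qed.

Lemma dead_orbit (D : disc w) (d z : mdart D) : mside d = None -> d \notin dbnd D ->
  z \in orbit (mface D) d -> mlam z = None.
Proof.
move=> ds dD; pose U := [set z : mdart D | ~~ isSome (mside z) & z \notin dbnd D].
have UU : {homo mface D : z / z \in U}.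
  move=> y; rewrite !inE dbnd_face => /andP[+ ->]; case E: (mside y) => // _.
  by rewrite mside_faceN.
have dU : d \in U by rewrite inE ds.
rewrite -fconnect_orbit -mem_porbit_fconnect => /(subsetP (porbit_closed UU dU)).
by rewrite inE => /andP[zs zD]; apply: dbnd_free => //; case: (mside z) zs.
Qed.

Lemma disc_sum (D : disc w) (d : mdart D) : mside d = None ->
  \sum_(y <- orbit (mface D) d) letter_sign (mlam y) = 0.
Proof.
move=> ds; have [dD|dD] := boolP (d \in dbnd D); last first.
  by rewrite big_seq big1 // => y /(dead_orbit ds dD) ->.
have [k ->] := orbit_rot_cycle (dbnd_cycle D) (dbnd_uniq D) dD.
rewrite (perm_big (dbnd D)) ?perm_rot //= -[RHS]w_exp.
by rewrite -(big_map (@mlam _ D) xpredT (@letter_sign L)) dbnd_lam big_map.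
Qed.

(** After zipping, the two mirror-image faces form a set invariant under [e'] and f. Erasing its
    labels and sides discards it; at least one outside dart disappears and none is created. *)
Lemma disc_fold_step (D : disc w) : (exists d : mdart D, outside K d) ->
  exists D' : disc w, (#|[set d : mdart D' | outside K d]| < #|[set d : mdart D | outside K d]|)%N.
Proof.
move=> Dout.
have [d1 [d2 [s1 [s2 [d1s d2s s1K s2K [d12 s12]]]]]] :=
  exists_fold wedge weight (fun c _ => exp0 c) (@disc_linked D) (@disc_sum D) Dout.
set e := medge D in d12; set f := mface D in d12.
pose b := (f^-1)%g d2; have fb : f b = d2 by rewrite permKV.
have s2E := side_corner_fold s12.
have bs k : mside (iter k (f^-1)%g b) = Some (side_mirror (iter k (@side_next L) s1)).
  elim: k => [|k IHk] /=.
    have [|t bt tE] := @mside_face_inv _ D b s2; first by rewrite -/f fb.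
    by rewrite bt; congr Some; apply: (can_inj (@side_nextK L)); rewrite -tE s2E.
  set z := iter k _ b in IHk *.
  have [|t bt tE] := @mside_face_inv _ D ((f^-1)%g z) (side_mirror (iter k (@side_next L) s1)).
    by rewrite -/f permKV.
  by rewrite bt; congr Some; apply: (can_inj (@side_nextK L)); rewrite -tE side_next_mirror.
have b0 : mside b = Some (side_mirror s1) by exact: bs 0%N.
(* The two faces are traversed in opposite directions, so they are distinct. *)
have bNa : b \notin porbit f d1.
  apply/negP=> /porbitP[k]; rewrite permX => bk; move: b0; rewrite bk (mside_iter k d1s).
  by move=> [] /(congr1 snd) /=; rewrite iter_side_next_dir; case: s1.2.
have oab : fingraph.order f d1 = fingraph.order f b.
  by rewrite (mside_order d1s) (mside_order b0).
have lam_ab k : mlam (iter k (f^-1)%g b) = omap (@linv _) (mlam (iter k f d1)).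
  by rewrite (mside_lam (bs k)) (mside_lam (mside_iter k d1s)) side_letter_mirror.
have abo : d1 \in porbit (e * f)%g (e b).
  by rewrite porbit_sym -eq_porbit_mem -porbit_perm1 permM medgeK fb eq_porbit_mem.
have omapK : involutive (omap (@linv (edge L))) by case=> //= l; rewrite linvK.
have [e' [e'K e'_neq pl le e'ab]] := planar_mirror omapK (@medgeK _ D) (@medge_neq _ D)
  (@mplanar _ D) (@mlam_edge _ D) bNa oab lam_ab abo.
pose X := porbit f d1 :|: porbit f b.
have e'X z : (e' z \in X) = (z \in X).
  apply: perm_closed => {}z; rewrite !inE => /orP[].
    rewrite mem_porbit_fconnect => za; rewrite -(iter_findex za) e'ab ?findex_max //.
    by rewrite -permX -(porbitV f b) mem_porbit orbT.
  rewrite -(porbitV f b) mem_porbit_fconnect => zb.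
  have kb : (findex (f^-1)%g b z < fingraph.order f d1)%N.
    by rewrite oab -[fingraph.order f b]card_porbit_order -porbitV card_porbit_order findex_max.
  by rewrite -(iter_findex zb) -(e'ab _ kb) e'K -permX mem_porbit.
have fX z : (f z \in X) = (z \in X).
  by rewrite !inE -!eq_porbit_mem porbit_perm1.
have Xside z : z \in X -> isSome (mside z).
  rewrite inE => /orP[]; last rewrite -porbitV; move=> /porbitP[k ->]; rewrite permX.
    by rewrite (mside_iter k d1s).
  by rewrite bs.
have XD z : z \in X -> z \notin dbnd D by move=> /Xside zs; apply/negP=> /dbnd_side zN; rewrite zN in zs.
pose lam z := if z \in X then None else @mlam _ D z.
pose sd z := if z \in X then None else @mside _ D z.
have le' z : lam (e' z) = omap (@linv _) (lam z).
  by rewrite /lam e'X; case: ifP => // _; exact: le.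
have sl z s : sd z = Some s -> lam z = Some (side_letter s).
  by rewrite /sd /lam; case: ifP => // _; exact: mside_lam.
have sf z s : sd z = Some s -> sd (f z) = Some (side_next s).
  by rewrite /sd fX; case: ifP => // _; exact: mside_face.
have so z s : sd z = Some s -> fingraph.order f z = size (bd (tag s.1)).
  by rewrite /sd; case: ifP => // _; exact: mside_order.
pose M := MapOver e'K e'_neq pl le' sl sf so.
have Dl : map (@mlam _ M) (dbnd D) = map Some w.
  rewrite -(dbnd_lam D); apply/eq_in_map => z zD; rewrite /= /lam.
  by case: ifP => // /XD; rewrite zD.
have Ds (z : mdart M) : z \in dbnd D -> mside z = None.
  by move=> zD; rewrite /= /sd; case: ifP => // _; exact: dbnd_side.
have Df (z : mdart M) : mside z = None -> z \notin dbnd D -> mlam z = None.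
  by rewrite /= /sd /lam; case: ifP => // _; exact: dbnd_free.
exists (@Disc L w M (dbnd D) (dbnd_uniq D) (dbnd_cycle D) Dl Ds Df) => /=.
apply: proper_card; apply/properP; split.
  by apply/subsetP=> z; rewrite !inE /outside /= /sd; case: ifP.
exists d1; first by rewrite inE /outside d1s; apply/asboolP.
by rewrite inE /outside /= /sd inE porbit_id.
Qed.

Lemma disc_fold : inhabited (disc w) -> exists D : disc w, forall d : mdart D, ~~ outside K d.
Proof.
case=> D; have [m] := ubnP #|[set d : mdart D | outside K d]|.
elim: m D => // m IHm D; rewrite ltnS => Dm.
have [out|none] := pselect (exists d : mdart D, outside K d).
  by have [D' D'D] := disc_fold_step out; apply: (IHm D'); exact: leq_trans D'D Dm.
by exists D => d; apply/negP=> dout; apply: none; exists d.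
Qed.

End FoldDisc.

(** * Exponent sums and restriction of words to a subcomplex *)

Section Exponent.
Local Open Scope ring_scope.
Variable L : complex.
Hypothesis exp0 : forall c : cell L, exponent_sum_zero c.

(** This gives exponent sum zero to the boundary word of a disc, as the search for folds
    requires. *)
Lemma homotopic_exponent u v : homotopic u v ->
  \sum_(l <- u) letter_sign (Some l) = \sum_(l <- v) letter_sign (L := L) (Some l).
Proof.
elim=> {u v} // [u v w _ -> _ ->//|u v l|u v c]; rewrite !big_cat /=; congr (_ + _).
  by case: l => x []; rewrite !big_cons big_nil /=; ring.
by rewrite (sum_letter_sign (bd c)) exp0 subrr add0r.
Qed.

End Exponent.

Section Restrict.
Variables (L : complex) (K : subcomplex L).
Notation restr := (pmap (@restrict_letter L K)).

Lemma restrict_sub_letter : pcancel (@sub_letter_val L K) (@restrict_letter L K).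
Proof. by case=> x b; rewrite /restrict_letter /sub_letter_val /= valK. Qed.

Lemma restrict_linv l : restrict_letter K (linv l) = omap (@linv _) (restrict_letter K l).
Proof. by rewrite /restrict_letter /=; case: insub. Qed.

Lemma pmap_word_inv (w : seq (letter (edge L))) :
  restr (word_inv w) = @word_inv (complex_of_sub K) (restr w).
Proof.
elim: w => [|l w IHw] //; rewrite /word_inv /= rev_cons -cats1 pmap_cat IHw /= restrict_linv.
case: (restrict_letter K l) => [l'|] /=; last by rewrite cats0.
by rewrite rev_cons -cats1.
Qed.

Lemma homotopic_word_inv (w : seq (letter (edge L))) :
  homotopic w [::] -> homotopic (word_inv w) [::].
Proof.
move=> h; apply: homotopic_trans (homotopic_invl w).
by have := homotopic_catl (word_inv w) (homotopic_sym h); rewrite cats0.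
Qed.

Lemma homotopic_catr_nil (A B : seq (letter (edge L))) :
  homotopic A [::] -> homotopic (A ++ B) [::] -> homotopic B [::].
Proof.
move=> hA; apply: homotopic_trans; apply: homotopic_sym.
exact: (homotopic_catr B hA).
Qed.

Lemma homotopic_catC_nil (A B : seq (letter (edge L))) :
  homotopic (A ++ B) [::] -> homotopic (B ++ A) [::].
Proof.
move=> h; have h1 := homotopic_catl (word_inv A) (homotopic_catr A h).
have h2 : homotopic (word_inv A ++ A) [::] by exact: homotopic_invl.
apply: homotopic_trans h2; apply: homotopic_trans h1; rewrite !catA.
apply: homotopic_sym; exact: (homotopic_catr A (homotopic_catr B (homotopic_invl A))).
Qed.

End Restrict.

(** * Injectivity on fundamental groups *)

Section Injectivity.
Variables (R : realType) (L : complex) (K : subcomplex L) (n : nat) (Ki : 'I_n -> subcomplex L).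
Hypotheses (wedge : is_wedge K Ki) (weight : weight_test R K Ki).
Hypothesis exp0 : forall c : cell L, exponent_sum_zero c.
Variable i0 : 'I_n.
Notation Gi := (complex_of_sub (Ki i0)).
Notation restr := (pmap (@restrict_letter L (Ki i0))).

(** Deleting the letters outside K_i is, on words, the retraction of the wedge K onto K_i that
    collapses the other summands: the boundary of a 2-cell of another K_j has no letter in K_i. *)
Lemma restrict_cell c : sub_cell K c -> @homotopic Gi (restr (bd c)) [::].
Proof.
case: (wedge) => _ -> tE _ [j _ cj]; have [ji|ji] := eqVneq j i0.
  rewrite ji in cj; pose c' : cell Gi := exist _ c (mem_set cj).
  by have := homotopic_sym (homotopic_cell [::] [::] c'); rewrite cat0s cats0.
suff -> : restr (bd c) = [::] by exact: homotopic_refl.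
have : forall i : 'I_(size (bd c)), sub_edge (Ki j) (tnth (in_tuple (bd c)) i).1.
  exact: sub_closed cj.
elim: (bd c) => //= l w IHw h; rewrite IHw => [|i]; last first.
  by have := h (lift ord0 i); rewrite !(tnth_nth l).
rewrite /restrict_letter insubF //; apply/negbTE/negP => /set_mem li.
have lj : sub_edge (Ki j) l.1 by exact: (h ord0).
by move/eqP: ji; apply; apply: (tE j i0) => //; exists l.1.
Qed.

Section Disc.
Variables (w : seq (letter (edge L))) (D : disc w).
Hypothesis Din : forall d : mdart D, ~~ outside K d.
Notation e := (medge D).
Notation f := (mface D).

Definition dart_word (d : mdart D) : seq (letter (edge Gi)) :=
  if mlam d is Some l then restr [:: l] else [::].

Definition trivial_word (l : seq (mdart D)) : bool :=
  `[< @homotopic Gi (flatten (map dart_word l)) [::] >].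

Lemma dart_wordE (l : seq (mdart D)) w' : map (@mlam _ D) l = map Some w' ->
  flatten (map dart_word l) = restr w'.
Proof.
elim: l w' => [|d l IHl] [|x w'] //= [dx /IHl ->].
by rewrite /dart_word dx /=; case: (restrict_letter _ x).
Qed.

Lemma trivial_rot A B : trivial_word (A ++ B) -> trivial_word (B ++ A).
Proof.
move=> /asboolP; rewrite map_cat flatten_cat => /homotopic_catC_nil h.
by apply/asboolP; rewrite map_cat flatten_cat.
Qed.

Lemma trivial_cat A B : trivial_word A -> trivial_word B -> trivial_word (A ++ B).
Proof.
move=> /asboolP hA /asboolP hB; apply/asboolP; rewrite map_cat flatten_cat.
exact: homotopic_cat hA hB.
Qed.

Lemma trivial_catl A B : trivial_word A -> trivial_word (A ++ B) -> trivial_word B.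
Proof.
move=> /asboolP hA /asboolP; rewrite map_cat flatten_cat => hAB; apply/asboolP.
exact: homotopic_catr_nil hA hAB.
Qed.

Lemma trivial_edge d : trivial_word [:: d; e d].
Proof.
apply/asboolP; rewrite /= cats0 /dart_word mlam_edge.
case: (mlam d) => [l|] /=; last exact: homotopic_refl.
rewrite restrict_linv; case: (restrict_letter _ l) => [l'|]; last exact: homotopic_refl.
exact/homotopic_sym/(@homotopic_spur Gi [::] [::] l').
Qed.

Lemma good_face d : d \notin dbnd D -> good_orbit trivial_word f d.
Proof.
move=> dD; case ds: (mside d) => [s|]; last first.
  apply/asboolP; suff -> : flatten [seq dart_word z | z <- orbit f d] = [::] by exact: homotopic_refl.
  have := @dead_orbit _ _ D d; move/(_ _ ds dD).
  elim: (orbit f d) => //= z l IHl h; rewrite IHl => [|y yl]; last by apply: h; rewrite inE yl orbT.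
  by rewrite /dart_word h // mem_head.
have sK : sub_cell K (tag s.1).
  by have := Din d; rewrite /outside ds => /asboolPn/contrapT.
have oE := mside_order ds.
case: s ds sK oE => -[c i] b /= ds cK oE; have q0 := bd_neq0 c.
(* Read from this position, the face spells exactly [bd c], or exactly [word_inv (bd c)] when
   traversed backwards from the last letter. *)
pose j : 'I_(size (bd c)) := if b then Ordinal q0 else rev_ord (Ordinal q0).
have [k kE] : exists k, iter k (if b then @ordS _ else @ord_pred _) i = j.
  pose h := fun k : 'I_(size (bd c)) => iter k (if b then @ordS _ else @ord_pred _) i.
  have hI : injective h by rewrite /h; case: (b); [exact: iter_ordS_inj|exact: iter_ord_pred_inj].
  by exists (invF hI j); exact: (f_invF hI j).
have next_iter m (t : 'I_(size (bd c))) :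
    iter m (@side_next L) (existT _ c t, b) =
    (existT _ c (iter m (if b then @ordS _ else @ord_pred _) t), b).
  by elim: m => //= m ->; rewrite /side_next /=; case: (b).
set z := iter k f d; have zs : mside z = Some (existT _ c j, b).
  by rewrite (mside_iter k ds) next_iter kE.
have zd : z \in porbit f d by rewrite /z -permX mem_porbit.
rewrite -(good_porbit trivial_rot zd); apply/asboolP.
have zo : fingraph.order f z = size (bd c) by rewrite (mside_order zs).
have l0 := bd_letter j.
rewrite (@dart_wordE _ (if b then bd c else word_inv (bd c))).
  case: (b); first exact: restrict_cell.
  by rewrite pmap_word_inv; apply: homotopic_word_inv; exact: restrict_cell.
apply: (@eq_from_nth _ None); rewrite size_map size_orbit zo.
  by rewrite size_map; case: (b); rewrite // size_rev size_map.
move=> m mq; rewrite (nth_map z) ?size_orbit ?zo // nth_traject ?zo //.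
rewrite (mside_lam (mside_iter m zs)) next_iter (nth_map l0); last first.
  by case: (b); rewrite // size_rev size_map.
congr Some; rewrite /side_letter /j /=; case: (b); rewrite /bd_letter (tnth_nth l0) /=.
  have -> : forall m, val (iter m (@ordS (size (bd c))) (Ordinal q0)) = m %% (size (bd c));
    last by rewrite modn_small.
  elim=> [|m' IHm] /=; first by rewrite mod0n.
  by rewrite IHm -addn1 modnDml addn1.
rewrite nth_rev size_map // (nth_map l0); last by rewrite ltn_subrL.
congr (linv (nth _ _ _)).
have predE : forall p, p < size (bd c) ->
    val (iter p (@ord_pred (size (bd c))) (rev_ord (Ordinal q0))) = size (bd c) - p.+1.
  elim=> [|p IHp] pq //=; rewrite IHp ?(ltnW pq) //.
  have -> : (size (bd c) - p.+1 + size (bd c)).-1 = size (bd c) - p.+2 + size (bd c) by lia.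
  by rewrite modnDr modn_small //; lia.
exact: predE.
Qed.

Lemma card_good_face : #|porbits f| <= #|good_orbits trivial_word f| + 1.
Proof.
have sub : porbits f \subset good_orbits trivial_word f :|: [set [set z in dbnd D]].
  apply/subsetP=> _ /imsetP[d _ ->]; rewrite !inE.
  have [dD|dD] := boolP (d \in dbnd D).
    by rewrite (porbit_cycle (dbnd_cycle D) dD) eqxx orbT.
  by rewrite imset_f // -topredE /= good_face.
apply: leq_trans (subset_leq_card sub) _; apply: leq_trans (leq_card_setU _ _) _.
by rewrite cards1.
Qed.

(* With the weight 2 on the existence of a bad face, a single bad face would
   push [phi] beyond its value on a tree of isolated edges. *)
Lemma trivial_dbnd : trivial_word (dbnd D).
Proof.
case E: (dbnd D) => [|d0 l]; first by apply/asboolP; exact: homotopic_refl.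
have step s x y := phi_tperm trivial_rot trivial_cat trivial_catl s x y (leqnn 2).
have iso (s : {perm mdart D}) x : x \in [set: mdart D] -> s x = e x -> s (e x) != x ->
    phi trivial_word 2 (tperm (e x) ((s^-1)%g x) * s)%g = (phi trivial_word 2 s + 1)%N.
  move=> _ sx sex; apply: (phi_isolate trivial_rot trivial_cat trivial_catl) => //.
  exact: trivial_edge.
have KKe (x : mdart D) : (e x \in [set: mdart D]) = (x \in [set: mdart D]) by rewrite !inE.
(* All darts are detached here, so [v'] is the identity and the final face permutation is e, whose
   faces are the trivial bigons of isolated edges. *)
have [v' v'1 [le _]] := planar_detach (@medgeK _ D) (@medge_neq _ D) (@mplanar _ D) KKe step iso.
have {}v'1 : v' = 1%g by apply/perm.permP=> x; rewrite perm1 v'1 ?inE.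
have eE : phi trivial_word 2 e = #|porbits e|.
  have allg x : good_orbit trivial_word e x.
    have xc : fcycle e [:: x; e x] by rewrite /= medgeK !eqxx.
    rewrite (good_cycle trivial_rot xc) ?mem_head ?trivial_edge //=.
    by rewrite inE eq_sym medge_neq.
  have -> : phi trivial_word 2 e = #|good_orbits trivial_word e|.
    by rewrite /phi (_ : all_good _ _) ?muln0 ?addn0 //; exact/forallP.
  by apply: eq_card => O; apply/imsetP/imsetP=> -[x _ ->]; exists x => //; exact: allg.
have oneE : #|porbits (1 : {perm mdart D})%g| <= #|mdart D| by exact: leq_imset_card.
have := card_porbits_involution (@medgeK _ D) (@medge_neq _ D).
rewrite v'1 mulg1 eE in le; rewrite cardsT in le.
have dD : d0 \in dbnd D by rewrite E mem_head.
rewrite -E -(good_cycle trivial_rot (dbnd_cycle D) (dbnd_uniq D) dD).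
move=> eE2; apply: contraT => bad; have nall : all_good trivial_word f = false.
  by apply/negbTE/forallPn; exists d0.
move: le oneE eE2 card_good_face; rewrite /phi nall.
move: #|mdart D| #|porbits e| #|porbits f| #|good_orbits _ _| #|porbits _| [exists x, _].
by move=> a b c d g []; rewrite /= => *; lia.
Qed.

End Disc.

Lemma pi1_incl_injective : injective (pi1_incl (K := Ki i0)).
Proof.
move=> g h; rewrite -[g]pi1_reprK -[h]pi1_reprK; move: (pi1_repr g) (pi1_repr h) => u v.
rewrite !pi1_incl_class => /pi1_classP uv; apply/pi1_classP.
pose w0 := u ++ word_inv v; set w := map (@sub_letter_val L (Ki i0)) w0.
have w_nil : homotopic w [::].
  rewrite /w map_cat; have -> : map (@sub_letter_val L (Ki i0)) (word_inv v) =
      @word_inv L (map (@sub_letter_val L (Ki i0)) v).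
    by rewrite /word_inv map_rev -!map_comp.
  exact: homotopic_trans (homotopic_catr _ uv) (homotopic_invr _).
have w_sub (j : 'I_(size w)) : sub_edge (Ki i0) (tnth (in_tuple w) j).1.
  have j0 : j < size w0 by rewrite -(size_map (@sub_letter_val L (Ki i0))) ltn_ord.
  have l0 := tnth (in_tuple w0) (Ordinal j0).
  rewrite (tnth_nth (sub_letter_val l0)) /= (nth_map l0) //.
  exact: set_mem (valP (nth l0 w0 j).1).
have w_exp := homotopic_exponent exp0 w_nil; rewrite big_nil in w_exp.
have [D Din] := disc_fold wedge weight exp0 w_sub w_exp
  ((homotopic_disc w_nil).2 (disc_nil L)).
have /asboolP := trivial_dbnd Din; rewrite (dart_wordE (dbnd_lam D)).
have -> : pmap (restrict_letter (Ki i0)) w = w0 by apply: map_pK; exact: restrict_sub_letter.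
move=> w0_nil; have := homotopic_catr v w0_nil; rewrite /w0 -catA /= => uv0.
apply: homotopic_trans uv0; apply: homotopic_sym.
by have := homotopic_catl u (homotopic_invl v); rewrite cats0.
Qed.

End Injectivity.

Theorem theorem3p8 (R : realType) (L : complex) (K : subcomplex L)
    (n : nat) (Ki : 'I_n -> subcomplex L) :
  0 < n ->
  is_wedge K Ki ->
  (forall i, full (Ki i)) ->
  (forall c, sub_cell K c -> exponent_sum_zero c) ->
  weight_test R K Ki ->
  VA_relative K /\
  ((forall c : cell L, exponent_sum_zero c) ->
   forall i, injective (pi1_incl (K := Ki i))).
Proof.
move=> _ wedge _ K_exp weight; split; first exact: VA_relative_of_weight_test wedge K_exp weight.
by move=> exp0 i; exact: pi1_incl_injective wedge weight exp0 i.
Qed.
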